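(* An $n$-dimensional Lorentzian manifold $(\mathcal{M},g)$ $(n\geq 3)$ equipped with a concircularly semi-symmetric metric connection $\overset{1}{\nabla}$ whose associated vector $P$ is a unit timelike vector field is a generalized Robertson-Walker (GRW) space-time.
   Context: A Lorentzian manifold is a pseudo-Riemannian manifold with a Lorentzian metric $g$ of signature $(-,+,+,\dots,+)$. $\overset{g}{\nabla}$ denotes the Levi-Civita connection of $g$. Given a covector (1-form) $\pi$ with associated vector field $P$, $\pi(\cdot)=g(\cdot,P)$, the semi-symmetric metric connection is $\overset{1}{\nabla}_XY=\overset{g}{\nabla}_XY+\pi(Y)X-g(X,Y)P$. It is called a concircularly semi-symmetric metric connection if $\pi$ satisfies $(\overset{g}{\nabla}_X\pi)(Y)-\pi(X)\pi(Y)=\omega\, g(X,Y)$ for all vector fields $X,Y$, where $\omega$ is an arbitrary scalar function. The vector field $P$ is unit timelike if $g(P,P)=-1$. An $n$-dimensional Lorentzian manifold ($n\geq 3$) is a generalized Robertson-Walker (GRW) space-time if the metric $g$ has the form $\mathrm{d}s^2=g_{ij}\mathrm{d}x^i\mathrm{d}x^j=-(\mathrm{d}t)^2+f(t)^2g^{*}_{\mu\nu}(\vec{x})\,\mathrm{d}x^\mu\mathrm{d}x^\nu$, where $t$ is time and $g^{*}_{\mu\nu}(\vec{x})$ is the metric of a Riemannian submanifold of dimension $n-1$; thus a GRW space-time can be represented by the warped product $-I\times f^2\mathcal{M}^{*}$, where $I$ is an open interval of the real line $\mathbb{R}$, $\mathcal{M}^{*}$ is a Riemannian $(n-1)$-dimensional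 manifold and $f>0$ is a smooth function (scale factor).
   Formalization: ''GRW space-time'' is read locally: each point has coordinates (t,x) in which g = -dt^2 + f(t)^2 g*(x); a global warped product -I x f^2 M* is not claimed, and fails e.g. for -dt^2 + e^{2t}|dx|^2 on R^n minus two points. *)

(* Defs.v *)
From HB Require Import structures.
From mathcomp Require Import all_boot all_order all_algebra.
From mathcomp Require Import all_classical all_reals all_analysis.

Set Implicit Arguments.
Unset Strict Implicit.
Unset Printing Implicit Defensive.

Import Order.TTheory GRing.Theory Num.Theory.
Import numFieldNormedType.Exports.

Local Open Scope classical_set_scope.
Local Open Scope ring_scope.

Definition iter_partial (R : realType) (n : nat) (W : normedModType R)
    (s : seq 'I_n) (f : 'rV[R]_n -> W) : 'rV[R]_n -> W :=
  foldr (fun i h => fun x => 'D_(delta_mx 0 i) h x) f s.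

(* C^oo on the open set U: the iterated partial derivatives of all orders exist
   and are continuous at the points of U. *)
Definition smooth_on (R : realType) (n : nat) (W : normedModType R)
    (U : set 'rV[R]_n) (f : 'rV[R]_n -> W) : Prop :=
  forall (s : seq 'I_n) (x : 'rV[R]_n), U x ->
    {for x, continuous (iter_partial s f)} /\
    forall i : 'I_n, derivable (iter_partial s f) x (delta_mx 0 i).

(* A homeomorphism from the open set cdom of T onto an open set of R^n; the
   values of cmap outside cdom, and of cinv outside cmap @` cdom, are
   irrelevant. *)
Record chart (R : realType) (n : nat) (T : topologicalType) := Chart {
  cdom : set T;
  cmap : T -> 'rV[R]_n;
  cinv : 'rV[R]_n -> T;
  cdom_open : open cdom;
  cimg_open : open (cmap @` cdom);
  cmapK : forall p, cdom p -> cinv (cmap p) = p;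
  cmap_continuous : {within cdom, continuous cmap};
  cinv_continuous : {within cmap @` cdom, continuous cinv} }.

Section Charts.
Context {R : realType} {n : nat} {T : topologicalType}.
Implicit Types c : chart R n T.

Definition cimg c : set 'rV[R]_n := cmap c @` cdom c.

Definition overlap c c' : set 'rV[R]_n := cmap c @` (cdom c `&` cdom c').

Definition transition c c' : 'rV[R]_n -> 'rV[R]_n := cmap c' \o cinv c.

Definition compatible c c' : Prop :=
  smooth_on (overlap c c') (transition c c') /\
  smooth_on (overlap c' c) (transition c' c).

End Charts.

(* The differentiable structure is a maximal atlas. *)
Record manifold (R : realType) (n : nat) := Manifold {
  carrier :> topologicalType;
  atlas : set (chart R n carrier);
  carrier_hausdorff : hausdorff_space carrier;
  carrier_second_countable : @second_countable carrier;
  atlas_cover : forall p : carrier, exists2 c, atlas c & cdom c p;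
  atlas_compatible : forall c c', atlas c -> atlas c' -> compatible c c';
  atlas_maximal :
    forall c, (forall c', atlas c' -> compatible c c') -> atlas c }.

Section Tensors.
Context {R : realType} {n : nat} (M : manifold R n).
Local Notation chartM := (chart R n M).

(* Tensor fields are given by their components in the charts of the atlas, as
   functions of the coordinates x.  Row i of the Jacobian matrix of a transition
   map holds the components of the i-th coordinate vector field in the new
   chart, whence the positions of J and J^T in the transformation laws. *)

Record vector_field := VectorField {
  vf_comp :> chartM -> 'rV[R]_n -> 'rV[R]_n;
  vf_smooth : forall c, atlas c -> smooth_on (cimg c) (vf_comp c);
  vf_law : forall c c', atlas c -> atlas c' ->
    forall x, overlap c c' x ->
      vf_comp c' (transition c c' x) =
        vf_comp c x *m jacobian (transition c c') x }.

Record covector_field := CovectorField {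
  cf_comp :> chartM -> 'rV[R]_n -> 'rV[R]_n;
  cf_smooth : forall c, atlas c -> smooth_on (cimg c) (cf_comp c);
  cf_law : forall c c', atlas c -> atlas c' ->
    forall x, overlap c c' x ->
      cf_comp c x =
        cf_comp c' (transition c c' x) *m (jacobian (transition c c') x)^T }.

Definition eta_mx : 'M[R]_n :=
  diag_mx (\row_(i < n) (if i == 0%N :> nat then -1 else 1)).

(* Signature (-,+,...,+): the rows of some invertible S are a basis in which
   the bilinear form with matrix A has matrix diag(-1,1,...,1). *)
Definition lorentzian (A : 'M[R]_n) : Prop :=
  exists2 S : 'M[R]_n, S \in unitmx & S *m A *m S^T = eta_mx.

Record lorentz_metric := LorentzMetric {
  g_comp :> chartM -> 'rV[R]_n -> 'M[R]_n;
  g_smooth : forall c, atlas c -> smooth_on (cimg c) (g_comp c);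
  g_sym : forall c, atlas c -> forall x, cimg c x -> (g_comp c x)^T = g_comp c x;
  g_lorentzian : forall c, atlas c -> forall x, cimg c x ->
    lorentzian (g_comp c x);
  g_law : forall c c', atlas c -> atlas c' ->
    forall x, overlap c c' x ->
      let J := jacobian (transition c c') x in
      g_comp c x = J *m g_comp c' (transition c c' x) *m J^T }.

(* An affine connection, given by its connection coefficients: gam c x i j is
   the row of the components of the covariant derivative of the j-th coordinate
   vector field of c along the i-th one. *)
Record connection := Connection {
  gam :> chartM -> 'rV[R]_n -> 'I_n -> 'I_n -> 'rV[R]_n;
  gam_smooth : forall c, atlas c -> forall i j,
    smooth_on (cimg c) (fun x => gam c x i j);
  gam_law : forall c c', atlas c -> atlas c' ->
    forall x, overlap c c' x -> forall i j,
      let J := jacobian (transition c c') x in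
      gam c x i j *m J =
        'D_(delta_mx 0 i) ('D_(delta_mx 0 j) (transition c c')) x +
        \sum_(a < n) \sum_(b < n)
          (J i a * J j b) *: gam c' (transition c c' x) a b }.

(* Below, X, Y, Z : 'rV[R]_n -> 'rV[R]_n are vector fields on the domain of a
   chart c, in components.  All identities between vector fields X, Y, Z are
   local, so they are required for the vector fields on chart domains. *)

Definition local_field (c : chartM) (X : 'rV[R]_n -> 'rV[R]_n) : Prop :=
  smooth_on (cimg c) X.

Definition inner (g : lorentz_metric) (c : chartM)
    (X Y : 'rV[R]_n -> 'rV[R]_n) : 'rV[R]_n -> R :=
  fun x => (X x *m g c x *m (Y x)^T) 0 0.

Definition pairing (pi : covector_field) (c : chartM)
    (X : 'rV[R]_n -> 'rV[R]_n) : 'rV[R]_n -> R :=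
  fun x => (pi c x *m (X x)^T) 0 0.

Definition deriv_along (X : 'rV[R]_n -> 'rV[R]_n) (h : 'rV[R]_n -> R) :
    'rV[R]_n -> R :=
  fun x => 'D_(X x) h x.

Definition bracket (X Y : 'rV[R]_n -> 'rV[R]_n) : 'rV[R]_n -> 'rV[R]_n :=
  fun x => 'D_(X x) Y x - 'D_(Y x) X x.

Definition nabla (D : connection) (c : chartM)
    (X Y : 'rV[R]_n -> 'rV[R]_n) : 'rV[R]_n -> 'rV[R]_n :=
  fun x => 'D_(X x) Y x +
    \sum_(i < n) \sum_(j < n) (X x 0 i * Y x 0 j) *: D c x i j.

Definition nabla_covector (D : connection) (pi : covector_field) (c : chartM)
    (X Y : 'rV[R]_n -> 'rV[R]_n) : 'rV[R]_n -> R :=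
  fun x => deriv_along X (pairing pi c Y) x - pairing pi c (nabla D c X Y) x.

Definition torsion_free (D : connection) : Prop :=
  forall c, atlas c -> forall X Y, local_field c X -> local_field c Y ->
  forall x, cimg c x ->
    nabla D c X Y x - nabla D c Y X x = bracket X Y x.

Definition metric_compatible (g : lorentz_metric) (D : connection) : Prop :=
  forall c, atlas c ->
  forall X Y Z, local_field c X -> local_field c Y -> local_field c Z ->
  forall x, cimg c x ->
    deriv_along X (inner g c Y Z) x =
      inner g c (nabla D c X Y) Z x + inner g c Y (nabla D c X Z) x.

Definition levi_civita (g : lorentz_metric) (D : connection) : Prop :=
  torsion_free D /\ metric_compatible g D.

Definition associated_vector (g : lorentz_metric) (pi : covector_field)
    (P : vector_field) : Prop :=
  forall c, atlas c -> forall X, local_field c X -> forall x, cimg c x ->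
    pairing pi c X x = inner g c X (P c) x.

Definition semi_symmetric_metric (g : lorentz_metric) (Dg : connection)
    (pi : covector_field) (P : vector_field) (D1 : connection) : Prop :=
  forall c, atlas c -> forall X Y, local_field c X -> local_field c Y ->
  forall x, cimg c x ->
    nabla D1 c X Y x =
      nabla Dg c X Y x + pairing pi c Y x *: X x - inner g c X Y x *: P c x.

Definition concircular (g : lorentz_metric) (Dg : connection)
    (pi : covector_field) : Prop :=
  exists w : M -> R,
  forall c, atlas c -> forall X Y, local_field c X -> local_field c Y ->
  forall x, cimg c x ->
    nabla_covector Dg pi c X Y x - pairing pi c X x * pairing pi c Y x =
      w (cinv c x) * inner g c X Y x.

Definition concircularly_semi_symmetric_metric (g : lorentz_metric)
    (Dg : connection) (pi : covector_field) (P : vector_field)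
    (D1 : connection) : Prop :=
  semi_symmetric_metric g Dg pi P D1 /\ concircular g Dg pi.

Definition unit_timelike (g : lorentz_metric) (P : vector_field) : Prop :=
  forall c, atlas c -> forall x, cimg c x -> inner g c (P c) (P c) x = -1.

End Tensors.

Definition riemannian_on (R : realType) (m : nat) (V : set 'rV[R]_m)
    (h : 'rV[R]_m -> 'M[R]_m) : Prop :=
  [/\ smooth_on V h,
      forall y, V y -> (h y)^T = h y
    & forall y, V y -> forall v : 'rV[R]_m, v != 0 ->
        0 < (v *m h y *m v^T) 0 0].

(* The chart c identifies its domain with the warped product of an open
   interval I, carrying -(dt)^2, and the open set V of R^m, carrying the
   Riemannian metric h: in the coordinates (t, y) of c, g = -(dt)^2 + f(t)^2 h.
   The coordinate space R^(m.+1) is convertible to R^(1 + m). *)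
Definition warped_chart (R : realType) (m : nat) (M : manifold R m.+1)
    (g : lorentz_metric M) (c : chart R m.+1 M) : Prop :=
  exists (I : set R) (V : set 'rV[R]_m) (f : R -> R) (h : 'rV[R]_m -> 'M[R]_m),
  [/\ open I /\ is_interval I,
      forall t, I t -> 0 < f t /\ forall k, derivable (derive1n k f) t 1,
      open V /\ riemannian_on V h,
      cimg c = [set x : 'rV[R]_(1 + m) | I (lsubmx x 0 0) /\ V (rsubmx x)]
    & forall x : 'rV[R]_(1 + m), cimg c x ->
        g c x = block_mx (- 1%:M) 0 0 (f (lsubmx x 0 0) ^+ 2 *: h (rsubmx x))
             :> 'M[R]_(1 + m)].

(* The warped form holds in suitable coordinates around each point.  This is
   local: removing points from a space-time preserves the existence of P, but
   in general not that of a global decomposition as a warped product. *)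
Definition is_GRW (R : realType) (m : nat) (M : manifold R m.+1)
    (g : lorentz_metric M) : Prop :=
  forall p : M, exists c : chart R m.+1 M,
    [/\ atlas c, cdom c p & warped_chart g c].

(* Main.v *)
Require Import Defs.
From HB Require Import structures.
From mathcomp Require Import all_boot all_order all_algebra.
From mathcomp Require Import all_classical all_reals all_analysis.
From mathcomp Require Import ring lra.

(** In a chart where P is the coordinate field d/dt, the one-form pi = g(., P) is
    related to the metric in two ways. First, pi is closed: concircularity says
    that nabla pi = pi pi + w g, a symmetric tensor, and the Levi-Civita connection
    has no torsion. So locally pi = - dT, and P(T) = - pi(P) = - g(P, P) = 1.
    Second, raising an index gives nabla_X P = w X + pi(X) P, and since P has
    constant length, X = P shows that w = 1. The Lie derivative of g along P is
    therefore 2 (g + pi pi) (lemma metric_derivative).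

    Suppose that coordinates (t, y) are chosen so that P = d/dt and T = t. Then
    pi = - dt means that g has the first row (-1, 0, ..., 0), and the Lie
    derivative says that the remaining entries satisfy dg_ij/dt = 2 g_ij. Hence
    g = - dt^2 + exp(2t) h(y), and h is positive definite because the negative
    direction of the signature is used up by d/dt (lemma spacelike_complement).
    This is the warped form with scale factor exp.

    Such coordinates exist because P(T) = 1: start on the level set T = 0 and
    follow the flow of P for the time t. The level set is itself parametrized by
    a flow, that of a multiple of a coordinate field along which T grows at unit
    speed (lemma straightening). The inverse coordinate change is then given by
    the same flows. Maximality of the atlas turns it into a chart (lemmas
    refined_chart and adapted_chart).

    Most of the file serves to show that flows of smooth vector fields exist and
    are smooth jointly in time and initial point. Existence is by Picard iteration
    (local_solution). Difference quotients with respect to the initial point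
    satisfy the linearized equation up to small errors, so they converge by the
    inequality of Gronwall, and their limit solves the linearized equation
    (variational_equation). Derivatives of all orders are then handled by a
    coinduction principle (smooth_coind): a set of functions whose first partial
    derivatives are polynomials in members of the set consists of smooth
    functions. It applies to all functions of the form G (psi t x), where psi is
    a family of integral curves of any smooth field in any dimension, because a
    derivative of such a function involves only the integral curves of the field
    lifted to the tangent space (smooth_flow). *)

Set Implicit Arguments.
Unset Strict Implicit.
Unset Printing Implicit Defensive.

Import Order.TTheory GRing.Theory Num.Theory.
Import numFieldNormedType.Exports.

Local Open Scope classical_set_scope.
Local Open Scope ring_scope.

(** * Mean value estimates in one variable *)

Section OneVariable.
Context {R : realType}.

Lemma scale_mul (a b : R) : a *: b = a * b. Proof. by []. Qed.

Lemma near_forall (T : topologicalType) (I : finType) (p : T)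
    (P : I -> T -> Prop) :
  (forall i, \forall x \near p, P i x) -> \forall x \near p, forall i, P i x.
Proof. exact: filter_forall. Qed.

Lemma cvg_sumR (T : Type) (F : set_system T) (I : finType) (f : I -> T -> R)
    (l : I -> R) : Filter F ->
  (forall i, f i t @[t --> F] --> l i) ->
  \sum_i f i t @[t --> F] --> \sum_i l i.
Proof.
move=> FF h; apply: (@cvg_big _ _ _ _ _ _ _ F _ f l) => //.
move=> x; exact: add_continuous.
Qed.

(** Moves derivatives of functions of several variables to functions of one
    real variable, where the mean value theorem is available. *)
Lemma is_derive_line (V W : normedModType R) (f : V -> W) (x u : V) (s : R)
    (df : W) :
  is_derive (x + s *: u) u f df <->
  is_derive s 1 (fun s : R => f (x + s *: u)) df.
Proof.
pose g s : W := f (x + s *: u).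
have E : (fun h => h^-1 *: ((f \o shift (x + s *: u)) (h *: u) - f (x + s *: u))) =
         (fun h => h^-1 *: ((g \o shift s) (h *: 1) - g s)).
  apply/funext => h /=; rewrite /g; congr (_ *: (f _ - _)).
  by rewrite [h%:A]mulr1 scalerDl addrCA.
by split=> -[d e]; split; move: d e; rewrite /derivable /derive -/g E.
Qed.

Lemma MVT01 (f df : R -> R) :
  (forall s : R, 0 <= s <= 1 -> is_derive s 1 f (df s)) ->
  exists2 s : R, 0 <= s <= 1 & f 1 - f 0 = df s.
Proof.
move=> fd.
have [|||s s01 ->] := @MVT_segment R f df 0 1.
- exact: ler01.
- move=> x; rewrite in_itv/= => /andP[x0 x1]; apply: fd.
  by rewrite (ltW x0) (ltW x1).
- apply: derivable_within_continuous => x; rewrite in_itv/= => xi.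
  exact: (@ex_derive _ _ _ _ _ _ _ (fd _ xi)).
by exists s; [move: s01; rewrite in_itv | rewrite subr0 mulr1].
Qed.

(** The segment from a to b is parametrized by [0, 1], so that no order
    between a and b has to be assumed: integral curves run in both time
    directions. *)
Lemma MVT_from (f df : R -> R) (a b : R) :
  (forall s : R, 0 <= s <= 1 ->
     is_derive (a + s * (b - a)) 1 f (df (a + s * (b - a)))) ->
  exists2 s : R, 0 <= s <= 1 & f b - f a = (b - a) * df (a + s * (b - a)).
Proof.
move=> fd.
have [s s01|s s01] := @MVT01 (fun s => f (a + s * (b - a)))
  (fun s => (b - a) * df (a + s * (b - a))).
  have h1 : is_derive s 1 (fun s => a + s * (b - a)) (b - a).
    apply: is_derive_eq; rewrite ?scaler0 ?add0r ?addr0.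
    by rewrite mul1r [_%:A]mulr1.
  rewrite [X in is_derive _ _ _ X]mulrC.
  exact: (@is_derive1_comp R f (fun s => a + s * (b - a)) s _ _ (fd _ s01) h1).
rewrite mul1r mul0r addr0 (addrC a) subrK => e.
by exists s.
Qed.

Lemma MVT_bound (f df : R -> R) (a b C : R) :
  (forall s : R, 0 <= s <= 1 ->
     is_derive (a + s * (b - a)) 1 f (df (a + s * (b - a))) /\
     `|df (a + s * (b - a))| <= C) ->
  `|f b - f a| <= C * `|b - a|.
Proof.
move=> h; have [s s01|s s01 ->] := @MVT_from f df a b; first exact: (h _ s01).1.
by rewrite normrM mulrC ler_wpM2r//; exact: (h _ s01).2.
Qed.

End OneVariable.

(** * Coordinates and the sup norm *)

Section MatrixNorm.
Context {R : realType} {m n : nat}.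
Implicit Types A : 'M[R]_(m, n).

Lemma coord_le_norm A i j : `|A i j| <= `|A|.
Proof.
rewrite [leRHS]/Num.Def.normr/= mx_normrE.
exact: (le_bigmax _ (fun ij : 'I_m * 'I_n => `|A ij.1 ij.2|) (i, j)).
Qed.

Lemma norm_le_coord A c : 0 <= c -> (forall i j, `|A i j| <= c) -> `|A| <= c.
Proof.
move=> c0 h; rewrite [leLHS]/Num.Def.normr/= mx_normrE.
by apply: bigmax_le => // -[i j] _; exact: h.
Qed.

Lemma norm_lt_coord A c : 0 < c -> (forall i j, `|A i j| < c) -> `|A| < c.
Proof.
move=> c0 h; rewrite [ltLHS]/Num.Def.normr/= mx_normrE.
by apply: bigmax_lt => // -[i j] _; exact: h.
Qed.

Lemma cvg_coordP (T : Type) (F : set_system T) (f : T -> 'M[R]_(m, n)) A :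
  Filter F ->
  f @ F --> A <-> forall i j, (fun t => f t i j) @ F --> A i j.
Proof.
move=> FF; split=> [fA i j|h].
  apply/cvgrPdist_le => e e0; move/cvgrPdist_le: fA => /(_ e e0).
  apply: filterS => t; apply: le_trans.
  by have := coord_le_norm (A - f t) i j; rewrite !mxE.
apply/cvgrPdist_le => e e0.
have : \forall t \near F, forall ij : 'I_m * 'I_n, `|A ij.1 ij.2 - f t ij.1 ij.2| <= e.
  apply: filter_forall => -[i j].
  by move: (h i j) => /cvgrPdist_le/(_ e e0).
apply: filterS => t ht; apply: norm_le_coord; first exact: ltW.
by move=> i j; rewrite !mxE; exact: (ht (i, j)).
Qed.

Lemma continuous_coordP (T : topologicalType) (f : T -> 'M[R]_(m, n)) x :
  {for x, continuous f} <-> forall i j, {for x, continuous (fun t => f t i j)}.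
Proof. exact: cvg_coordP. Qed.

End MatrixNorm.

(** * Strict differentiability and the chain rule *)

Section Differentiation.
Context {R : realType} {n : nat}.
Implicit Types (f : 'rV[R]_n -> R) (p x y z : 'rV[R]_n).

Local Notation e_ i := (delta_mx (0 : 'I_1) i).

(** The partial derivatives exist near p but are continuous only at p, which
    is all that strict differentiability needs. *)
Definition C1_at f p := forall i,
  (\forall x \near p, derivable f x (e_ i)) /\ {for p, continuous ('D_(e_ i) f)}.

(** Both points of the increment move, not only one of them. This two-point
    form gives Lipschitz constants and compares neighbouring integral
    curves. *)
Lemma strict_diff f p : C1_at f p -> forall c : R, 0 < c ->
  exists2 r : R, 0 < r & forall y z, `|y - p| < r -> `|z - p| < r ->
    `|f y - f z - \sum_i (y 0 i - z 0 i) * 'D_(e_ i) f p| <= c * `|y - z|.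
Proof.
move=> fp c c0.
pose c' := c / n.+1%:R.
have c'0 : 0 < c' by rewrite divr_gt0.
have : \forall x \near p, forall i : 'I_n, derivable f x (e_ i) /\
    `|'D_(e_ i) f x - 'D_(e_ i) f p| <= c'.
  apply: near_forall => i; have [d1 d2] := fp i.
  apply: filterI; first exact: d1.
  move/cvgrPdist_le : d2 => /(_ _ c'0).
  by apply: filterS => x; rewrite distrC.
move=> /nbhs_normP[r /= r0 hr]; exists r => // y z yp zp.
(* The points w k lead from z to y by changing one coordinate at a time, so
   that every increment is governed by a single partial derivative. *)
pose w k : 'rV[R]_n := \row_i if (i < k)%N then y 0 i else z 0 i.
have w0 : w 0%N = z by apply/rowP => i; rewrite mxE.
have wn : w n = y by apply/rowP => i; rewrite mxE ltn_ord.
have -> : f y - f z = \sum_(i < n) (f (w i.+1) - f (w i)).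
  by rewrite -wn -w0 -(telescope_sumr (f \o w) (leq0n n)) big_mkord.
rewrite -sumrB; apply: le_trans (ler_norm_sum _ _ _) _.
have -> : c = \sum_(i < n.+1) c'.
  by rewrite sumr_const card_ord -mulr_natr divfK.
rewrite mulr_suml big_ord_recl [leRHS]addrC -[leLHS]addr0.
apply: lerD; last by rewrite mulr_ge0// ltW.
apply: ler_sum => i _.
pose a := y 0 i - z 0 i.
have stp s : 0 <= s <= 1 -> `|w i + (s * a) *: e_ i - p| < r.
  move=> /andP[s0 s1].
  apply: norm_lt_coord => // k j; rewrite !mxE (ord1 k) eqxx /=.
  case: (eqVneq j i) => [->|ji].
    rewrite ltnn mulr1 /a.
    have -> : z 0 i + s * (y 0 i - z 0 i) - p 0 i =
      s * (y 0 i - p 0 i) + (1 - s) * (z 0 i - p 0 i) by ring.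
    apply: le_lt_trans (ler_normD _ _) _.
    rewrite !normrM ger0_norm// (@ger0_norm _ (1 - s)) ?subr_ge0//.
    have -> : r = s * r + (1 - s) * r by ring.
    have hy : `|y 0 i - p 0 i| < r.
      by apply: le_lt_trans yp; have := coord_le_norm (y - p) 0 i; rewrite !mxE.
    have hz : `|z 0 i - p 0 i| < r.
      by apply: le_lt_trans zp; have := coord_le_norm (z - p) 0 i; rewrite !mxE.
    have [s0'|s0'] := eqVneq s 0.
      by rewrite s0' !mul0r !add0r subr0 !mul1r.
    by apply: ltr_leD; [rewrite ltr_pM2l// lt_neqAle eq_sym s0'|
       rewrite ler_wpM2l ?subr_ge0// ltW].
  rewrite mulr0 addr0; case: ifP => _.
    by apply: le_lt_trans yp; have := coord_le_norm (y - p) 0 j; rewrite !mxE.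
  by apply: le_lt_trans zp; have := coord_le_norm (z - p) 0 j; rewrite !mxE.
have wS : w i.+1 = w i + a *: e_ i.
  apply/rowP => j; rewrite !mxE eqxx/= /a.
  case: (eqVneq j i) => [->|ji]; first by rewrite leqnn ltnn mulr1 addrC subrK.
  by rewrite mulr0 addr0 ltnS leq_eqVlt (inj_eq val_inj) (negbTE ji).
have [s s01|s s01 H] := @MVT_from R (fun s => f (w i + s *: e_ i))
    (fun s => 'D_(e_ i) f (w i + s *: e_ i)) 0 a.
  rewrite subr0 add0r; apply: (is_derive_line _ _ _ _ _).1.
  apply: derivableP; apply: (hr _ _ i).1; rewrite /ball_/= distrC; exact: stp.
move: H; rewrite subr0 add0r scale0r addr0 -wS => ->.
rewrite -mulrBr normrM mulrC ler_pM//.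
  apply: (hr _ _ i).2; rewrite /ball_/= distrC; exact: stp.
by have := coord_le_norm (y - z) 0 i; rewrite !mxE.
Qed.

End Differentiation.

Section Chain.
Context {R : realType} {n : nat} {V : normedModType R}.

Local Notation e_ i := (delta_mx (0 : 'I_1) i).

(** The inner map is only assumed to have a derivative along the one
    direction v; the error of the outer linear approximation is controlled
    by strict_diff at the two points g (x + h v) and g x. *)
Lemma is_derive_chain (f : 'rV[R]_n -> R) (g : V -> 'rV[R]_n) (x v : V)
    (d : 'I_n -> R) :
  C1_at f (g x) -> (forall i, is_derive x v (fun y => g y 0 i) (d i)) ->
  is_derive x v (f \o g) (\sum_i d i * 'D_(e_ i) f (g x)).
Proof.
move=> fC1 gd.
pose Q i (h : R) : R := h^-1 *: (g (h *: v + x) 0 i - g x 0 i).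
have Qd i : Q i h @[h --> 0^'] --> d i.
  have [d1 d2] := gd i; rewrite -d2; exact: d1.
have gx : g (h *: v + x) @[h --> 0^'] --> g x.
  apply/cvg_coordP => k i; rewrite (ord1 k).
  have : (g x 0 i + h * Q i h) @[h --> (0:R)^'] --> g x 0 i + 0 * d i.
    apply: cvgD; first exact: cvg_cst.
    by apply: cvgM (Qd i); exact: nbhs_dnbhs.
  rewrite mul0r addr0; apply: cvg_trans; apply: near_eq_cvg.
  near=> h; rewrite /Q.
  have h0 : h != 0 by near: h; exact: nbhs_dnbhs_neq.
  by rewrite scale_mul mulrA divff// mul1r addrC subrK.
have key : h^-1 *: (f (g (h *: v + x)) - f (g x)) @[h --> 0^'] -->
    \sum_i d i * 'D_(e_ i) f (g x).
  have S : \sum_i Q i h * 'D_(e_ i) f (g x) @[h --> 0^'] -->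
    \sum_i d i * 'D_(e_ i) f (g x).
    apply: cvg_sumR => i.
    by apply: cvgM (Qd i) _; exact: cvg_cst.
  have -> : (fun h : R => h^-1 *: (f (g (h *: v + x)) - f (g x))) =
    (fun h => (\sum_i Q i h * 'D_(e_ i) f (g x)) +
      (h^-1 *: (f (g (h *: v + x)) - f (g x)) -
       \sum_i Q i h * 'D_(e_ i) f (g x))).
    by apply/funext => h; rewrite [RHS]addrC subrK.
  rewrite -[X in _ --> X]addr0; apply: cvgD => //.
  apply/cvgrPdist_le => e e0.
  (* An eventual bound for the difference quotients of g in the sup norm. *)
  pose L := 1 + \sum_i `|d i|.
  have L0 : 0 < L by rewrite ltr_pwDl// sumr_ge0.
  have [r r0 hr] := strict_diff fC1 (divr_gt0 e0 L0).
  near=> h.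
  rewrite sub0r normrN.
  have h0 : h != 0 by near: h; exact: nbhs_dnbhs_neq.
  have := hr (g (h *: v + x)) (g x).
  rewrite subrr normr0 => /(_ _ r0) /[dup] H.
  have gr : `|g (h *: v + x) - g x| < r.
    near: h; move/cvgrPdist_lt: gx => /(_ _ r0).
    by apply: filterS => h; rewrite distrC.
  move=> /(_ gr) {}H.
  have -> : h^-1 *: (f (g (h *: v + x)) - f (g x)) - \sum_i Q i h * 'D_(e_ i) f (g x)
    = h^-1 * (f (g (h *: v + x)) - f (g x) -
      \sum_i (g (h *: v + x) 0 i - g x 0 i) * 'D_(e_ i) f (g x)).
    rewrite mulrBr mulr_sumr; congr (_ - _).
    by apply: eq_bigr => i _; rewrite /Q scale_mul -mulrA.
  rewrite normrM normfV mulrC ler_pdivrMr ?normr_gt0//.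
  apply: le_trans H _.
  rewrite -mulrA ler_wpM2l ?(ltW e0)// ler_pdivrMl//.
  apply: norm_le_coord; first by rewrite mulr_ge0// ltW.
  move=> k i; rewrite (ord1 k) !mxE.
  have -> : g (h *: v + x) 0 i - g x 0 i = h * Q i h.
    by rewrite /Q scale_mul mulrA divff// mul1r.
  rewrite normrM mulrC ler_wpM2r//.
  have : `|Q i h| <= 1 + `|d i|.
    move: i; near: h; apply: filter_forall => i.
    move/cvgrPdist_le: (Qd i) => /(_ 1 ltr01); apply: filterS => h hh.
    rewrite -[Q i h](subrK (d i)) (le_trans (ler_normD _ _))// lerD2r distrC.
    exact: hh.
  move=> /le_trans; apply; rewrite lerD2l (bigD1 i)//= lerDl sumr_ge0//.
split; first by apply/cvg_ex; eexists; exact: key.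
exact/cvg_lim/key.
Unshelve. all: by end_near. Qed.

End Chain.

(** * Stability of smoothness *)

Section Smooth.
Context {R : realType} {n : nat}.
Implicit Types (U : set 'rV[R]_n) (W : normedModType R).

Local Notation e_ i := (delta_mx (0 : 'I_1) i).

Lemma near_continuous W (f g : 'rV[R]_n -> W) (x : 'rV[R]_n) :
  (\near x, f x = g x) -> {for x, continuous f} -> {for x, continuous g}.
Proof.
move=> fg fx; have e : f x = g x := nbhs_singleton fg.
suff : g @ x --> f x by rewrite e.
exact: cvg_trans (near_eq_cvg fg) fx.
Qed.

Lemma eq_on_near W U (f g : 'rV[R]_n -> W) x : open U -> U x ->
  (forall y, U y -> f y = g y) -> \near x, f x = g x.
Proof. by move=> Uo Ux fg; near=> y; apply: fg; near: y; exact: open_nbhs_nbhs.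
Unshelve. all: by end_near. Qed.

Lemma smooth_on_ext W U (f g : 'rV[R]_n -> W) : open U ->
  (forall x, U x -> f x = g x) -> smooth_on U f -> smooth_on U g.
Proof.
move=> Uo fg fs.
have E s : forall x, U x -> iter_partial s f x = iter_partial s g x.
  elim: s => //= i s IH x Ux.
  exact: near_eq_derive (eq_on_near Uo Ux IH).
move=> s x Ux; have [c d] := fs s x Ux.
have nE := eq_on_near Uo Ux (E s); split; first exact: near_continuous c.
by move=> i; exact: near_eq_derivable (d i).
Qed.

Lemma smooth_on_sub W U U' (f : 'rV[R]_n -> W) :
  U' `<=` U -> smooth_on U f -> smooth_on U' f.
Proof. by move=> UU fs s x /UU; exact: fs. Qed.

Lemma smooth_continuous W U (f : 'rV[R]_n -> W) x :
  smooth_on U f -> U x -> {for x, continuous f}.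
Proof. by move=> fs Ux; exact: (fs [::] x Ux).1. Qed.

Lemma smooth_derivable W U (f : 'rV[R]_n -> W) x i :
  smooth_on U f -> U x -> derivable f x (e_ i).
Proof. by move=> fs Ux; exact: (fs [::] x Ux).2. Qed.

Lemma smooth_partial W U (f : 'rV[R]_n -> W) i :
  smooth_on U f -> smooth_on U ('D_(e_ i) f).
Proof.
by move=> fs s x Ux; have := fs (rcons s i) x Ux; rewrite /iter_partial foldr_rcons.
Qed.

Lemma derive_coord (V : normedModType R) m k (F : V -> 'M[R]_(m, k)) x v i j :
  derivable F x v -> 'D_v F x i j = 'D_v (fun y => F y i j) x.
Proof. by move=> d; rewrite derive_mx// mxE. Qed.

(** Lets every argument on smoothness be carried out with real valued
    functions, which form a ring. *)
Lemma smooth_coordP m k U (f : 'rV[R]_n -> 'M[R]_(m, k)) : open U ->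
  smooth_on U f <-> forall i j, smooth_on U (fun x => f x i j).
Proof.
move=> Uo; split=> [fs i j|fs].
  have E s : forall x, U x ->
      iter_partial s f x i j = iter_partial s (fun x => f x i j) x.
    elim: s => //= a s IH x Ux; rewrite derive_coord; last exact: (fs s x Ux).2.
    exact: near_eq_derive (eq_on_near Uo Ux IH).
  move=> s x Ux; have [c d] := fs s x Ux.
  have nE := eq_on_near Uo Ux (E s); split.
    apply: near_continuous nE _; have /continuous_coordP := c; exact.
  move=> a; apply: near_eq_derivable nE _.
  by have /derivable_mxP := d a; exact.
have D s a x (E : forall x, U x -> forall i j,
      iter_partial s f x i j = iter_partial s (fun x => f x i j) x) : U x ->
    derivable (iter_partial s f) x (e_ a).
  move=> Ux; apply/derivable_mxP => i j.
  apply: near_eq_derivable ((fs i j s x Ux).2 a).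
  by apply: eq_on_near Uo Ux _ => y Uy; rewrite E.
have E s : forall x, U x -> forall i j,
    iter_partial s f x i j = iter_partial s (fun x => f x i j) x.
  elim: s => //= a s IH x Ux i j; rewrite derive_coord; last exact: D.
  by apply: near_eq_derive (eq_on_near Uo Ux _) => y Uy; exact: IH.
move=> s x Ux; split; last by move=> a; exact: D (E s) _.
apply/continuous_coordP => i j.
apply: near_continuous ((fs i j s x Ux).1).
by apply: eq_on_near Uo Ux _ => y Uy; rewrite E.
Qed.

Lemma smooth_rowP m U (f : 'rV[R]_n -> 'rV[R]_m) : open U ->
  smooth_on U f <-> forall j, smooth_on U (fun x => f x 0 j).
Proof.
move=> Uo; split=> [fs j|fs]; first exact: (smooth_coordP f Uo).1 fs 0 j.
apply: (smooth_coordP f Uo).2 => i j; rewrite (ord1 i); exact: fs.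
Qed.

Lemma smooth_C1 U (f : 'rV[R]_n -> R) p : open U -> smooth_on U f -> U p ->
  C1_at f p.
Proof.
move=> Uo fs Up i; split.
  by apply: filterS (open_nbhs_nbhs (conj Uo Up)) => x; exact: smooth_derivable.
exact: smooth_continuous (smooth_partial i fs) Up.
Qed.

Inductive algebra_of (G : set ('rV[R]_n -> R)) : set ('rV[R]_n -> R) :=
| alg_gen g : G g -> algebra_of G g
| alg_cst c : algebra_of G (fun=> c)
| alg_add f g : algebra_of G f -> algebra_of G g ->
    algebra_of G (fun x => f x + g x)
| alg_mul f g : algebra_of G f -> algebra_of G g ->
    algebra_of G (fun x => f x * g x).

Lemma alg_sum G (I : finType) (f : I -> 'rV[R]_n -> R) :
  (forall i, algebra_of G (f i)) -> algebra_of G (fun x => \sum_i f i x).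
Proof.
move=> h; rewrite -[index_enum I]/(index_enum I).
elim: (index_enum I) => [|i s IH].
  by under eq_fun do rewrite big_nil; exact: alg_cst.
by under eq_fun do rewrite big_cons; exact: alg_add.
Qed.

Lemma algebra_of_C1 G U : open U ->
  (forall g x, G g -> U x -> {for x, continuous g} /\
     forall i, derivable g x (e_ i)) ->
  forall f x, algebra_of G f -> U x -> {for x, continuous f} /\
     forall i, derivable f x (e_ i).
Proof.
move=> Uo h f x Gf Ux; elim: Gf => {f}.
- by move=> g Gg; exact: h.
- move=> c; split; first exact: cst_continuous.
  by move=> i; exact: derivable_cst.
- move=> f g _ [fc fd] _ [gc gd]; split; first exact: (continuousD fc gc).
  by move=> i; exact: (derivableD (fd i) (gd i)).
- move=> f g _ [fc fd] _ [gc gd]; split; first exact: (continuousM fc gc).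
  by move=> i; exact: (derivableM (fd i) (gd i)).
Qed.

(** Smoothness by coinduction. If the partial derivatives of the functions
    in G are polynomials in functions of G, then, by the rules for sums and
    products, the whole ring generated by G is closed under partial
    derivatives, so that derivatives of all orders exist and are continuous.
    All closure properties of smooth functions below, and the smoothness of
    flows, come from a suitable choice of G. *)
Lemma smooth_coind G U : open U ->
  (forall g x, G g -> U x -> {for x, continuous g} /\
     forall i, derivable g x (e_ i)) ->
  (forall g i, G g ->
     exists2 h, algebra_of G h & forall x, U x -> 'D_(e_ i) g x = h x) ->
  forall f, algebra_of G f -> smooth_on U f.
Proof.
move=> Uo GC GD f Gf.
have C := algebra_of_C1 Uo GC.
have D g i : algebra_of G g ->
    exists2 h, algebra_of G h & forall x, U x -> 'D_(e_ i) g x = h x.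
  elim=> {g}.
  - by move=> g; exact: GD.
  - move=> c; exists (fun=> 0); first exact: alg_cst.
    by move=> x _; exact: derive_cst.
  - move=> f1 f2 G1 [h1 H1 E1] G2 [h2 H2 E2].
    exists (fun x => h1 x + h2 x); first exact: alg_add.
    move=> x Ux; rewrite -E1// -E2//.
    exact: (deriveD ((C _ _ G1 Ux).2 i) ((C _ _ G2 Ux).2 i)).
  - move=> f1 f2 G1 [h1 H1 E1] G2 [h2 H2 E2].
    exists (fun x => f1 x * h2 x + f2 x * h1 x).
      by apply: alg_add; apply: alg_mul.
    move=> x Ux; rewrite -E1// -E2//.
    exact: (deriveM ((C _ _ G1 Ux).2 i) ((C _ _ G2 Ux).2 i)).
have E s : exists2 h, algebra_of G h &
    forall x, U x -> iter_partial s f x = h x.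
  elim: s => [|i s [h H Eh]]; first by exists f.
  have [h' H' Eh'] := D h i H; exists h' => // x Ux /=.
  rewrite -Eh'//; exact: near_eq_derive (eq_on_near Uo Ux Eh).
move=> s x Ux; have [h H Eh] := E s; have [c d] := C _ _ H Ux.
have nE : \near x, h x = iter_partial s f x.
  by apply: eq_on_near Uo Ux _ => y Uy; rewrite Eh.
by split=> [|i]; [exact: near_continuous c|exact: near_eq_derivable (d i)].
Qed.

Lemma smooth_algebra U f : open U -> algebra_of (smooth_on U) f -> smooth_on U f.
Proof.
move=> Uo; apply: smooth_coind => // [g x gs Ux|g i gs].
  split; first exact: smooth_continuous Ux.
  by move=> i; exact: smooth_derivable Ux.
by exists ('D_(e_ i) g) => //; apply: alg_gen; exact: smooth_partial.
Qed.

Opaque smooth_on.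

Lemma smooth_cst U c : open U -> smooth_on U (fun=> c : R).
Proof. by move=> Uo; apply: smooth_algebra => //; exact: alg_cst. Qed.

Lemma smooth_add U (f g : 'rV[R]_n -> R) : open U ->
  smooth_on U f -> smooth_on U g -> smooth_on U (fun x => f x + g x).
Proof. by move=> Uo fs gs; apply: smooth_algebra => //; apply: alg_add; exact: alg_gen. Qed.

Lemma smooth_mul U (f g : 'rV[R]_n -> R) : open U ->
  smooth_on U f -> smooth_on U g -> smooth_on U (fun x => f x * g x).
Proof. by move=> Uo fs gs; apply: smooth_algebra => //; apply: alg_mul; exact: alg_gen. Qed.

Lemma smooth_sum U (I : finType) (f : I -> 'rV[R]_n -> R) : open U ->
  (forall i, smooth_on U (f i)) -> smooth_on U (fun x => \sum_i f i x).
Proof. by move=> Uo fs; apply: smooth_algebra => //; apply: alg_sum => i; exact: alg_gen. Qed.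

Lemma smooth_opp U (f : 'rV[R]_n -> R) : open U ->
  smooth_on U f -> smooth_on U (fun x => - f x).
Proof.
move=> Uo fs; have -> : (fun x => - f x) = (fun x => -1 * f x).
  by apply/funext => x; rewrite mulN1r.
by apply: smooth_mul fs => //; exact: smooth_cst.
Qed.

Lemma is_derive_coord (x v : 'rV[R]_n) i : is_derive x v (fun y => y 0 i) (v 0 i).
Proof.
have /derivable_mxP h := @derivable_id R 'rV[R]_n x v.
by split; [exact: h|rewrite -[in RHS](@derive_id R 'rV[R]_n x v) derive_coord].
Qed.

Lemma smooth_coordinate U i : open U -> smooth_on U (fun x => x 0 i).
Proof.
move=> Uo; pose G : set ('rV[R]_n -> R) :=
  [set (fun x : 'rV[R]_n => x 0 i)].
apply: (@smooth_coind G) => //; last exact: alg_gen.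
- move=> _ x -> Ux; split; last first.
    by move=> j; have [] := is_derive_coord x (e_ j) i.
  exact: ((continuous_coordP id x).1 (@cvg_id _ (nbhs x)) 0 i).
- move=> _ j ->; exists (fun=> e_ j 0 i); first exact: alg_cst.
  by move=> x Ux; have [] := is_derive_coord x (e_ j) i.
Qed.

(** Here G consists of the smooth functions and 1/f: a derivative of 1/f is a
    polynomial in 1/f and a derivative of f. *)
Lemma smooth_inv U (f : 'rV[R]_n -> R) : open U -> (forall x, U x -> f x != 0) ->
  smooth_on U f -> smooth_on U (fun x => (f x)^-1).
Proof.
move=> Uo f0 fs.
pose G : set ('rV[R]_n -> R) := smooth_on U `|` [set fun x => (f x)^-1].
apply: (@smooth_coind G) => //; last by apply: alg_gen; right.
- move=> g x [gs|->] Ux.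
    split; first exact: smooth_continuous Ux.
    by move=> i; exact: smooth_derivable Ux.
  split; first by apply: continuousV (f0 _ Ux) _; exact: smooth_continuous Ux.
  by move=> i; apply: derivableV (f0 _ Ux) _; exact: smooth_derivable Ux.
- move=> g i [gs|->].
    by exists ('D_(e_ i) g) => //; apply: alg_gen; left; exact: smooth_partial.
  exists (fun x => (- 1 * ((f x)^-1 * (f x)^-1)) * 'D_(e_ i) f x).
    apply: alg_mul; last by apply: alg_gen; left; exact: smooth_partial.
    apply: alg_mul; first exact: alg_cst.
    by apply: alg_mul; apply: alg_gen; right.
  move=> x Ux; rewrite deriveV//; [|exact: f0|exact: smooth_derivable Ux].
  by rewrite scale_mul mulN1r -exprVn expr2.
Qed.

End Smooth.

Section SmoothComposition.
Context {R : realType} {n m : nat}.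
Implicit Types (U : set 'rV[R]_n) (V : set 'rV[R]_m).
Opaque smooth_on.

Local Notation e_ i := (delta_mx (0 : 'I_1) i).

(** Here G consists of the smooth functions and of the compositions k \o g
    for all smooth k at once: by the chain rule, the derivatives of such a
    composition involve compositions of the partial derivatives of k. *)
Lemma smooth_comp U V (f : 'rV[R]_m -> R) (g : 'rV[R]_n -> 'rV[R]_m) :
  open U -> open V -> (forall x, U x -> V (g x)) ->
  smooth_on V f -> smooth_on U g -> smooth_on U (f \o g).
Proof.
move=> Uo Vo UV fs gs.
pose G : set ('rV[R]_n -> R) := smooth_on U `|`
  [set h | exists2 f, smooth_on V f & h = f \o g].
have chain k x i : smooth_on V k -> U x -> is_derive x (e_ i) (k \o g)
    (\sum_j 'D_(e_ i) (fun y => g y 0 j) x * 'D_(e_ j) k (g x)).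
  move=> ks Ux; apply: is_derive_chain; first exact: smooth_C1 (UV _ Ux).
  move=> j; apply: derivableP; apply: smooth_derivable Ux.
  by exact: (smooth_rowP g Uo).1 gs j.
apply: (@smooth_coind _ _ G) => //; last by apply: alg_gen; right; exists f.
- move=> h x [hs|[k ks ->]] Ux.
    split; first exact: smooth_continuous Ux.
    by move=> i; exact: smooth_derivable Ux.
  split; last by move=> i; have [] := chain k x i ks Ux.
  apply: continuous_comp; first exact: smooth_continuous Ux.
  exact: smooth_continuous (UV _ Ux).
- move=> h i [hs|[k ks ->]].
    by exists ('D_(e_ i) h) => //; apply: alg_gen; left; exact: smooth_partial.
  exists (fun x => \sum_j 'D_(e_ i) (fun y => g y 0 j) x * ('D_(e_ j) k \o g) x).
    apply: alg_sum => j; apply: alg_mul; apply: alg_gen.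
      left; apply: smooth_partial; exact: (smooth_rowP g Uo).1 gs j.
    by right; exists ('D_(e_ j) k); [exact: smooth_partial|].
  by move=> x Ux; have [] := chain k x i ks Ux.
Qed.

Lemma smooth_comp_mx U V k l (f : 'rV[R]_m -> 'M[R]_(k, l))
    (g : 'rV[R]_n -> 'rV[R]_m) :
  open U -> open V -> (forall x, U x -> V (g x)) ->
  smooth_on V f -> smooth_on U g -> smooth_on U (f \o g).
Proof.
move=> Uo Vo UV /(smooth_coordP _ Vo) fs gs.
by apply/smooth_coordP => // i j; exact: (smooth_comp Uo Vo UV (fs i j) gs).
Qed.

Lemma smooth_affine U (A : 'M[R]_(n, m)) b : open U ->
  smooth_on U (fun x => x *m A + b).
Proof.
move=> Uo; apply/smooth_rowP => // j.
have -> : (fun x => (x *m A + b) 0 j) =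
    (fun x => \sum_i x 0 i * A i j + b 0 j).
  by apply/funext => x; rewrite !mxE.
apply: smooth_add => //; last exact: smooth_cst.
apply: smooth_sum => // i; apply: smooth_mul => //; last exact: smooth_cst.
exact: smooth_coordinate.
Qed.

End SmoothComposition.

(** * Curves: derivatives of limits, antiderivatives, uniqueness *)

Section Curves.
Context {R : realType}.

Lemma is_derive_rowP (V : normedModType R) n (F : V -> 'rV[R]_n) x v (d : 'rV[R]_n) :
  is_derive x v F d <-> forall i, is_derive x v (fun y => F y 0 i) (d 0 i).
Proof.
split=> [[D E] i|h].
  split; first by have /derivable_mxP := D; exact.
  by rewrite -derive_coord// E.
have D : derivable F x v.
  by apply/derivable_mxP => k i; rewrite (ord1 k); have [] := h i.
by split=> //; apply/rowP => i; rewrite derive_coord//; have [] := h i.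
Qed.

Lemma is_derive_continuous (V : normedModType R) (f : R -> V) (t : R) d :
  is_derive t 1 f d -> {for t, continuous f}.
Proof. by move=> [D _]; apply/differentiable_continuous/derivable1_diffP. Qed.

(** The derivative in its form without quotients, in which limits can be
    taken. *)
Lemma is_derive_small (h : R -> R) t d :
  (forall e : R, 0 < e -> exists2 r : R, 0 < r & forall s, `|s| < r ->
     `|h (t + s) - h t - s * d| <= e * `|s|) ->
  is_derive t 1 h d.
Proof.
move=> H.
have C : s^-1 *: (h (s *: 1 + t) - h t) @[s --> (0:R)^'] --> d.
  apply/cvgrPdist_le => e e0; have [r r0 hr] := H e e0.
  near=> s.
  have s0 : s != 0 by near: s; exact: nbhs_dnbhs_neq.
  have sr : `|s| < r by near: s; exact: dnbhs0_lt.
  rewrite scale_mul [s%:A]mulr1 (addrC s) distrC.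
  have -> : s^-1 * (h (t + s) - h t) - d = s^-1 * (h (t + s) - h t - s * d).
    by rewrite [RHS]mulrBr [in RHS]mulrA mulVf// mul1r.
  by rewrite normrM normfV mulrC ler_pdivrMr ?normr_gt0// hr.
split; first by apply/cvg_ex; exists d.
exact/cvg_lim/C.
Unshelve. all: by end_near. Qed.

(** Derivatives pass to the limit when they converge uniformly near t0. The
    mean value theorem bounds the linearization error of f i by a multiple
    of the step that does not depend on i, and this bound is inherited by
    the pointwise limit. *)
Lemma is_derive_limit (I : Type) (F : set_system I) (f df : I -> R -> R)
    (h g : R -> R) (t0 r : R) : ProperFilter F -> 0 < r ->
  (forall t, `|t - t0| < r -> f i t @[i --> F] --> h t) ->
  {for t0, continuous g} ->
  (\forall i \near F, forall t, `|t - t0| < r -> is_derive t 1 (f i) (df i t)) ->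
  (forall e : R, 0 < e ->
     \forall i \near F, forall t, `|t - t0| < r -> `|df i t - g t| <= e) ->
  is_derive t0 1 h (g t0).
Proof.
move=> FF r0 fh gc fd U; apply: is_derive_small => e e0.
have e20 : 0 < e / 2 by rewrite divr_gt0.
move/cvgrPdist_le: gc => /(_ _ e20) /nbhs_normP[r' /= r'0 hr'].
exists (Num.min r r'); first by rewrite lt_min r0.
move=> s; rewrite lt_min => /andP[sr sr'].
have key : \forall i \near F, `|f i (t0 + s) - f i t0 - s * g t0| <= e * `|s|.
  near=> i.
  have di : forall t, `|t - t0| < r -> is_derive t 1 (f i) (df i t) by near: i.
  have ui : forall t, `|t - t0| < r -> `|df i t - g t| <= e / 2.
    by near: i; exact: U.
  have B u : 0 <= u <= 1 -> `|t0 + u * (t0 + s - t0) - t0| <= `|s|.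
    move=> /andP[u0 u1]; have -> : t0 + u * (t0 + s - t0) - t0 = u * s by ring.
    by rewrite normrM ger0_norm// ler_piMl.
  have [u u01|u u01] := @MVT_from R (f i) (df i) t0 (t0 + s).
    by apply: di; exact: le_lt_trans (B _ u01) _.
  move=> ->; set x := t0 + u * _.
  have -> : (t0 + s - t0) * df i x - s * g t0 =
    s * ((df i x - g x) + (g x - g t0)) by ring.
  rewrite normrM mulrC ler_wpM2r//.
  rewrite [e]splitr (le_trans (ler_normD _ _))//.
  apply: lerD; first by apply: ui; exact: le_lt_trans (B _ u01) _.
  rewrite distrC; apply: hr'; rewrite /ball_/= distrC.
  exact: le_lt_trans (B _ u01) _.
have L : `|f i (t0 + s) - f i t0 - s * g t0| @[i --> F] -->
    `|h (t0 + s) - h t0 - s * g t0|.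
  apply: cvg_norm; apply: cvgB; last exact: cvg_cst.
  apply: cvgB; apply: fh; last by rewrite subrr normr0.
  by rewrite addrC addKr.
exact: (cvgr_to_le L key).
Unshelve. all: by end_near. Qed.

(** The fundamental theorem of calculus gives antiderivatives on segments
    only, since its integral has a fixed left end. *)
Lemma antiderivative_bounded (g : R -> R) (b : R) : continuous g -> 0 < b ->
  exists2 G : R -> R, G 0 = 0 & forall t : R, `|t| < b -> is_derive t 1 G (g t).
Proof.
move=> gc b0.
pose F (x : R) : R := (\int[lebesgue_measure]_(t in [set` `[- b, x]]) (g t))%R.
exists (fun x => F x - F 0); first by rewrite subrr.
move=> t; rewrite ltr_norml => /andP[bt tb].
have [|d e] := @continuous_FTC1_closed R g (- b) t b tb _ bt (gc t).
  apply: continuous_compact_integrable; first exact: segment_compact.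
  exact: continuous_subspaceT.
have : is_derive t 1 F (g t) by split; [exact: d|rewrite -derive1E].
move=> H.
have := @is_deriveB R R R F (fun=> F 0) t 1 _ _ H (is_derive_cst _ _ _).
by rewrite subr0.
Qed.

(** Uniqueness of antiderivatives, to which conservation laws along flows and
    the exponential growth of the metric are reduced. *)
Lemma eq_is_derive (f g df : R -> R) (a b : R) :
  (forall s, 0 <= s <= 1 -> is_derive (a + s * (b - a)) 1 f (df (a + s * (b - a)))
     /\ is_derive (a + s * (b - a)) 1 g (df (a + s * (b - a)))) ->
  f a = g a -> f b = g b.
Proof.
move=> h fg.
have := @MVT_bound R (fun x => f x - g x) (fun=> 0) a b 0.
rewrite mul0r fg subrr subr0 => H; apply/eqP; rewrite -subr_eq0 -normr_le0.
apply: H => s s01; split; last by rewrite normr0.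
have [h1 h2] := h s s01.
have := @is_deriveB R R R f g _ 1 _ _ h1 h2.
by rewrite subrr.
Qed.

(** Antiderivatives vanishing at 0 agree on common segments, so those on the
    segments [-b, b] glue together. *)
Lemma antiderivative (g : R -> R) : continuous g ->
  exists2 G : R -> R, G 0 = 0 & forall t : R, is_derive t 1 G (g t).
Proof.
move=> gc.
have /choice[G HG] : forall b : R, exists G : R -> R, 0 < b ->
    G 0 = 0 /\ forall t : R, `|t| < b -> is_derive t 1 G (g t).
  move=> b; have [b0|b0] := ltP 0 b; last by exists (fun=> 0).
  by have [G G0 Gd] := antiderivative_bounded gc b0; exists G.
(* The segment [-b, b] with b = |t| + 1 contains t in its interior. *)
pose H t := G (`|t| + 1) t.
have b1 (t : R) : 0 < `|t| + 1 by rewrite ltr_wpDl.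
exists H; first by rewrite /H normr0 add0r; exact: (HG 1 ltr01).1.
move=> t; have b2 : 0 < `|t| + 2 by rewrite ltr_wpDl.
apply: (@near_eq_is_derive R R R (G (`|t| + 2)) H); last first.
  by apply: (HG _ b2).2; rewrite ltrDl.
near=> s.
have st : `|s| < `|t| + 1.
  near: s; apply/nbhs_normP; exists 1; first exact: ltr01.
  move=> s /=; rewrite distrC => st.
  by rewrite -[s](subrK t) addrC (le_lt_trans (ler_normD _ _))// ltrD2l.
apply: (@eq_is_derive (G (`|t| + 2)) (G (`|s| + 1)) g 0 s) => [u /andP[u0 u1]|]; last first.
  by rewrite (HG _ b2).1 (HG _ (b1 s)).1.
rewrite subr0 add0r.
have us : `|u * s| <= `|s| by rewrite normrM ger0_norm// ler_piMl.
split; [apply: (HG _ b2).2|apply: (HG _ (b1 s)).2].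
  apply: le_lt_trans us _; apply: lt_trans st _.
  by rewrite ltrD2l ltr1n.
by apply: le_lt_trans us _; rewrite ltrDl.
Unshelve. all: by end_near. Qed.

End Curves.

(** * The inequality of Gronwall *)

Section Gronwall.
Context {R : realType}.

(** The function (u + c/K) exp(-K t) has a nonpositive derivative. *)
Lemma gronwall1 (u du : R -> R) (K c a : R) : 1 <= K -> 0 <= c -> 0 <= a ->
  (forall t, 0 <= t <= a -> is_derive t 1 u (du t) /\ du t <= K * u t + c) ->
  u a + c / K <= (u 0 + c / K) * expR (K * a).
Proof.
move=> K1 c0 a0 h.
have K0 : 0 < K by exact: lt_le_trans K1.
pose w t := (u t + c / K) * expR (- K * t).
have [s /andP[s0 s1]|s /andP[s0 s1] E] := @MVT_from R w
    (fun t => (u t + c / K) * (- K * expR (- K * t)) + expR (- K * t) * du t) 0 a.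
  rewrite subr0 add0r.
  have sa : 0 <= s * a <= a by rewrite mulr_ge0//= ler_piMl.
  have [d1 _] := h _ sa.
  have d2 : is_derive (s * a) 1 (fun t => u t + c / K) (du (s * a)).
    by have := @is_deriveD R R R u (fun=> c / K) _ 1 _ _ d1 (is_derive_cst _ _ _); rewrite addr0.
  have d3 : is_derive (s * a) 1 (fun t : R => - K * t) (- K).
    have := @is_deriveZ R R R id (- K) (s * a) 1 1 (is_derive_id _ _).
    by rewrite [_%:A]mulr1.
  have d4 := @is_derive1_comp R (@expR R) (fun t => - K * t) (s * a) _ _ (is_derive_expR _) d3.
  have := @is_deriveM R R _ _ (s * a) 1 _ _ d2 d4.
  by rewrite !scale_mul (mulrC (expR _) (- K)).
have : w a <= w 0.
  rewrite -subr_le0 E subr0 add0r mulr_ge0_le0//.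
  have sa : 0 <= s * a <= a by rewrite mulr_ge0//= ler_piMl.
  have [_ d] := h _ sa.
  have -> : (u (s * a) + c / K) * (- K * expR (- K * (s * a))) +
      expR (- K * (s * a)) * du (s * a) =
    (du (s * a) - (K * u (s * a) + c)) * expR (- K * (s * a)).
    have : c / K * K = c by rewrite divfK// gt_eqF.
    move: (c / K) => x <-; ring.
  by rewrite mulr_le0_ge0 ?expR_ge0// subr_le0.
rewrite /w mulr0 expR0 mulr1 mulNr expRN -ler_pdivlMr ?invr_gt0 ?expR_gt0//.
by rewrite invrK.
Qed.

(** Two features matter for the applications: the constant C depends neither
    on the curve w nor on the error c, and negative times are covered. The
    sup norm is not differentiable along a curve, so the scalar inequality
    is applied to the sum of the squares of the coordinates. *)
Lemma gronwall n (M a : R) : 0 <= M -> 0 <= a ->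
  exists2 C : R, 0 < C &
  forall (w dw : R -> 'rV[R]_n) (c : R), 0 <= c ->
    (forall t : R, `|t| <= a -> is_derive t 1 w (dw t) /\ `|dw t| <= M * `|w t| + c) ->
    forall t, `|t| <= a -> `|w t| <= C * (`|w 0| + c).
Proof.
move=> M0 a0.
(* For u the sum of the squares of the coordinates, u' is at most 2 N |w| (M
   |w| + c), and N (|w| - c)^2 >= 0 turns this into (2 N M + N) u + N c^2. The
   summand 1 makes K at least 1. *)
pose N : R := n%:R; pose K := 2 * N * M + N + 1.
have N0 : 0 <= N by rewrite /N.
have K1 : 1 <= K by rewrite /K lerDr addr_ge0// mulr_ge0// mulr_ge0.
pose C := 1 + N * expR (K * a).
have C1 : 1 <= C by rewrite /C lerDl mulr_ge0// expR_ge0.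
exists C; first exact: lt_le_trans C1.
move=> w dw c c0 h.
have pos (z dz : R -> 'rV[R]_n) b : 0 <= b <= a ->
    (forall t : R, 0 <= t <= b -> is_derive t 1 z (dz t) /\
       `|dz t| <= M * `|z t| + c) ->
    `|z b| <= C * (`|z 0| + c).
  move=> /andP[b0 ba] H.
  pose u t := \sum_i z t 0 i ^+ 2.
  have u_le t : u t <= N * `|z t| ^+ 2.
    rewrite /u /N mulr_natl -[X in _ <= _ *+ X](card_ord n) -sumr_const.
    apply: ler_sum => i _; rewrite -real_normK ?num_real// lerXn2r ?nnegrE//.
    exact: coord_le_norm.
  have le_u t : `|z t| ^+ 2 <= u t.
    have u0 : 0 <= u t by apply: sumr_ge0 => i _; exact: sqr_ge0.
    rewrite -[leRHS]sqr_sqrtr// lerXn2r ?nnegrE ?sqrtr_ge0//.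
    apply: norm_le_coord; first exact: sqrtr_ge0.
    move=> k i; rewrite (ord1 k) -sqrtr_sqr ler_wsqrtr//.
    by rewrite /u (bigD1 i)//= lerDl sumr_ge0// => j _; exact: sqr_ge0.
  have uz : u b <= (u 0 + N * c ^+ 2) * expR (K * b).
    have le : u b + N * c ^+ 2 / K <= (u 0 + N * c ^+ 2 / K) * expR (K * b).
      apply: (@gronwall1 u (fun t => \sum_i 2 * z t 0 i * dz t 0 i)) => //.
        by rewrite mulr_ge0// sqr_ge0.
      move=> t tb; split.
        have [/is_derive_rowP zd _] := H t tb.
        apply: (@is_derive_eq _ _ _ _ _ _ _
          (\sum_i (z t 0 i *: dz t 0 i + z t 0 i *: dz t 0 i))); last first.
          by apply: eq_bigr => i _; rewrite !scale_mul; ring.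
        have -> : u = \sum_i (fun t => z t 0 i ^+ 2).
          by apply/funext => s; rewrite fct_sumE.
        apply: is_derive_sum => i.
        have := @is_deriveM R R _ _ t 1 _ _ (zd i) (zd i).
        exact.
      have [_ dzM] := H t tb.
      have Z0 : 0 <= `|z t| by [].
      apply: (@le_trans _ _ (\sum_(i < n) 2 * `|z t| * (M * `|z t| + c))).
        apply: ler_sum => i _; apply: le_trans (ler_norm _) _.
        rewrite !normrM (@ger0_norm _ 2)// -!mulrA ler_pM2l//.
        apply: ler_pM => //; first exact: coord_le_norm.
        exact: le_trans (coord_le_norm _ _ _) dzM.
      rewrite sumr_const card_ord -mulr_natl -/N.
      apply: (@le_trans _ _ ((2 * N * M + N) * `|z t| ^+ 2 + N * c ^+ 2)).
        have : 0 <= N * (`|z t| - c) ^+ 2 by rewrite mulr_ge0// sqr_ge0.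
        by move: (`|z t|) => y; nra.
      rewrite lerD2r; apply: (@le_trans _ _ ((2 * N * M + N) * u t)).
        by rewrite ler_wpM2l// addr_ge0// mulr_ge0// mulr_ge0.
      rewrite ler_wpM2r//; first exact: le_trans (sqr_ge0 _) (le_u t).
      by rewrite lerDl.
    have K0 : 0 < K by exact: lt_le_trans K1.
    have cK : 0 <= N * c ^+ 2 / K <= N * c ^+ 2.
      rewrite divr_ge0 ?(ltW K0)//=; last by rewrite mulr_ge0// sqr_ge0.
      by rewrite ler_pdivrMr// ler_peMr// mulr_ge0// sqr_ge0.
    move/andP: cK => [cK1 cK2].
    apply: (@le_trans _ _ (u b + N * c ^+ 2 / K)); first by rewrite lerDl.
    by apply: le_trans le _; rewrite ler_wpM2r ?expR_ge0// lerD2l.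
  have z2 : `|z b| ^+ 2 <= (C * (`|z 0| + c)) ^+ 2.
    apply: le_trans (le_u b) _; apply: le_trans uz _.
    have eb : expR (K * b) <= expR (K * a).
      by rewrite ler_expR ler_wpM2l// (le_trans _ K1).
    apply: (@le_trans _ _ (N * (`|z 0| + c) ^+ 2 * expR (K * a))).
      apply: ler_pM => //; last 1 first.
      - apply: (@le_trans _ _ (N * `|z 0| ^+ 2 + N * c ^+ 2)).
          by rewrite lerD2r.
        rewrite -mulrDr ler_wpM2l//.
        have : 0 <= `|z 0| by []. move: (`|z 0|) => y y0; nra.
      - by rewrite addr_ge0 ?(le_trans (sqr_ge0 _) (le_u 0))// mulr_ge0// sqr_ge0.
    rewrite exprMn mulrAC ler_wpM2r ?sqr_ge0//.
    apply: (@le_trans _ _ C); first by rewrite /C lerDr.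
    by rewrite expr2 ler_peMl// (le_trans ler01).
  have R0 : 0 <= C * (`|z 0| + c).
    by apply: mulr_ge0; [exact: le_trans ler01 C1|exact: addr_ge0].
  by rewrite -(@ler_pXn2r _ 2%N) ?nnegrE.
move=> t ta; have [t0|t0] := leP 0 t.
  apply: (pos w dw t); first by rewrite t0 -(ger0_norm t0).
  move=> s /andP[s0 st]; apply: h; rewrite ger0_norm// (le_trans st)//.
  by rewrite -(ger0_norm t0).
(* Negative times: reverse the curve. *)
rewrite -[t]opprK -[in `|w 0|]oppr0.
apply: (pos (fun s => w (- s)) (fun s => - dw (- s)) (- t)).
  by rewrite oppr_ge0 ltW//= -(ltr0_norm t0).
move=> s /andP[s0 st]; rewrite normrN.
have sa : `|- s| <= a.
  by rewrite normrN ger0_norm// (le_trans st)// -(ltr0_norm t0).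
have [d b] := h _ sa; split=> //.
apply/is_derive_rowP => i; move/is_derive_rowP: d => /(_ i) d.
have := @is_derive1_comp R (fun s => w s 0 i) -%R s _ _ d (is_deriveNid _ _).
by rewrite mulrN1 mxE.
Qed.

End Gronwall.

(** * Existence of integral curves *)

Section Picard.
Context {R : realType} {n : nat}.

Lemma near_norm_lt (V : normedModType R) (y : V) (d : R) : 0 < d ->
  \forall z \near y, `|y - z| < d.
Proof. by move=> d0; apply/nbhs_normP; exists d. Qed.

(** The sequences u k - 2 C / 2^k and u k + 2 C / 2^k are nondecreasing and
    nonincreasing, and the limit is the supremum of the former. *)
Lemma geometric_cvg (u : nat -> R) (C : R) :
  (forall k, `|u k.+1 - u k| <= C / 2 ^+ k) ->
  exists l, forall k, `|l - u k| <= 2 * C / 2 ^+ k.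
Proof.
move=> h.
have C0 : 0 <= C by have := h 0%N; rewrite expr0 divr1; exact: le_trans.
pose d k : R := C / 2 ^+ k.
have d0 k : 0 <= d k by rewrite /d divr_ge0// exprn_ge0.
have dS k : d k = 2 * d k.+1.
  by rewrite /d exprS; field; rewrite expf_neq0.
pose v k := u k - 2 * d k; pose w k := u k + 2 * d k.
have hk k : `|u k.+1 - u k| <= d k by exact: h.
have vS k : v k <= v k.+1.
  by have := hk k; rewrite /v ler_norml (dS k) => /andP[]; have := d0 k.+1; lra.
have wS k : w k.+1 <= w k.
  by have := hk k; rewrite /w ler_norml (dS k) => /andP[]; have := d0 k.+1; lra.
have vm k j : v k <= v (k + j)%N.
  by elim: j => [|j IH]; [rewrite addn0|rewrite addnS (le_trans IH)].
have wm k j : w (k + j)%N <= w k.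
  by elim: j => [|j IH]; [rewrite addn0|rewrite addnS (le_trans _ IH)].
have vw k j : v k <= w j.
  apply: le_trans (vm k j) _; rewrite addnC; apply: le_trans (wm j k).
  by rewrite /v /w; have := d0 (j + k)%N; lra.
exists (sup (range v)) => k.
have l1 : v k <= sup (range v).
  by apply: ub_le_sup; [exists (w 0%N) => _ [j _ <-]|exists k].
have l2 : sup (range v) <= w k.
  by apply: ge_sup; [exists (v 0%N); exists 0%N|move=> _ [j _ <-]].
by rewrite -mulrA -/(d k) ler_norml; move: l1 l2; rewrite /v /w => l1 l2;
  apply/andP; split; lra.
Qed.

Lemma near_geometric (c e : R) : 0 < e -> \forall k \near \oo, c / 2 ^+ k <= e.
Proof.
move=> e0.
have h : `|(2^-1 : R)| < 1.
  by rewrite ger0_norm ?invr_ge0// invf_lt1// ltr1n.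
have /cvgrPdist_le/(_ e e0) := @cvg_geometric R c _ h.
apply: filterS => k; rewrite /geometric/= sub0r normrN exprVn => H.
exact: le_trans (ler_norm _) H.
Qed.

Lemma geometric_le (a e c : R) : 0 <= e -> (forall k, a <= e + c / 2 ^+ k) -> a <= e.
Proof.
move=> e0 h; apply/ler_addgt0Pr => d d0.
have [k _ hk] := near_geometric c d0.
by apply: le_trans (h k) _; rewrite lerD2l hk/=.
Qed.

Lemma MVT_row (w dw : R -> 'rV[R]_n) (a b C : R) :
  (forall s, 0 <= s <= 1 ->
     is_derive (a + s * (b - a)) 1 w (dw (a + s * (b - a))) /\
     `|dw (a + s * (b - a))| <= C) ->
  `|w b - w a| <= C * `|b - a|.
Proof.
move=> h.
have C0 : 0 <= C.
  by have [|_] := h 0; [rewrite lexx ler01|exact: le_trans].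
apply: norm_le_coord; first by rewrite mulr_ge0.
move=> k i; rewrite (ord1 k) !mxE.
apply: (@MVT_bound R (fun t => w t 0 i) (fun t => dw t 0 i)) => s s01.
have [/is_derive_rowP d le] := h s s01; split; first exact: d.
exact: le_trans (coord_le_norm _ _ _) le.
Qed.

Lemma lipschitz_continuous_rV m (F : 'rV[R]_n -> 'rV[R]_m) (M : R) :
  (forall y z, `|F y - F z| <= M * `|y - z|) -> continuous F.
Proof.
move=> h; suff H (y : 'rV[R]_n) : {for y, continuous F} by exact: H.
apply/(@cvgrPdist_le _ _ _ (nbhs y) _) => e e0.
have M1 : 0 < `|M| + 1 by rewrite ltr_wpDl.
have d0 : 0 < e / (`|M| + 1) by rewrite divr_gt0.
have yN : nbhs y [set z | `|y - z| < e / (`|M| + 1)].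
  exact: (near_norm_lt (y : (matrix R 1 n : normedModType R)) d0).
apply: (@filterS _ (nbhs y) (nbhs_filter y)) yN => z /= yz.
apply: le_trans (h _ _) _.
move: yz; rewrite ltr_pdivlMr// => /ltW; apply: le_trans.
by rewrite mulrC ler_wpM2l// (le_trans (ler_norm _))// lerDl.
Qed.

(** The bound e M <= 1/2 makes consecutive iterates approach each other like
    the powers of 1/2 on the whole interval; the derivatives F (y k t) then
    converge uniformly because F is Lipschitz, and is_derive_limit applies. *)
Lemma picard (F : 'rV[R]_n -> 'rV[R]_n) (M K e : R) : 0 <= M -> 0 < e ->
  e * M <= 2^-1 ->
  (forall y z, `|F y - F z| <= M * `|y - z|) -> (forall y, `|F y| <= K) ->
  forall x, exists2 y : R -> 'rV[R]_n, y 0 = x &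
    forall t : R, `|t| < e -> is_derive t 1 y (F (y t)).
Proof.
move=> M0 e0 eM FL FK x.
have K0 : 0 <= K by apply: le_trans (FK x).
have Fc := lipschitz_continuous_rV FL.
(* A is the integral operator y |-> x + int F(y), on continuous curves. *)
have /choice[A HA] : forall y : R -> 'rV[R]_n, exists z : R -> 'rV[R]_n,
    continuous y -> z 0 = x /\ forall t : R, is_derive t 1 z (F (y t)).
  move=> y; have [yc|yc] := pselect (continuous y); last by exists (fun=> 0).
  have /choice[G HG] : forall i : 'I_n, exists G : R -> R,
      G 0 = 0 /\ forall t : R, is_derive t 1 G (F (y t) 0 i).
    move=> i; have [|G G0 Gd] := @antiderivative R (fun t => F (y t) 0 i).
      move=> t; have /continuous_coordP : {for t, continuous (F \o y)}.
        by apply: continuous_comp; [exact: yc|exact: Fc].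
      exact.
    by exists G.
  exists (fun t => \row_i (x 0 i + G i t)) => _; split.
    by apply/rowP => i; rewrite !mxE (HG i).1 addr0.
  move=> t; apply/is_derive_rowP => i.
  have := @is_deriveD R R R (fun=> x 0 i) (G i) t 1 _ _ (is_derive_cst _ _ _) ((HG i).2 t).
  rewrite add0r; congr (is_derive _ _ _ _); apply/funext => s.
  by rewrite mxE.
pose y k := iter k A (fun=> x).
have yc k : continuous (y k).
  elim: k => [|k IH]; first exact: cst_continuous.
  by move=> t; exact: is_derive_continuous ((HA _ IH).2 t).
have y0 k : y k 0 = x by case: k => //= k; exact: (HA _ (yc k)).1.
have yd k (t : R) : is_derive t 1 (y k.+1) (F (y k t)) by exact: (HA _ (yc k)).2.
have within s t : 0 <= s <= 1 -> `|t| <= e -> `|0 + s * (t - 0)| <= e.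
  move=> /andP[s0 s1] te; rewrite add0r subr0 normrM ger0_norm//.
  by apply: le_trans te; rewrite ler_piMl.
have step k : forall t, `|t| <= e -> `|y k.+1 t - y k t| <= K * e / 2 ^+ k.
  elim: k => [|k IH] t te.
    rewrite expr0 divr1 -[y 0%N t](y0 1%N).
    apply: (@le_trans _ _ (K * `|t - 0|)); last by rewrite subr0 ler_wpM2l.
    by apply: (@MVT_row _ (fun t => F (y 0%N t))) => s _.
  have -> : y k.+2 t - y k.+1 t = (y k.+2 t - y k.+1 t) - (y k.+2 0 - y k.+1 0).
    by rewrite !y0 subrr subr0.
  apply: (@le_trans _ _ (M * (K * e / 2 ^+ k) * `|t - 0|)).
    apply: (@MVT_row (fun t => y k.+2 t - y k.+1 t)
      (fun t => F (y k.+1 t) - F (y k t))) => s s01; split.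
      exact: is_deriveB.
    apply: le_trans (FL _ _) _; rewrite ler_wpM2l//; apply: IH.
    exact: within.
  rewrite subr0 exprS invfM.
  have z0 : 0 <= K * e / 2 ^+ k by rewrite divr_ge0 ?exprn_ge0// mulr_ge0// ltW.
  have -> : K * e * (2^-1 / 2 ^+ k) = (K * e / 2 ^+ k) * 2^-1 by ring.
  have -> : M * (K * e / 2 ^+ k) * `|t| = (K * e / 2 ^+ k) * (`|t| * M) by ring.
  by rewrite ler_wpM2l//; apply: le_trans eM; rewrite ler_wpM2r.
have /choice[z Hz] : forall t : R, exists z : 'rV[R]_n, `|t| <= e ->
    forall k, `|z - y k t| <= 2 * (K * e) / 2 ^+ k.
  move=> t; have [te|te] := leP (`|t|) e; last by exists 0.
  have /choice[l hl] : forall i : 'I_n, exists l, forall k,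
      `|l - y k t 0 i| <= 2 * (K * e) / 2 ^+ k.
    move=> i; apply: geometric_cvg => k; apply: le_trans (step k t te).
    by have := coord_le_norm (y k.+1 t - y k t) 0 i; rewrite !mxE.
  exists (\row_i l i) => _ k; apply: norm_le_coord.
    by rewrite divr_ge0 ?exprn_ge0// mulr_ge0// mulr_ge0// ltW.
  by move=> j i; rewrite !mxE (ord1 j).
exists z.
  apply/eqP; rewrite -subr_eq0 -normr_le0.
  apply: (@geometric_le _ _ (2 * (K * e))) => // k.
  by rewrite add0r -{1}(y0 k); apply: Hz; rewrite normr0 ltW.
have zc t : `|t| < e -> {for t, continuous z}.
  move=> te; apply/cvgrPdist_le => d d0.
  have d3 : 0 < d / 3 by rewrite divr_gt0.
  have [k _ hk] := near_geometric (2 * (K * e)) d3.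
  have zk s : `|s| <= e -> `|z s - y k s| <= d / 3.
    by move=> se; apply: le_trans (Hz s se k) _; exact: (hk k (leqnn k)).
  near=> s.
  have se : `|s| <= e.
    near: s; apply/nbhs_normP; exists (e - `|t|); first by rewrite /= subr_gt0.
    move=> s /=; rewrite distrC => ts; rewrite -[s](subrK t) addrC.
    by rewrite (le_trans (ler_normD _ _))// -lerBrDl ltW.
  have ykc : `|y k t - y k s| <= d / 3.
    by near: s; move/cvgrPdist_le: (yc k t) => /(_ _ d3).
  have -> : z t - z s = (z t - y k t) + (y k t - y k s) + (y k s - z s).
    by rewrite -addrA subrKA subrKA.
  have -> : d = d / 3 + d / 3 + d / 3 by lra.
  apply: le_trans (ler_normD _ _) _; apply: lerD; last by rewrite distrC zk.
  apply: le_trans (ler_normD _ _) _; apply: lerD => //.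
  by apply: zk; exact: ltW.
move=> t te; apply/is_derive_rowP => i.
have r0 : 0 < e - `|t| by rewrite subr_gt0.
have near_te s : `|s - t| < e - `|t| -> `|s| <= e.
  move=> st; rewrite -[s](subrK t) addrC.
  by rewrite (le_trans (ler_normD _ _))// -lerBrDl ltW.
apply: (@is_derive_limit R nat \oo (fun k s => y k.+1 s 0 i)
  (fun k s => F (y k s) 0 i) (fun s => z s 0 i) (fun s => F (z s) 0 i) t _ _ r0).
- move=> s /near_te se; apply/cvgrPdist_le => d d0.
  have := near_geometric (2 * (K * e)) d0.
  move=> [N _ HN]; exists N => // k /= Nk.
  apply: le_trans (HN k.+1 _); last exact: leqW.
  apply: le_trans (Hz s se k.+1).
  by have := coord_le_norm (z s - y k.+1 s) 0 i; rewrite !mxE.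
- have /continuous_coordP : {for t, continuous (F \o z)}.
    by apply: continuous_comp; [exact: zc|exact: Fc].
  exact.
- apply: nearW => k s _.
  by have /is_derive_rowP := yd k s; exact.
- move=> d d0; have := near_geometric (M * (2 * (K * e))) d0.
  apply: filterS => k hk s /near_te se.
  apply: le_trans hk; rewrite -mulrA.
  apply: (@le_trans _ _ (`|F (y k s) - F (z s)|)).
    by have := coord_le_norm (F (y k s) - F (z s)) 0 i; rewrite !mxE.
  by apply: le_trans (FL _ _) _; rewrite ler_wpM2l// distrC Hz.
Unshelve. all: by end_near. Qed.

Definition clamp (r u : R) : R := if u < - r then - r else if r < u then r else u.

Lemma clamp_lipschitz r u v : 0 <= r -> `|clamp r u - clamp r v| <= `|u - v|.
Proof.
move=> r0; rewrite /clamp ler_norml.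
have := ler_norm (u - v); have := ler_norm (v - u); rewrite (distrC v).
by do ?case: ifPn; rewrite -?leNgt => *; apply/andP; split; lra.
Qed.

Lemma clamp_norm r u : 0 <= r -> `|clamp r u| <= r.
Proof.
move=> r0; rewrite /clamp ler_norml.
by do ?case: ifPn; rewrite -?leNgt => *; apply/andP; split; lra.
Qed.

Lemma clamp_id r u : `|u| <= r -> clamp r u = u.
Proof.
by rewrite ler_norml /clamp => /andP[]; do ?case: ifPn; rewrite -?leNgt => *; lra.
Qed.

(** F is only Lipschitz near p. Composed with the coordinatewise truncation
    to the cube around p it becomes globally bounded and Lipschitz, and for
    short times the integral curves of the truncated field do not leave the
    cube, where it agrees with F. *)
Lemma local_solution (F : 'rV[R]_n -> 'rV[R]_n) (p : 'rV[R]_n) (r M : R) : 0 < r -> 0 <= M ->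
  (forall y z : 'rV[R]_n, `|y - p| <= r -> `|z - p| <= r -> `|F y - F z| <= M * `|y - z|) ->
  exists2 e : R, 0 < e & forall x : 'rV[R]_n, `|x - p| < r / 2 ->
    exists2 y : R -> 'rV[R]_n, y 0 = x & forall t : R, `|t| < e ->
      `|y t - p| < r /\ is_derive t 1 y (F (y t)).
Proof.
move=> r0 M0 FL.
pose cl (x : 'rV[R]_n) : 'rV[R]_n := \row_i (p 0 i + clamp r (x 0 i - p 0 i)).
have clr x : `|cl x - p| <= r.
  apply: norm_le_coord; first exact: ltW.
  by move=> k i; rewrite (ord1 k) !mxE addrC addKr clamp_norm// ltW.
have clL x y : `|cl x - cl y| <= `|x - y|.
  apply: norm_le_coord => // k i; rewrite (ord1 k) !mxE.
  rewrite opprD addrACA subrr add0r.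
  apply: le_trans (clamp_lipschitz _ _ (ltW r0)) _.
  rewrite opprB addrA subrK.
  by have := coord_le_norm (x - y) 0 i; rewrite !mxE.
have clid x : `|x - p| <= r -> cl x = x.
  move=> xp; apply/rowP => i; rewrite mxE clamp_id ?subrKC//.
  by apply: le_trans xp; have := coord_le_norm (x - p) 0 i; rewrite !mxE.
pose K := `|F p| + M * r.
have K0 : 0 <= K by rewrite addr_ge0// mulr_ge0// ltW.
have K1 : 0 < K + 1 by rewrite ltr_wpDl.
have M1 : 0 < M + 1 by rewrite ltr_wpDl.
(* The first bound keeps a curve of speed at most K within r / 2 of its start,
   the second one is the contraction condition of picard. *)
pose e := Num.min (r / 2 / (K + 1)) (2^-1 / (M + 1)).
have e0 : 0 < e by rewrite lt_min !divr_gt0.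
exists e => // x xp.
have [|||y y0 yd] := @picard (F \o cl) M K e M0 e0 _ _ _ x.
- apply: (@le_trans _ _ (2^-1 / (M + 1) * M)).
    by rewrite ler_wpM2r// /e ge_min lexx orbT.
  rewrite -mulrA ler_piMr// mulrC ler_pdivrMr// mul1r.
  by rewrite lerDl.
- move=> y z /=; apply: le_trans (FL _ _ (clr _) (clr _)) _.
  by rewrite ler_wpM2l.
- move=> y /=; rewrite -[F (cl y)](subrK (F p)) addrC.
  apply: le_trans (ler_normD _ _) _; rewrite lerD2l.
  apply: le_trans (FL _ _ (clr _) _) _; first by rewrite subrr normr0 ltW.
  by rewrite ler_wpM2l.
exists y => // t te.
have yt : `|y t - p| < r.
  rewrite -[y t](subrK x) -addrA; apply: le_lt_trans (ler_normD _ _) _.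
  have -> : r = r / 2 + r / 2 by lra.
  apply: ler_ltD => //.
  apply: (@le_trans _ _ (K * `|t - 0|)).
    rewrite -y0; apply: (@MVT_row y (F \o cl \o y)) => s /andP[s0 s1]; split.
      apply: yd; rewrite add0r subr0 normrM ger0_norm//.
      by apply: le_lt_trans te; rewrite ler_piMl.
    rewrite /= -[F (cl _)](subrK (F p)) addrC.
    apply: le_trans (ler_normD _ _) _; rewrite lerD2l.
    apply: le_trans (FL _ _ (clr _) _) _; first by rewrite subrr normr0 ltW.
    by rewrite ler_wpM2l.
  rewrite subr0; apply: (@le_trans _ _ ((K + 1) * (r / 2 / (K + 1)))).
    apply: ler_pM => //; first by rewrite lerDl.
    by apply: le_trans (ltW te) _; rewrite /e ge_min lexx.
  by rewrite mulrC divfK// gt_eqF.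
split=> //; have := yd t te; rewrite /= clid//; exact: ltW.
Qed.

End Picard.

(** * Estimates uniform along a curve *)

Section Uniform.
Context {R : realType}.
Opaque smooth_on.

Local Notation e_ i := (delta_mx (0 : 'I_1) i).

(** The derivative of F at z in the direction w, written through the partial
    derivatives so that it is linear in w by construction. *)
Definition dirD n N (F : 'rV[R]_n -> 'rV[R]_N) (z w : 'rV[R]_n) : 'rV[R]_N :=
  \row_i \sum_j w 0 j * 'D_(e_ j) (fun y => F y 0 i) z.

Lemma dirDZ n N (F : 'rV[R]_n -> 'rV[R]_N) z a w : dirD F z (a *: w) = a *: dirD F z w.
Proof.
apply/rowP => i; rewrite !mxE mulr_sumr; apply: eq_bigr => j _.
by rewrite !mxE mulrA.
Qed.

Lemma dirDB n N (F : 'rV[R]_n -> 'rV[R]_N) z w w' :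
  dirD F z (w - w') = dirD F z w - dirD F z w'.
Proof.
apply/rowP => i; rewrite !mxE -sumrB; apply: eq_bigr => j _.
by rewrite !mxE mulrBl.
Qed.

Lemma dirD_bound n N (W : set 'rV[R]_n) (F : 'rV[R]_n -> 'rV[R]_N) q : open W ->
  smooth_on W F -> W q ->
  exists2 r : R, 0 < r & exists2 M : R, 0 <= M &
    forall z, `|z - q| < r -> forall w, `|dirD F z w| <= M * `|w|.
Proof.
move=> Wo Fs Wq.
have FC i : C1_at (fun y => F y 0 i) q.
  exact: (smooth_C1 Wo ((smooth_rowP F Wo).1 Fs i) Wq).
have : \forall z \near q, forall i j, `|'D_(e_ j) (fun y => F y 0 i) z| <=
    `|'D_(e_ j) (fun y => F y 0 i) q| + 1.
  apply: near_forall => i; apply: near_forall => j.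
  have [_ /cvgrPdist_le/(_ 1 ltr01)] := FC i j.
  apply: filterS => z; set a := 'D_ _ _ _; set b := 'D_ _ _ _ => ab.
  by rewrite -[b](subrK a) addrC (le_trans (ler_normD _ _))// lerD2l distrC.
move=> /nbhs_normP[r /= r0 hr]; exists r => //.
exists (\sum_i \sum_j (`|'D_(e_ j) (fun y => F y 0 i) q| + 1)).
  by apply: sumr_ge0 => i _; apply: sumr_ge0 => j _; rewrite addr_ge0.
move=> z zq w; have {}hr := hr z _; rewrite /ball_/= distrC in hr.
have {}hr := hr zq.
have S0 i : 0 <= \sum_j (`|'D_(e_ j) (fun y => F y 0 i) q| + 1).
  by apply: sumr_ge0 => j _; rewrite addr_ge0.
apply: norm_le_coord; first by rewrite mulr_ge0// sumr_ge0.
move=> k i; rewrite (ord1 k) mxE.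
apply: le_trans (ler_norm_sum _ _ _) _.
apply: (@le_trans _ _ ((\sum_j (`|'D_(e_ j) (fun y => F y 0 i) q| + 1)) * `|w|)).
  rewrite mulr_suml; apply: ler_sum => j _; rewrite normrM mulrC.
  by apply: ler_pM => //; exact: coord_le_norm.
by rewrite ler_wpM2r// (bigD1 i)//= lerDl sumr_ge0.
Qed.

(** The derivative is taken at the moving point z instead of q, which is the
    form needed along a curve. *)
Lemma strict_diff_row n N (W : set 'rV[R]_n) (F : 'rV[R]_n -> 'rV[R]_N) q (c : R) :
  open W -> smooth_on W F -> W q -> 0 < c ->
  exists2 r : R, 0 < r & forall y z, `|y - q| < r -> `|z - q| < r ->
    `|F y - F z - dirD F z (y - z)| <= c * `|y - z|.
Proof.
move=> Wo Fs Wq c0.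
have FC i : C1_at (fun y => F y 0 i) q.
  exact: (smooth_C1 Wo ((smooth_rowP F Wo).1 Fs i) Wq).
have c20 : 0 < c / 2 by rewrite divr_gt0.
(* n.+1 instead of n, to divide also in dimension 0. *)
pose c' := c / 2 / n.+1%:R.
have c'0 : 0 < c' by rewrite divr_gt0.
have D1 : \forall z \near q, forall i j, `|'D_(e_ j) (fun y => F y 0 i) q -
    'D_(e_ j) (fun y => F y 0 i) z| <= c'.
  apply: near_forall => i; apply: near_forall => j.
  by have [_ /cvgrPdist_le/(_ _ c'0)] := FC i j.
move/nbhs_normP: D1 => [r1 /= r10 hr1].
have D2 : \forall r \near (0:R)^'+, forall i : 'I_N, forall y z,
    `|y - q| < r -> `|z - q| < r -> `|F y 0 i - F z 0 i -
      \sum_j (y 0 j - z 0 j) * 'D_(e_ j) (fun y => F y 0 i) q| <= c / 2 * `|y - z|.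
  apply: filter_forall => i.
  have [r r0 hr] := strict_diff (FC i) c20.
  near=> s => y z ys zs.
  have sr : s <= r by near: s; exact: nbhs_right_le.
  by apply: hr; [exact: lt_le_trans ys sr|exact: lt_le_trans zs sr].
have [r [r0 rr1 hr]] : exists r : R, [/\ 0 < r, r <= r1 &
    forall i : 'I_N, forall y z,
    `|y - q| < r -> `|z - q| < r -> `|F y 0 i - F z 0 i -
      \sum_j (y 0 j - z 0 j) * 'D_(e_ j) (fun y => F y 0 i) q| <= c / 2 * `|y - z|].
  apply: (@filter_ex _ (0:R)^'+); near=> r; split.
  - by [].
  - by near: r; exact: nbhs_right_le.
  - by near: r.
exists r => // y z yq zq; apply: norm_le_coord; first by rewrite mulr_ge0// ltW.
move=> k i; rewrite (ord1 k) !mxE.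
set a := F y 0 i - F z 0 i.
pose s1 := \sum_j (y 0 j - z 0 j) * 'D_(e_ j) (fun y => F y 0 i) q.
rewrite -[a](subrK s1) -addrA; apply: le_trans (ler_normD _ _) _.
have -> : c * `|y - z| = c / 2 * `|y - z| + c / 2 * `|y - z| by field.
apply: lerD; first exact: hr.
rewrite /s1 -sumrB; apply: le_trans (ler_norm_sum _ _ _) _.
have -> : c / 2 = \sum_(j < n.+1) c'.
  by rewrite sumr_const card_ord -[RHS]mulr_natr /c' divfK.
rewrite mulr_suml big_ord_recl [leRHS]addrC -[leLHS]addr0.
apply: lerD; last by rewrite mulr_ge0// ltW.
apply: ler_sum => j _; rewrite !mxE -mulrBr normrM mulrC ler_pM//.
  by apply: hr1; rewrite /= distrC; exact: lt_le_trans zq rr1.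
by have := coord_le_norm (y - z) 0 j; rewrite !mxE.
Unshelve. all: by end_near. Qed.

Lemma local_lipschitz n N (W : set 'rV[R]_n) (F : 'rV[R]_n -> 'rV[R]_N) q :
  open W -> smooth_on W F -> W q ->
  exists2 r : R, 0 < r & exists2 M : R, 0 <= M &
    forall y z, `|y - q| < r -> `|z - q| < r -> `|F y - F z| <= M * `|y - z|.
Proof.
move=> Wo Fs Wq.
have [r1 r10 h1] := strict_diff_row Wo Fs Wq ltr01.
have [r2 r20 [M M0 h2]] := dirD_bound Wo Fs Wq.
exists (Num.min r1 r2); first by rewrite lt_min r10.
exists (M + 1); first by rewrite addr_ge0.
move=> y z; rewrite !lt_min => /andP[y1 y2] /andP[z1 z2].
rewrite -[F y - F z](subrK (dirD F z (y - z))) addrC.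
apply: le_trans (ler_normD _ _) _; rewrite mulrDl; apply: lerD; first exact: h2.
exact: h1.
Qed.

Definition jcont n N (psi : R -> 'rV[R]_n -> 'rV[R]_N) (t : R) (x : 'rV[R]_n) :=
  forall c : R, 0 < c -> exists2 d : R, 0 < d & forall t' x',
    `|t' - t| < d -> `|x' - x| < d -> `|psi t' x' - psi t x| < c.

(** Compactness along a curve: a property that holds for all pairs of points
    near each point of the curve t |-> psi t x0, with a constant M that may
    depend on t, holds along all nearby curves with a single M and a single
    distance d. *)
Lemma uniform_near_curve n N (psi : R -> 'rV[R]_n -> 'rV[R]_N) (x0 : 'rV[R]_n)
    (a : R) (P : R -> 'rV[R]_N -> 'rV[R]_N -> Prop) :
  (forall t, `|t| <= a -> jcont psi t x0) ->
  (forall t, `|t| <= a -> exists2 r : R, 0 < r & exists M0 : R,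
     forall M y z, M0 <= M -> `|y - psi t x0| < r -> `|z - psi t x0| < r -> P M y z) ->
  exists2 d : R, 0 < d & exists2 M : R, 0 <= M &
    forall x x', `|x - x0| < d -> `|x' - x0| < d ->
    forall t, `|t| <= a -> P M (psi t x) (psi t x').
Proof.
move=> psic hP.
have /compact_near_coveringP K : compact `[- a, a] := @segment_compact R (- a) a.
(* The distance and the constant are treated together as a parameter that
   tends to (0+, +oo), so that the covering form of compactness yields both at
   once. *)
have : \forall i \near filter_prod (0:R)^'+ (+oo_R), `[- a, a]%classic `<=`
    [set t | forall x x', `|x - x0| < i.1 -> `|x' - x0| < i.1 ->
      P i.2 (psi t x) (psi t x')].
  apply: K => t /=; rewrite in_itv/= -ler_norml => ta.
  have [r r0 [M0 hr]] := hP t ta; have [d d0 hd] := psic t ta r r0.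
  exists ([set t' | `|t - t'| < d],
          [set i : R * R | i.1 <= d /\ M0 <= i.2]); first split => /=.
  - exact: (@near_norm_lt R R t d d0).
  - exists ([set s : R | s <= d], [set M : R | M0 <= M]); last by [].
    split=> /=; first exact: nbhs_right_le.
    by apply: nbhs_pinfty_ge; exact: num_real.
  move=> [t' [s M]] /= [tt' [sd M0M]] x x' xs xs'.
  apply: hr => //; apply: hd; rewrite 1?distrC//.
    by rewrite distrC; exact: lt_le_trans xs sd.
  by rewrite distrC; exact: lt_le_trans xs' sd.
move=> [[A B] /= [A0 BM] AB].
have [d [d0 Ad]] : exists d : R, 0 < d /\ A d.
  by apply: (@filter_ex _ (0:R)^'+); near=> d; split=> //; near: d; exact: A0.
have [M [M0 BM']] : exists M : R, 0 <= M /\ B M.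
  apply: (@filter_ex _ +oo_R); near=> M; split; first by [].
  by near: M.
exists d => //; exists M => // x x' xd xd' t ta.
by apply: (AB (d, M)) => //=; rewrite in_itv/= -ler_norml.
Unshelve. all: by end_near. Qed.

End Uniform.

(** * Differentiability of a flow in its initial data *)

Section Variational.
Context {R : realType}.
Opaque smooth_on.

Local Notation e_ i := (delta_mx (0 : 'I_1) i).

Lemma three_quarters_lt (c : R) : 0 < c -> c / 4 + c / 4 + c / 4 < c.
Proof. by move=> c0; lra. Qed.

(** Integral curves of F parametrized by x, with affine initial values. The
    parameter space R^n is separate from the phase space R^N and the initial
    values are not required to be x itself, because both are lost when
    derivatives in x are adjoined to the phase variables; affine initial
    values are preserved. *)
Definition flow_family n N (W : set 'rV[R]_N) (F : 'rV[R]_N -> 'rV[R]_N) (e : R)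
    (U : set 'rV[R]_n) (psi : R -> 'rV[R]_n -> 'rV[R]_N) : Prop :=
  [/\ forall (t : R) x, `|t| < e -> U x ->
        W (psi t x) /\ is_derive t 1 (psi^~ x) (F (psi t x)),
      forall (t : R) x, `|t| < e -> U x -> jcont psi t x
    & exists (A : 'M[R]_(n, N)) b, forall x, U x -> psi 0 x = x *m A + b].

Context {n N : nat} {W : set 'rV[R]_N} {F : 'rV[R]_N -> 'rV[R]_N} {e : R}
  {U : set 'rV[R]_n} {psi : R -> 'rV[R]_n -> 'rV[R]_N}.
Hypothesis Wo : open W.
Hypothesis Fs : smooth_on W F.
Hypothesis Uo : open U.
Hypothesis psi_sol : forall (t : R) x, `|t| < e -> U x ->
        W (psi t x) /\ is_derive t 1 (psi^~ x) (F (psi t x)).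
Hypothesis psi_cont : forall (t : R) x, `|t| < e -> U x -> jcont psi t x.
Variables (A : 'M[R]_(n, N)) (b : 'rV[R]_N).
Hypothesis psi0 : forall x, U x -> psi 0 x = x *m A + b.
Variable v : 'rV[R]_n.

Definition quot (h : R) x t := h^-1 *: (psi t (x + h *: v) - psi t x).
Definition dquot (h : R) x t := h^-1 *: (F (psi t (x + h *: v)) - F (psi t x)).

(** The difference quotient of the flow in the direction v satisfies the
    linearized equation up to an error c, uniformly for parameters close to
    x0, small h and times up to a. The error is that of strict_diff_row, and
    it stays proportional to h since the quotient itself is bounded by the
    inequality of Gronwall. *)
Lemma quot_estimates (a : R) x0 : 0 <= a -> a < e -> U x0 ->
  exists2 M : R, 0 <= M & forall c : R, 0 < c ->
  exists2 d : R, 0 < d & forall x h, `|x - x0| < d -> h != 0 -> `|h| < d ->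
    [/\ U x, U (x + h *: v), quot h x 0 = v *m A &
     forall t : R, `|t| <= a ->
      [/\ forall w, `|dirD F (psi t x) w| <= M * `|w|,
          is_derive t 1 (quot h x) (dquot h x t) &
          `|dquot h x t - dirD F (psi t x) (quot h x t)| <= c]].
Proof.
move=> a0 ae Ux0.
have te t : `|t| <= a -> `|t| < e by move=> ta; exact: le_lt_trans ta ae.
have cont t : `|t| <= a -> jcont psi t x0 by move=> /te ta; exact: psi_cont.
have [|d1 d10 [M1 M10 H1]] := @uniform_near_curve R n N psi x0 a
  (fun M y z => `|F y - F z| <= M * `|y - z| /\
    forall w, `|dirD F z w| <= M * `|w|) cont _.
    move=> t /te ta; have [Wt _] := psi_sol ta Ux0.
    have [r1 r10 [M1 M10 h1]] := local_lipschitz Wo Fs Wt.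
    have [r2 r20 [M2 M20 h2]] := dirD_bound Wo Fs Wt.
    exists (Num.min r1 r2); first by rewrite lt_min r10.
    exists (Num.max M1 M2) => M y z; rewrite ge_max !lt_min.
    move=> /andP[MM1 MM2] /andP[y1 y2] /andP[z1 z2]; split.
      by apply: le_trans (h1 _ _ y1 z1) _; rewrite ler_wpM2r.
    by move=> w; apply: le_trans (h2 _ z2 _) _; rewrite ler_wpM2r.
exists M1 => // c c0.
have [C C0 gron] := @gronwall R N M1 a M10 a0.
pose B := C * (`|v *m A| + 0).
have B0 : 0 <= B by rewrite mulr_ge0 ?addr_ge0// ltW.
(* B bounds the difference quotients. *)
pose c' := c / (B + 1).
have c'0 : 0 < c' by rewrite divr_gt0// ltr_wpDl.
have [|d2 d20 [_ _ H2]] := @uniform_near_curve R n N psi x0 a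
  (fun _ y z => `|F y - F z - dirD F z (y - z)| <= c' * `|y - z|) cont _.
    move=> t /te ta; have [Wt _] := psi_sol ta Ux0.
    have [r r0 h] := strict_diff_row Wo Fs Wt c'0.
    by exists r => //; exists 0 => M y z _; exact: h.
have /nbhs_normP[d3 /= d30 H3] := open_nbhs_nbhs (conj Uo Ux0).
pose dm := Num.min d1 (Num.min d2 d3).
have dm0 : 0 < dm by rewrite !lt_min d10 d20.
pose d := Num.min (dm / 2) (dm / 2 / (`|v| + 1)).
have v1 : 0 < `|v| + 1 by rewrite ltr_wpDl.
have d0 : 0 < d by rewrite lt_min !divr_gt0.
exists d => // x h xd h0 hd.
have xm : `|x - x0| < dm.
  apply: lt_le_trans xd _; rewrite /d ge_min; apply/orP; left.
  by rewrite ler_pdivrMr// ler_peMr ?ltW// ltr1n.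
have xhm : `|x + h *: v - x0| < dm.
  rewrite addrAC; apply: le_lt_trans (ler_normD _ _) _.
  have -> : dm = dm / 2 + dm / 2 by field.
  apply: ltr_leD.
    by apply: lt_le_trans xd _; rewrite /d ge_min lexx.
  rewrite normrZ; apply: (@le_trans _ _ (dm / 2 / (`|v| + 1) * (`|v| + 1))).
    apply: ler_pM => //; last by rewrite lerDl.
    by apply: le_trans (ltW hd) _; rewrite /d ge_min lexx orbT.
  by rewrite divfK// gt_eqF.
have ball3 y : `|y - x0| < dm -> U y.
  by rewrite !lt_min => /and3P[_ _ y3]; apply: H3; rewrite /ball_/= distrC.
have b1 y : `|y - x0| < dm -> `|y - x0| < d1 by rewrite !lt_min => /and3P[].
have b2 y : `|y - x0| < dm -> `|y - x0| < d2 by rewrite !lt_min => /and3P[].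
have q0 : quot h x 0 = v *m A.
  rewrite /quot !psi0; [|exact: ball3|exact: ball3].
  rewrite mulmxDl -scalemxAl.
  have -> : x *m A + h *: (v *m A) + b - (x *m A + b) = h *: (v *m A).
    by move: (x *m A) (v *m A) => y z; apply/rowP => i; rewrite !mxE; ring.
  by rewrite scalerA mulVf// scale1r.
have qd (t : R) : `|t| <= a -> is_derive t 1 (quot h x) (dquot h x t).
  move=> /te ta; rewrite /quot /dquot.
  have [_ e1] := psi_sol ta (ball3 _ xhm).
  have [_ e2] := psi_sol ta (ball3 _ xm).
  exact: (is_deriveZ h^-1 (is_deriveB e1 e2)).
have qB t : `|t| <= a -> `|quot h x t| <= B.
  move=> ta; rewrite /B -q0; apply: (gron (quot h x) (dquot h x)) => // s sa.
  split; first exact: qd.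
  rewrite addr0 /dquot /quot !normrZ mulrCA ler_wpM2l//.
  exact: (H1 _ _ (b1 _ xhm) (b1 _ xm) s sa).1.
split => //; [exact: ball3|exact: ball3|move=> t ta; split].
- exact: (H1 _ _ (b1 _ xhm) (b1 _ xm) t ta).2.
- exact: qd.
- rewrite /dquot /quot dirDZ -scalerBr normrZ.
  apply: (@le_trans _ _ (c' * `|quot h x t|)).
    rewrite /quot normrZ mulrCA ler_wpM2l//.
    exact: (H2 _ _ (b2 _ xhm) (b2 _ xm) t ta).
  apply: (@le_trans _ _ (c' * (B + 1))).
    by rewrite ler_wpM2l ?ltW// (le_lt_trans (qB _ ta))// ltrDl.
  by rewrite /c' divfK// gt_eqF// ltr_wpDl.
Qed.

(** Two difference quotients solve the same linearized equation up to small
    errors and have the same initial value v A. *)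
Lemma quot_cauchy (a : R) x0 : 0 <= a -> a < e -> U x0 ->
  forall c : R, 0 < c ->
  exists2 d : R, 0 < d & forall x h k, `|x - x0| < d ->
    h != 0 -> `|h| < d -> k != 0 -> `|k| < d ->
     forall t : R, `|t| <= a -> `|quot h x t - quot k x t| <= c.
Proof.
move=> a0 ae Ux0 c c0.
have [M M0 H] := quot_estimates a0 ae Ux0.
have [C C0 gron] := @gronwall R N M a M0 a0.
have c'0 : 0 < c / C / 2 by rewrite !divr_gt0.
have [d d0 hd] := H _ c'0; exists d => // x h k xd h0 hd' k0 kd t ta.
have [_ _ qh0 Hh] := hd x h xd h0 hd'; have [_ _ qk0 Hk] := hd x k xd k0 kd.
have -> : c = C * (`|quot h x 0 - quot k x 0| + (c / C / 2 + c / C / 2)).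
  by rewrite qh0 qk0 subrr normr0; field; rewrite gt_eqF.
apply: (gron (fun t => quot h x t - quot k x t)
  (fun t => dquot h x t - dquot k x t)) => //.
  by rewrite addr_ge0// ltW.
move=> s sa; have [LD dh eh] := Hh s sa; have [_ dk ek] := Hk s sa.
split; first exact: is_deriveB.
have -> : dquot h x s - dquot k x s =
  dirD F (psi s x) (quot h x s - quot k x s) +
  ((dquot h x s - dirD F (psi s x) (quot h x s)) -
   (dquot k x s - dirD F (psi s x) (quot k x s))).
  by rewrite dirDB; apply/rowP => i; rewrite !mxE; ring.
apply: le_trans (ler_normD _ _) _; apply: lerD; first exact: LD.
by apply: le_trans (ler_normB _ _) _; exact: lerD.
Qed.

Lemma line_quot t x :
  (fun h : R => h^-1 *: ((psi t \o shift x) (h *: v) - psi t x)) =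
  (fun h : R => quot h x t).
Proof. by apply/funext => h; rewrite /quot /= (addrC x). Qed.

(** The difference quotients converge uniformly in t and x; this uniformity,
    and not only the derivative itself, gives the next lemmas. *)
Lemma quot_limit (a : R) x0 : 0 <= a -> a < e -> U x0 ->
  forall c : R, 0 < c ->
  exists2 d : R, 0 < d & forall x, `|x - x0| < d -> forall t : R, `|t| <= a ->
    derivable (psi t) x v /\ forall h, h != 0 -> `|h| < d ->
     `|quot h x t - 'D_v (psi t) x| <= c.
Proof.
move=> a0 ae Ux0.
have H := quot_cauchy a0 ae Ux0.
have /nbhs_normP[d1 /= d10 H1] := open_nbhs_nbhs (conj Uo Ux0).
have D x t : `|x - x0| < d1 -> `|t| <= a -> derivable (psi t) x v.
  move=> xd ta; have Ux : U x by apply: H1; rewrite /ball_/= distrC.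
  rewrite /derivable line_quot//; apply/cauchy_cvgP/cauchy_exP => c c0.
  have c20 : 0 < c / 2 by rewrite divr_gt0.
  have [d d0 hd] := quot_cauchy a0 ae Ux c20.
  pose k := d / 2.
  have k0 : 0 < k by rewrite divr_gt0.
  have kd : `|k| < d by rewrite gtr0_norm// /k ltr_pdivrMr// ltr_pMr// ltr1n.
  exists (quot k x t); rewrite /nbhs/=; near=> h.
  have h0 : h != 0 by near: h; exact: nbhs_dnbhs_neq.
  have hd' : `|h| < d by near: h; exact: dnbhs0_lt.
  rewrite -ball_normE /ball_/=; apply: (@le_lt_trans _ _ (c / 2)); last first.
    by rewrite ltr_pdivrMr// ltr_pMr// ltr1n.
  by apply: hd => //; [rewrite subrr normr0|rewrite gt_eqF].
move=> c c0; have [d d0 hd] := H c c0.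
exists (Num.min d d1); first by rewrite lt_min d0.
move=> x; rewrite lt_min => /andP[xd xd1] t ta; split; first exact: D.
move=> h h0; rewrite lt_min => /andP[hd' _].
have Ux : U x by apply: H1; rewrite /ball_/= distrC.
have L : quot k x t @[k --> 0^'] --> 'D_v (psi t) x.
  by rewrite -line_quot//; exact: (D x t xd1 ta).
have L' : `|quot h x t - quot k x t| @[k --> 0^'] --> `|quot h x t - 'D_v (psi t) x|.
  by apply: cvg_norm; apply: cvgB L; exact: cvg_cst.
apply: (cvgr_to_le L'); near=> k.
have k0 : k != 0 by near: k; exact: nbhs_dnbhs_neq.
have kd : `|k| < d by near: k; exact: dnbhs0_lt.
exact: hd.
Unshelve. all: by end_near. Qed.

Lemma variational_derivable (t : R) x : `|t| < e -> U x -> derivable (psi t) x v.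
Proof.
move=> te Ux; have [d d0 hd] := quot_limit (normr_ge0 t) te Ux ltr01.
by apply: (hd x _ t (lexx _)).1; rewrite subrr normr0.
Qed.

Lemma variational_init x : U x -> 0 < e -> 'D_v (psi 0) x = v *m A.
Proof.
move=> Ux e0; have [M M0 H] := quot_estimates (lexx 0) e0 Ux.
have [d d0 hd] := H 1 ltr01.
have xd : `|x - x| < d by rewrite subrr normr0.
have n0 : `|0 : R| < e by rewrite normr0.
have L : quot k x 0 @[k --> 0^'] --> 'D_v (psi 0) x.
  by rewrite -line_quot//; exact: (variational_derivable n0 Ux).
suff L' : quot k x 0 @[k --> 0^'] --> v *m A by exact: (cvg_unique _ L L').
apply: cvg_trans (@cvg_cst _ (v *m A) _ (0^') _); apply: near_eq_cvg.
near=> k; have k0 : k != 0 by near: k; exact: nbhs_dnbhs_neq.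
have kd : `|k| < d by near: k; exact: dnbhs0_lt.
by have [] := hd x k xd k0 kd.
Unshelve. all: by end_near. Qed.

Lemma between_lt (t e' : R) : `|t| < e' -> exists2 a : R, `|t| < a & a < e'.
Proof.
by move=> te; exists ((`|t| + e') / 2); [rewrite midf_lt|rewrite midf_lt].
Qed.

(** A uniform limit of continuous functions: with one fixed step h, the
    quotient at h is within c / 4 of the derivative at both points, and is
    itself continuous. *)
Lemma variational_jcont (t : R) x0 : `|t| < e -> U x0 ->
  jcont (fun t x => 'D_v (psi t) x) t x0.
Proof.
move=> te Ux0 c c0.
have [a ta ae] := between_lt te.
have a0 : 0 <= a by exact: le_trans (ltW ta).
have c4 : 0 < c / 4 by rewrite divr_gt0.
have [d d0 hd] := quot_limit a0 ae Ux0 c4.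
have [M M0 HE] := quot_estimates a0 ae Ux0.
have [d' d'0 hd'] := HE 1 ltr01.
pose h := Num.min d d' / 2.
have m0 : 0 < Num.min d d' by rewrite lt_min d0.
have h0 : 0 < h by rewrite divr_gt0.
have hm : `|h| < Num.min d d'.
  by rewrite gtr0_norm// /h ltr_pdivrMr// ltr_pMr// ltr1n.
have [hd1 hd2] : `|h| < d /\ `|h| < d' by move: hm; rewrite lt_min => /andP[].
have hn : h != 0 by rewrite gt_eqF.
have [_ Uh _ _] := hd' x0 h (ltac:(by rewrite subrr normr0)) hn hd2.
have ch : 0 < c / 8 * h by rewrite mulr_gt0// divr_gt0.
have [r1 r10 hr1] := psi_cont te Uh ch.
have [r2 r20 hr2] := psi_cont te Ux0 ch.
exists (Num.min (Num.min r1 r2) (Num.min d (a - `|t|))).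
  by rewrite !lt_min r10 r20 d0 subr_gt0.
move=> t' x'; rewrite !lt_min => /andP[/andP[t1 t2] /andP[_ t3]].
move=> /andP[/andP[x1 x2] /andP[x3 _]].
have t'a : `|t'| <= a.
  rewrite -[t'](subrK t) addrC (le_trans (ler_normD _ _))//.
  by rewrite -lerBrDl ltW.
have xx : `|x0 - x0| < d by rewrite subrr normr0.
have q1 := (hd x' x3 t' t'a).2 h hn hd1.
have q2 := (hd x0 xx t (ltW ta)).2 h hn hd1.
have q3 : `|quot h x' t' - quot h x0 t| <= c / 4.
  rewrite /quot -scalerBr normrZ normfV gtr0_norm// ler_pdivrMl//.
  have -> : psi t' (x' + h *: v) - psi t' x' - (psi t (x0 + h *: v) - psi t x0) =
     (psi t' (x' + h *: v) - psi t (x0 + h *: v)) - (psi t' x' - psi t x0).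
    by apply/rowP => i; rewrite !mxE; ring.
  have -> : h * (c / 4) = c / 8 * h + c / 8 * h by field.
  apply: le_trans (ler_normB _ _) _; apply: lerD; last by rewrite ltW// hr2.
  rewrite ltW// hr1//.
  by rewrite opprD addrACA subrr addr0.
have -> : 'D_v (psi t') x' - 'D_v (psi t) x0 =
  ('D_v (psi t') x' - quot h x' t') + (quot h x' t' - quot h x0 t) +
  (quot h x0 t - 'D_v (psi t) x0).
  by rewrite -addrA subrKA subrKA.
apply: (@le_lt_trans _ _ (c / 4 + c / 4 + c / 4)); last exact: three_quarters_lt.
apply: le_trans (ler_normD _ _) _; apply: lerD; last exact: q2.
apply: le_trans (ler_normD _ _) _; apply: lerD; last exact: q3.
rewrite distrC; exact: q1.
Qed.

Lemma jcont_at m k (f : R -> 'rV[R]_m -> 'rV[R]_k) (t : R) x :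
  jcont f t x -> {for t, continuous (f^~ x)}.
Proof.
move=> fc; apply/cvgrPdist_lt => c c0; have [d d0 hd] := fc c c0.
apply: filterS (near_norm_lt (t : R) d0) => s ts.
by rewrite distrC; apply: hd; [rewrite distrC|rewrite subrr normr0].
Qed.

(** The limit of the approximate equations of quot_estimates. *)
Lemma variational_equation (t : R) x : `|t| < e -> U x ->
  is_derive t 1 (fun t => 'D_v (psi t) x)
    (dirD F (psi t x) ('D_v (psi t) x)).
Proof.
move=> te Ux; apply/is_derive_rowP => i.
have [a ta ae] := between_lt te.
have a0 : 0 <= a by exact: le_trans (ltW ta).
have r0 : 0 < a - `|t| by rewrite subr_gt0.
have sa s : `|s - t| < a - `|t| -> `|s| <= a.
  move=> st; rewrite -[s](subrK t) addrC (le_trans (ler_normD _ _))//.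
  by rewrite -lerBrDl ltW.
have [M M0 HE] := quot_estimates a0 ae Ux.
have xx (d : R) : 0 < d -> `|x - x| < d by rewrite subrr normr0.
apply: (@is_derive_limit R R (0^') (fun h s => quot h x s 0 i)
  (fun h s => dquot h x s 0 i) (fun s => 'D_v (psi s) x 0 i)
  (fun s => dirD F (psi s x) ('D_v (psi s) x) 0 i) t _ _ r0).
- move=> s /sa s'; have se := le_lt_trans s' ae.
  have L : quot k x s @[k --> 0^'] --> 'D_v (psi s) x.
    by rewrite -line_quot//; exact: (variational_derivable se Ux).
  by move/cvg_coordP: L; exact.
- have -> : (fun s => dirD F (psi s x) ('D_v (psi s) x) 0 i) =
    (fun s => \sum_j 'D_v (psi s) x 0 j * 'D_(e_ j) (fun y => F y 0 i) (psi s x)).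
    by apply/funext => s; rewrite mxE.
  have [Wt _] := psi_sol te Ux.
  apply: cvg_sumR => j; apply: cvgM.
    have /continuous_coordP K := jcont_at (variational_jcont te Ux); exact: K.
  apply: (@continuous_comp _ _ _ (psi^~ x) ('D_(e_ j) (fun y => F y 0 i))).
    exact: jcont_at (psi_cont te Ux).
  have FC := smooth_C1 Wo ((smooth_rowP F Wo).1 Fs i) Wt.
  exact: (FC j).2.
- have [d d0 hd] := HE 1 ltr01.
  near=> h => s /sa s'.
  have h0 : h != 0 by near: h; exact: nbhs_dnbhs_neq.
  have hd' : `|h| < d by near: h; exact: dnbhs0_lt.
  have [_ _ _ K] := hd x h (xx _ d0) h0 hd'.
  by have [_ /is_derive_rowP D _] := K s s'; exact: D.
- move=> c c0.
  have c20 : 0 < c / 2 by rewrite divr_gt0.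
  have M1 : 0 < M + 1 by rewrite ltr_wpDl.
  have cM : 0 < c / 2 / (M + 1) by rewrite divr_gt0.
  have [d d0 hd] := HE _ c20.
  have [d' d'0 hd'] := quot_limit a0 ae Ux cM.
  near=> h => s /sa s'.
  have h0 : h != 0 by near: h; exact: nbhs_dnbhs_neq.
  have hd1 : `|h| < d by near: h; exact: dnbhs0_lt.
  have hd2 : `|h| < d' by near: h; exact: dnbhs0_lt.
  have [_ _ _ K] := hd x h (xx _ d0) h0 hd1.
  have [LD _ E] := K s s'.
  have Q := (hd' x (xx _ d'0) s s').2 h h0 hd2.
  set z := dirD F (psi s x) ('D_v (psi s) x).
  apply: (@le_trans _ _ `|dquot h x s - z|).
    by have := coord_le_norm (dquot h x s - z) 0 i; rewrite !mxE.
  rewrite -[dquot h x s](subrK (dirD F (psi s x) (quot h x s))) -addrA.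
  apply: le_trans (ler_normD _ _) _; rewrite [c]splitr; apply: lerD => //.
  rewrite -dirDB; apply: le_trans (LD _) _.
  apply: (@le_trans _ _ ((M + 1) * (c / 2 / (M + 1)))).
    by apply: ler_pM => //; rewrite lerDl.
  by rewrite mulrC divfK// gt_eqF.
Unshelve. all: by end_near. Qed.

End Variational.

(** * Smoothness of flows *)

Section SmoothFlow.
Context {R : realType}.
Opaque smooth_on.

Local Notation e_ i := (delta_mx (0 : 'I_1) i).

(** The vector field on the tangent space whose integral curves are the
    pairs of an integral curve of F and a solution of the linearized
    equation along it. *)
Definition tangent_lift N (F : 'rV[R]_N -> 'rV[R]_N) (z : 'rV[R]_(N + N)) :
    'rV[R]_(N + N) :=
  row_mx (F (lsubmx z)) (dirD F (lsubmx z) (rsubmx z)).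

Lemma open_lsubmx m k (W : set 'rV[R]_m) :
  open W -> open [set z : 'rV[R]_(m + k) | W (lsubmx z)].
Proof.
move=> Wo; apply: (@open_comp _ _ lsubmx) => // z _.
by apply/differentiable_continuous/differentiable_lsubmx.
Qed.

Lemma open_rsubmx m k (W : set 'rV[R]_k) :
  open W -> open [set z : 'rV[R]_(m + k) | W (rsubmx z)].
Proof.
move=> Wo; apply: (@open_comp _ _ rsubmx) => // z _.
by apply/differentiable_continuous/differentiable_rsubmx.
Qed.

Lemma smooth_lsubmx m k (D : set 'rV[R]_(m + k)) : open D ->
  smooth_on D (lsubmx : 'rV[R]_(m + k) -> 'rV[R]_m).
Proof.
move=> Do; apply: (smooth_rowP _ Do).2 => j.
have -> : (fun x : 'rV[R]_(m + k) => lsubmx x 0 j) = (fun x => x 0 (lshift k j)).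
  by apply/funext => x; rewrite mxE.
exact: smooth_coordinate.
Qed.

Lemma smooth_rsubmx m k (D : set 'rV[R]_(m + k)) : open D ->
  smooth_on D (rsubmx : 'rV[R]_(m + k) -> 'rV[R]_k).
Proof.
move=> Do; apply: (smooth_rowP _ Do).2 => j.
have -> : (fun x : 'rV[R]_(m + k) => rsubmx x 0 j) = (fun x => x 0 (rshift m j)).
  by apply/funext => x; rewrite mxE.
exact: smooth_coordinate.
Qed.

Lemma smooth_row_mx n m k (D : set 'rV[R]_n) (f : 'rV[R]_n -> 'rV[R]_m)
    (g : 'rV[R]_n -> 'rV[R]_k) : open D ->
  smooth_on D f -> smooth_on D g -> smooth_on D (fun x => row_mx (f x) (g x)).
Proof.
move=> Do fs gs; apply: (smooth_rowP _ Do).2 => j.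
case: (fintype.splitP j) => i ji.
  have -> : (fun x => row_mx (f x) (g x) 0 j) = (fun x => f x 0 i).
    apply/funext => x; rewrite -[RHS](row_mxEl (f x) (g x)); congr (row_mx _ _ _ _).
    exact: val_inj.
  exact: (smooth_rowP _ Do).1.
have -> : (fun x => row_mx (f x) (g x) 0 j) = (fun x => g x 0 i).
  apply/funext => x; rewrite -[RHS](row_mxEr (f x) (g x)); congr (row_mx _ _ _ _).
  exact: val_inj.
exact: (smooth_rowP _ Do).1.
Qed.

Lemma tangent_lift_smooth N (W : set 'rV[R]_N) (F : 'rV[R]_N -> 'rV[R]_N) :
  open W -> smooth_on W F ->
  smooth_on [set z | W (lsubmx z)] (tangent_lift F).
Proof.
move=> Wo Fs; have Do := @open_lsubmx N N W Wo.
apply: smooth_row_mx => //.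
  exact: (smooth_comp_mx Do Wo (fun x Wx => Wx) Fs (smooth_lsubmx Do)).
apply: (smooth_rowP _ Do).2 => i.
have -> : (fun x : 'rV[R]_(N + N) => dirD F (lsubmx x) (rsubmx x) 0 i) =
  (fun x => \sum_j rsubmx x 0 j * ('D_(e_ j) (fun y => F y 0 i) \o lsubmx) x).
  by apply/funext => x; rewrite mxE.
apply: smooth_sum => // j; apply: smooth_mul => //.
  exact: ((smooth_rowP _ Do).1 (smooth_rsubmx Do) j).
apply: (smooth_comp Do Wo (fun x Wx => Wx) _ (smooth_lsubmx Do)).
by apply: smooth_partial; exact: (smooth_rowP F Wo).1.
Qed.

Lemma is_derive_row_mx (V : normedModType R) m k (f : V -> 'rV[R]_m)
    (g : V -> 'rV[R]_k) x v df dg :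
  is_derive x v f df -> is_derive x v g dg ->
  is_derive x v (fun y => row_mx (f y) (g y)) (row_mx df dg).
Proof.
move=> /is_derive_rowP fd /is_derive_rowP gd; apply/is_derive_rowP => j.
case: (fintype.splitP j) => i ji.
  have -> : j = lshift k i by exact: val_inj.
  rewrite row_mxEl; have := fd i; congr (is_derive _ _ _ _).
  by apply/funext => y; rewrite row_mxEl.
have -> : j = rshift m i by exact: val_inj.
rewrite row_mxEr; have := gd i; congr (is_derive _ _ _ _).
by apply/funext => y; rewrite row_mxEr.
Qed.

Lemma norm_row_mx_lt m k (a : 'rV[R]_m) (b : 'rV[R]_k) c :
  `|a| < c -> `|b| < c -> `|row_mx a b| < c.
Proof.
move=> ac bc; apply: norm_lt_coord; first exact: le_lt_trans ac.
move=> i j; rewrite (ord1 i); case: (fintype.splitP j) => l jl.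
  have -> : j = lshift k l by exact: val_inj.
  by rewrite row_mxEl; exact: le_lt_trans (coord_le_norm _ _ _) ac.
have -> : j = rshift m l by exact: val_inj.
by rewrite row_mxEr; exact: le_lt_trans (coord_le_norm _ _ _) bc.
Qed.

(** The class of flow families is closed under adjoining derivatives in the
    parameter. This is what makes the coinduction of smooth_flow close up. *)
Lemma flow_family_lift n N (W : set 'rV[R]_N) F e (U : set 'rV[R]_n) psi v :
  open W -> smooth_on W F -> open U -> 0 < e ->
  flow_family W F e U psi ->
  flow_family [set z | W (lsubmx z)] (tangent_lift F) e U
    (fun t x => row_mx (psi t x) ('D_v (psi t) x)).
Proof.
move=> Wo Fs Uo e0 [sol cont [A [b init]]]; split.
- move=> t x te Ux; split; first by rewrite /= row_mxKl; exact: (sol t x te Ux).1.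
  rewrite /tangent_lift row_mxKl row_mxKr; apply: is_derive_row_mx.
    exact: (sol t x te Ux).2.
  exact: (variational_equation Wo Fs Uo sol cont init).
- move=> t x te Ux c c0.
  have [d1 d10 h1] := cont t x te Ux c c0.
  have [d2 d20 h2] := variational_jcont Wo Fs Uo sol cont init v te Ux c0.
  exists (Num.min d1 d2); first by rewrite lt_min d10.
  move=> t' x'; rewrite !lt_min => /andP[t1 t2] /andP[x1 x2].
  rewrite opp_row_mx add_row_mx; apply: norm_row_mx_lt; first exact: h1.
  exact: h2.
- exists (row_mx A 0), (row_mx b (v *m A)) => x Ux.
  rewrite mul_mx_row mulmx0 add_row_mx add0r -init//.
  by rewrite (variational_init Wo Fs Uo sol cont init).
Qed.

Definition cylinder n (e : R) (U : set 'rV[R]_n) : set 'rV[R]_(1 + n) :=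
  [set z | `|lsubmx z 0 0| < e /\ U (rsubmx z)].

Lemma cylinder_open n e (U : set 'rV[R]_n) : open U -> open (cylinder e U).
Proof.
move=> Uo; apply: openI; last exact: open_rsubmx.
have Io : open [set a : 'rV[R]_1 | `|a 0 0| < e].
  apply: (@open_comp _ _ (fun a : 'rV[R]_1 => `|a 0 0|) [set x | x < e]).
    move=> a _; apply: (@continuous_comp _ _ _ (fun a : 'rV[R]_1 => a 0 0)).
      by apply/differentiable_continuous/differentiable_coord.
    exact: norm_continuous.
  exact: open_lt.
exact: open_lsubmx Io.
Qed.

(** Time and parameter combined into one vector variable, in which
    smoothness is expressed. *)
Definition on_cylinder n (T : Type) (f : R -> 'rV[R]_n -> T) (z : 'rV[R]_(1 + n)) : T :=
  f (lsubmx z 0 0) (rsubmx z).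

Lemma is_derive_time n (f : R -> 'rV[R]_n -> R) (z : 'rV[R]_(1 + n)) d :
  is_derive (lsubmx z 0 0 : R) 1 (f^~ (rsubmx z)) d ->
  is_derive z (e_ (lshift n 0)) (on_cylinder f) d.
Proof.
move=> fd; rewrite -[z]addr0 -(scale0r (e_ (lshift n (0:'I_1)))).
apply: (is_derive_line _ _ _ _ _).2.
have -> : (fun s : R => on_cylinder f (z + s *: e_ (lshift n (0:'I_1)))) =
   (fun s => f (lsubmx z 0 0 + s *: 1) (rsubmx z)).
  apply/funext => s; rewrite /on_cylinder; congr (f _ _).
    by rewrite !mxE/= ?eqxx.
  apply/rowP => j; rewrite !mxE/=.
  by rewrite ?eq_rlshift ?mulr0 ?addr0.
apply: (is_derive_line (f^~ (rsubmx z)) (lsubmx z 0 0 : R) (1 : R) 0 d).1.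
by rewrite scale0r addr0.
Qed.

Lemma is_derive_space n (f : R -> 'rV[R]_n -> R) z j d :
  is_derive (rsubmx z) (e_ j) (f (lsubmx z 0 0)) d ->
  is_derive z (e_ (rshift 1 j)) (on_cylinder f) d.
Proof.
move=> fd; rewrite -[z]addr0 -(scale0r (e_ (rshift 1 j))).
apply: (is_derive_line _ _ _ _ _).2.
have -> : (fun s : R => on_cylinder f (z + s *: e_ (rshift 1 j))) =
   (fun s => f (lsubmx z 0 0) (rsubmx z + s *: e_ j)).
  apply/funext => s; rewrite /on_cylinder; congr (f _ _).
    by rewrite !mxE/= ?eq_lrshift ?mulr0 ?addr0.
  apply/rowP => i; rewrite !mxE/=; congr (_ + _ * (_ _)%:R).
apply: (is_derive_line (f (lsubmx z 0 0)) (rsubmx z) (e_ j) 0 d).1.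
by rewrite scale0r addr0.
Qed.

Lemma jcont_on_cylinder n N (f : R -> 'rV[R]_n -> 'rV[R]_N) z :
  jcont f (lsubmx z 0 0) (rsubmx z) -> {for z, continuous (on_cylinder f)}.
Proof.
move=> fc; apply/(@cvgrPdist_lt _ _ _ (nbhs z) _) => c c0.
have [d d0 hd] := fc c c0.
apply: (@filterS _ (nbhs z) (nbhs_filter z))
  (near_norm_lt (z : (matrix R 1 (1 + n) : normedModType R)) d0).
move=> y; rewrite distrC => zy; rewrite distrC; apply: hd.
  apply: le_lt_trans zy; have := coord_le_norm (y - z) 0 (lshift n 0).
  by rewrite !mxE.
apply: le_lt_trans zy; apply: norm_le_coord => // i j.
have := coord_le_norm (y - z) i (rshift 1 j).
by rewrite !mxE.
Qed.

(** By smooth_coind, with G the set of all functions G' (psi' t x), for all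
    phase spaces, smooth fields, flow families and smooth observables G' at
    once. The time derivative of such a function replaces G' by its
    derivative along F', and a derivative in x replaces the family by its
    tangent lift; no derivative of order higher than one is ever computed. *)
Lemma smooth_flow n N (W : set 'rV[R]_N) F e (U : set 'rV[R]_n) psi
    (G : 'rV[R]_N -> R) :
  open W -> smooth_on W F -> open U -> 0 < e ->
  flow_family W F e U psi -> smooth_on W G ->
  smooth_on (cylinder e U) (on_cylinder (fun t x => G (psi t x))).
Proof.
move=> Wo0 Fs0 Uo e0 fam0 Gs0.
pose Gen : set ('rV[R]_(1 + n) -> R) := [set h |
  exists N (W : set 'rV[R]_N) F psi (G : 'rV[R]_N -> R),
   [/\ open W, smooth_on W F, flow_family W F e U psi, smooth_on W G &
     h = on_cylinder (fun t x => G (psi t x))]].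
have time N' (W' : set 'rV[R]_N') F' psi' G' (t : R) x : open W' -> smooth_on W' F' ->
    flow_family W' F' e U psi' -> smooth_on W' G' -> `|t| < e -> U x ->
    is_derive t 1 (fun s => G' (psi' s x))
      (\sum_k F' (psi' t x) 0 k * 'D_(e_ k) G' (psi' t x)).
  move=> Wo Fs [sol _ _] Gs te Ux; have [Wt dt] := sol t x te Ux.
  apply: (@is_derive_chain R N' R G' (psi'^~ x) t 1
    (fun k => F' (psi' t x) 0 k)); first exact: smooth_C1 Wo Gs Wt.
  exact: (is_derive_rowP _ _ _ _).1.
have space N' (W' : set 'rV[R]_N') F' psi' G' (t : R) x j : open W' -> smooth_on W' F' ->
    flow_family W' F' e U psi' -> smooth_on W' G' -> `|t| < e -> U x ->
    is_derive x (e_ j) (fun y => G' (psi' t y))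
      (\sum_k 'D_(e_ j) (psi' t) x 0 k * 'D_(e_ k) G' (psi' t x)).
  move=> Wo Fs [sol cont [A [b init]]] Gs te Ux; have [Wt _] := sol t x te Ux.
  apply: (@is_derive_chain R N' _ G' (psi' t) x (e_ j)
    (fun k => 'D_(e_ j) (psi' t) x 0 k)); first exact: smooth_C1 Wo Gs Wt.
  apply: (is_derive_rowP _ _ _ _).1; apply: derivableP.
  exact: (variational_derivable Wo Fs Uo sol cont init).
have gen0 : Gen (on_cylinder (fun t x => G (psi t x))).
  by exists N, W, F, psi, G; split; [exact: Wo0|exact: Fs0|exact: fam0|exact: Gs0|].
apply: (@smooth_coind _ _ Gen); [exact: cylinder_open| | |exact: alg_gen]; last first.
- move=> h i [N' [W' [F' [psi' [G' [Wo Fs fam Gs ->]]]]]].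
  case: (fintype.splitP i) => j ij.
    have -> : i = lshift n j by exact: val_inj.
    rewrite (ord1 j).
    pose K y := \sum_k F' y 0 k * 'D_(e_ k) G' y.
    exists (on_cylinder (fun t x => K (psi' t x))).
      apply: alg_gen; exists N', W', F', psi', K.
      split; [exact: Wo|exact: Fs|exact: fam| |by []].
      apply: smooth_sum; first exact: Wo.
      move=> k; apply: smooth_mul; first exact: Wo.
        exact: ((smooth_rowP _ Wo).1 Fs k).
      exact: smooth_partial.
    move=> z [te Uz].
    by have [_ ->] := is_derive_time (f := fun t x => G' (psi' t x))
        (time _ _ _ _ _ _ _ Wo Fs fam Gs te Uz).
  have -> : i = rshift 1 j by exact: val_inj.
  pose K (y : 'rV[R]_(N' + N')) :=
    \sum_k rsubmx y 0 k * ('D_(e_ k) G' \o lsubmx) y.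
  exists (on_cylinder (fun t x => K (row_mx (psi' t x) ('D_(e_ j) (psi' t) x)))).
    have Lo := @open_lsubmx N' N' W' Wo.
    apply: alg_gen; exists (N' + N')%N, [set z | W' (lsubmx z)],
      (tangent_lift F'), (fun t x => row_mx (psi' t x) ('D_(e_ j) (psi' t) x)), K.
    split; [exact: Lo|exact: tangent_lift_smooth|exact: flow_family_lift| |by []].
      apply: smooth_sum; first exact: Lo.
      move=> k; apply: smooth_mul; first exact: Lo.
        exact: ((smooth_rowP _ Lo).1 (smooth_rsubmx Lo) k).
      apply: (smooth_comp Lo Wo (fun x Wx => Wx) _ (smooth_lsubmx Lo)).
      exact: smooth_partial.
  move=> z [te Uz].
  have [_ ->] := is_derive_space (f := fun t x => G' (psi' t x))
        (space _ _ _ _ _ _ _ j Wo Fs fam Gs te Uz).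
  by rewrite /on_cylinder /K /= row_mxKl row_mxKr.
- move=> h z [N' [W' [F' [psi' [G' [Wo Fs fam Gs ->]]]]]] [te Uz].
  split; last first.
    move=> i; case: (fintype.splitP i) => j ij.
      have -> : i = lshift n j by exact: val_inj.
      rewrite (ord1 j).
      by have [] := is_derive_time (f := fun t x => G' (psi' t x))
        (time _ _ _ _ _ _ _ Wo Fs fam Gs te Uz).
    have -> : i = rshift 1 j by exact: val_inj.
    by have [] := is_derive_space (f := fun t x => G' (psi' t x))
        (space _ _ _ _ _ _ _ j Wo Fs fam Gs te Uz).
  have [sol cont _] := fam; have [Wz _] := sol _ _ te Uz.
  apply: (@continuous_comp _ _ _ (on_cylinder psi') G').
    exact: jcont_on_cylinder (cont _ _ te Uz).
  exact: smooth_continuous Gs Wz.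
Qed.

End SmoothFlow.

(** * The local flow of a smooth vector field *)

Section LocalFlow.
Context {R : realType} {N : nat}.
Opaque smooth_on.

Definition cube (p : 'rV[R]_N) (r : R) : set 'rV[R]_N := [set x | `|x - p| < r].

Lemma cube_open p r : open (cube p r).
Proof.
have -> : cube p r = ball_ Num.Def.normr p r.
  by apply/seteqP; split=> x; rewrite /cube /ball_/= distrC.
have -> : ball_ Num.Def.normr p r = ball p r by rewrite -ball_normE.
have [r0|r0] := ltP 0 r; last first.
  rewrite (_ : ball p r = set0); first exact: open0.
  rewrite -ball_normE; apply/seteqP; split=> x //=.
  by move=> /lt_le_trans/(_ r0); rewrite normr_lt0.
exact: ball_open.
Qed.

(** The continuity in the initial point and the group law both come from the
    inequality of Gronwall applied to the difference of two integral curves. *)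
Lemma local_flow (F : 'rV[R]_N -> 'rV[R]_N) (W : set 'rV[R]_N) p :
  open W -> smooth_on W F -> W p ->
  exists2 r : R, 0 < r & exists2 e : R, 0 < e &
  exists theta : R -> 'rV[R]_N -> 'rV[R]_N,
  [/\ forall (t : R) x, `|t| < e -> cube p r x ->
        W (theta t x) /\ is_derive t 1 (theta^~ x) (F (theta t x)),
      forall x, cube p r x -> theta 0 x = x,
      forall (t : R) x, `|t| < e -> cube p r x -> cube p r (theta t x) ->
        theta (- t) (theta t x) = x
    & smooth_on (cylinder e (cube p r)) (on_cylinder theta)].
Proof.
move=> Wo Fs Wp.
have [r1 r10 [M M0 LF]] := local_lipschitz Wo Fs Wp.
have /nbhs_normP[r2 /= r20 Wr2] := open_nbhs_nbhs (conj Wo Wp).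
pose r0 := Num.min r1 r2 / 2.
have m0 : 0 < Num.min r1 r2 by rewrite lt_min r10.
have r00 : 0 < r0 by rewrite divr_gt0.
have r0m : r0 < Num.min r1 r2 by rewrite /r0 ltr_pdivrMr// ltr_pMr// ltr1n.
move: (r0m); rewrite lt_min => /andP[r01 r02].
have LF' y z : `|y - p| < r0 -> `|z - p| < r0 -> `|F y - F z| <= M * `|y - z|.
  by move=> yp zp; apply: LF; exact: lt_trans r01.
have [e' e'0 sol] : exists2 e : R, 0 < e & forall x : 'rV[R]_N, `|x - p| < r0 / 2 ->
    exists2 y : R -> 'rV[R]_N, y 0 = x & forall t : R, `|t| < e ->
      `|y t - p| < r0 /\ is_derive t 1 y (F (y t)).
  apply: (@local_solution R N F p r0 M) => // y z yp zp.
  by apply: LF; exact: le_lt_trans r01.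
have /choice[Y HY] : forall x : 'rV[R]_N, exists y : R -> 'rV[R]_N,
    `|x - p| < r0 / 2 -> y 0 = x /\ forall t : R, `|t| < e' ->
      `|y t - p| < r0 /\ is_derive t 1 y (F (y t)).
  move=> x; have [xp|xp] := pselect (`|x - p| < r0 / 2); last by exists (fun=> 0).
  by have [y y0 yd] := sol x xp; exists y.
(* The curves exist up to time e' = 2 e, so that the composition of two flows
   of times less than e stays in their domain. *)
pose th t x := Y x t; pose r := r0 / 2; pose e := e' / 2.
have rr : 0 < r by rewrite divr_gt0.
have ee : 0 < e by rewrite divr_gt0.
have lee : e < e' by rewrite /e ltr_pdivrMr// ltr_pMr// ltr1n.
have thd (t : R) x : `|t| < e' -> cube p r x ->
    `|th t x - p| < r0 /\ is_derive t 1 (th^~ x) (F (th t x)).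
  by move=> te xp; exact: (HY x xp).2.
have th0 x : cube p r x -> th 0 x = x by move=> xp; exact: (HY x xp).1.
have thW (t : R) x : `|t| < e' -> cube p r x -> W (th t x).
  move=> te xp; apply: Wr2; rewrite /ball_/= distrC.
  by apply: lt_trans r02; exact: (thd t x te xp).1.
have cont (t : R) x : `|t| < e' -> cube p r x -> jcont th t x.
  move=> te xp c c0.
  have [a ta ae] := between_lt te.
  have a0 : 0 <= a by exact: le_trans (ltW ta).
  have [C C0 gron] := @gronwall R N M a M0 a0.
  have c20 : 0 < c / 2 by rewrite divr_gt0.
  have /cvgrPdist_lt/(_ _ c20)/nbhs_normP[d1 /= d10 hd1] :=
    is_derive_continuous (thd t x te xp).2.
  have /nbhs_normP[d2 /= d20 hd2] := open_nbhs_nbhs (conj (@cube_open p r) xp).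
  pose d := Num.min (Num.min d1 d2) (Num.min (a - `|t|) (c / 2 / C)).
  exists d.
    by rewrite !lt_min d10 d20 subr_gt0 ta/= !divr_gt0.
  move=> t' x'; rewrite !lt_min => /andP[/andP[t1 _] /andP[t2 _]].
  move=> /andP[/andP[_ x1] /andP[_ x2]].
  have x'p : cube p r x' by apply: hd2; rewrite /ball_/= distrC.
  have t'a : `|t'| <= a.
    rewrite -[t'](subrK t) addrC (le_trans (ler_normD _ _))//.
    by rewrite -lerBrDl ltW.
  have -> : th t' x' - th t x = (th t' x' - th t' x) + (th t' x - th t x).
    by rewrite subrKA.
  apply: le_lt_trans (ler_normD _ _) _.
  rewrite [c]splitr; apply: ler_ltD; last first.
    by rewrite distrC; apply: hd1; rewrite /ball_/= distrC.
  apply: (@le_trans _ _ (C * (`|th 0 x' - th 0 x| + 0))).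
    apply: (gron (fun s => th s x' - th s x) (fun s => F (th s x') - F (th s x))) => //.
    move=> s sa; have se := le_lt_trans sa ae.
    have [b1 D1] := thd s x' se x'p; have [b2 D2] := thd s x se xp.
    by split; [exact: is_deriveB|rewrite addr0; exact: LF'].
  rewrite addr0 !th0// mulrC -ler_pdivlMr//; exact: ltW.
exists r => //; exists e => //; exists th; split.
- move=> t x te xp; have te' := lt_trans te lee; split; first exact: thW.
  exact: (thd t x te' xp).2.
- exact: th0.
- move=> t x te xp yp; set y := th t x.
  have t0 := normr_ge0 t.
  have [C C0 gron] := @gronwall R N M `|t| M0 t0.
  have te' := lt_trans te lee.
  have : `|th (- t) y - th (t - t) x| <= C * (`|th 0 y - th (t + 0) x| + 0).
    apply: (gron (fun s => th s y - th (t + s) x)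
      (fun s => F (th s y) - F (th (t + s) x))) => //; last by rewrite normrN.
    move=> s st.
    have se : `|s| < e' by exact: le_lt_trans te'.
    have tse : `|t + s| < e'.
      rewrite (le_lt_trans (ler_normD _ _))//.
      have -> : e' = e + e by rewrite /e; lra.
      by apply: ltrD => //; exact: le_lt_trans te.
    have [b1 D1] := thd s y se yp; have [b2 D2] := thd (t + s) x tse xp.
    split; last by rewrite addr0; exact: LF'.
    apply: is_deriveB.
    apply/is_derive_rowP => i; move/is_derive_rowP: D2 => /(_ i) D2.
    have D3 : is_derive s 1 (fun s => t + s) (1 : R).
      have := @is_deriveD R R R (fun=> t) id s 1 _ _ (is_derive_cst _ _ _) (is_derive_id _ _).
      by rewrite add0r.
    have := @is_derive1_comp R (fun s => th s x 0 i) (fun s => t + s) s _ _ D2 D3.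
    by rewrite mulr1.
  have E : th 0 y - th (t + 0) x = 0 by rewrite addr0 th0// subrr.
  rewrite E normr0 addr0 mulr0 subrr th0// normr_le0 subr_eq0.
  by move/eqP.
- have fam : flow_family W F e (cube p r) th.
    split.
    - move=> t x te xp; have te' := lt_trans te lee; split; first exact: thW.
      exact: (thd t x te' xp).2.
    - by move=> t x te xp; apply: cont => //; exact: lt_trans lee.
    - by exists 1%:M, 0 => x xp; rewrite mulmx1 addr0 th0.
  have Co := @cylinder_open R N e _ (@cube_open p r).
  apply: (smooth_rowP _ Co).2 => j.
  apply: (@smooth_flow R N N W F e (cube p r) th (fun y => y 0 j)) => //.
  - exact: cube_open.
  - exact: smooth_coordinate.
Qed.

End LocalFlow.

(** * Potentials of closed forms *)

Section Poincare.
Context {R : realType} {n : nat}.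
Opaque smooth_on.

Local Notation e_ i := (delta_mx (0 : 'I_1) i).

Lemma C1_continuous (f : 'rV[R]_n -> R) p : C1_at f p -> {for p, continuous f}.
Proof.
move=> fC; have [r r0 hr] := strict_diff fC ltr01.
apply/(@cvgrPdist_lt _ _ _ (nbhs p) _) => c c0.
pose S := \sum_i `|'D_(e_ i) f p|.
have S0 : 0 <= S by apply: sumr_ge0.
have S1 : 0 < S + 1 by rewrite ltr_wpDl.
have d0 : 0 < Num.min r (c / (S + 1)) by rewrite lt_min r0 divr_gt0.
apply: (@filterS _ (nbhs p) (nbhs_filter p))
  (near_norm_lt (p : (matrix R 1 n : normedModType R)) d0).
move=> y; rewrite distrC lt_min => /andP[yr yc]; rewrite distrC.
have := hr y p yr; rewrite subrr normr0 => /(_ r0).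
rewrite mul1r => H.
have A : `|\sum_i (y 0 i - p 0 i) * 'D_(e_ i) f p| <= S * `|y - p|.
  apply: le_trans (ler_norm_sum _ _ _) _; rewrite mulr_suml.
  apply: ler_sum => i _; rewrite normrM mulrC ler_wpM2l//.
  by have := coord_le_norm (y - p) 0 i; rewrite !mxE.
rewrite -[f y - f p](subrK (\sum_i (y 0 i - p 0 i) * 'D_(e_ i) f p)).
apply: le_lt_trans (ler_normD _ _) _.
apply: (@le_lt_trans _ _ ((S + 1) * `|y - p|)).
  by rewrite mulrDl mul1r addrC; exact: lerD.
by rewrite mulrC -ltr_pdivlMr.
Qed.

(** Upgrades a function with smooth partial derivatives: G consists of f and
    the smooth functions. *)
Lemma smooth_of_partials (U : set 'rV[R]_n) (f : 'rV[R]_n -> R)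
    (g : 'I_n -> 'rV[R]_n -> R) : open U ->
  (forall x i, U x -> is_derive x (e_ i) f (g i x)) ->
  (forall i, smooth_on U (g i)) -> smooth_on U f.
Proof.
move=> Uo fd gs.
have fC x : U x -> C1_at f x.
  move=> Ux i; split.
    near=> y; have Uy : U y by near: y; exact: open_nbhs_nbhs.
    by have [] := fd y i Uy.
  apply: near_continuous (smooth_continuous (gs i) Ux).
  near=> y; have Uy : U y by near: y; exact: open_nbhs_nbhs.
  by have [] := fd y i Uy.
pose G : set ('rV[R]_n -> R) := smooth_on U `|` [set f].
apply: (@smooth_coind _ _ G); [exact: Uo| | |by apply: alg_gen; right].
- move=> h x [hs|->] Ux.
    split; first exact: smooth_continuous hs Ux.
    by move=> i; exact: smooth_derivable hs Ux.
  split; first exact: C1_continuous (fC x Ux).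
  by move=> i; have [] := fd x i Ux.
- move=> h i [hs|->].
    exists ('D_(e_ i) h); last by [].
    by apply: alg_gen; left; exact: smooth_partial.
  exists (g i); first by apply: alg_gen; left; exact: gs.
  by move=> x Ux; have [] := fd x i Ux.
Unshelve. all: by end_near. Qed.

Lemma clamp_continuous (r : R) : 0 <= r -> continuous (clamp r).
Proof.
move=> r0 u; apply/cvgrPdist_lt => c c0.
apply: filterS (near_norm_lt (u : R) c0) => v.
exact: le_lt_trans (clamp_lipschitz _ _ r0).
Qed.

Definition ray (p : 'rV[R]_n) (s : R) (x : 'rV[R]_n) := p + s *: (x - p).

Lemma ray_cube p r s x : `|s| <= 1 -> cube p r x -> cube p r (ray p s x).
Proof.
move=> s1 xp; rewrite /cube/= /ray addrC addKr normrZ.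
by apply: le_lt_trans xp; rewrite ler_piMl.
Qed.

Lemma ray_jcont p s x : jcont (ray p) s x.
Proof.
move=> c c0.
have s1 : 0 < `|s| + 1 by rewrite ltr_wpDl.
have x1 : 0 < `|x - p| + 1 by rewrite ltr_wpDl.
exists (Num.min 1 (Num.min (c / 2 / (`|s| + 1)) (c / 2 / (`|x - p| + 1)))).
  by rewrite !lt_min ltr01 !divr_gt0.
move=> s' x'; rewrite !lt_min => /and3P[a1 _ a3] /and3P[b1 b2 _].
have -> : ray p s' x' - ray p s x = s' *: (x' - x) + (s' - s) *: (x - p).
  by rewrite /ray; apply/rowP => i; rewrite !mxE; ring.
apply: le_lt_trans (ler_normD _ _) _; rewrite [c]splitr; apply: ler_ltD.
  rewrite normrZ; apply: (@le_trans _ _ ((`|s| + 1) * (c / 2 / (`|s| + 1)))).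
    apply: ler_pM => //; last exact: ltW.
    rewrite -[s'](subrK s) addrC (le_trans (ler_normD _ _))//.
    by rewrite lerD2l ltW.
  by rewrite mulrC divfK// gt_eqF.
rewrite normrZ; apply: (@le_lt_trans _ _ (`|s' - s| * (`|x - p| + 1))).
  by rewrite ler_wpM2l// lerDl.
by rewrite -ltr_pdivlMr.
Qed.

(** The potential is T x = int_0^1 w(p + s(x - p)) (x - p) ds. The
    derivative of T is not computed under the integral sign: as w is closed,
    h s w_i(p + s(x - p)) is, up to o(h), an antiderivative in s of the
    increment of the integrand from x to x + h e_i; it goes from 0 at s = 0
    to h w_i(x) at s = 1. *)
Lemma poincare (w : 'rV[R]_n -> 'rV[R]_n) p (r : R) : 0 < r ->
  smooth_on (cube p r) w ->
  (forall x, cube p r x -> forall i j, 'D_(e_ i) (fun y => w y 0 j) x =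
     'D_(e_ j) (fun y => w y 0 i) x) ->
  exists2 T : 'rV[R]_n -> R, T p = 0 &
    forall x i, cube p r x -> is_derive x (e_ i) T (w x 0 i).
Proof.
move=> r0 ws wcl.
have Co := @cube_open R n p r.
have wjs j : smooth_on (cube p r) (fun y => w y 0 j) := (smooth_rowP w Co).1 ws j.
pose rho (x : 'rV[R]_n) (s : R) := \sum_j w (ray p s x) 0 j * (x - p) 0 j.
have /choice[G HG] : forall x : 'rV[R]_n, exists G : R -> R, cube p r x ->
    G 0 = 0 /\ forall s : R, `|s| <= 1 -> is_derive s 1 G (rho x s).
  move=> x; have [xp|xp] := pselect (cube p r x); last by exists (fun=> 0).
  (* The truncation keeps the ray inside the cube, so that the integrand is
     continuous on the whole line. *)
  have [|G G0 Gd] := @antiderivative R (rho x \o clamp 1).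
    move=> s; apply: cvg_sumR => j; apply: cvgM; last exact: cvg_cst.
    apply: (@continuous_comp _ _ _ (fun s => ray p (clamp 1 s) x) (fun y => w y 0 j)).
      apply: (@continuous_comp _ _ _ (clamp 1) (ray p ^~ x)).
        exact: clamp_continuous.
      exact: jcont_at (ray_jcont _ _ _).
    apply: smooth_continuous (wjs j) _.
    by apply: ray_cube => //; exact: clamp_norm.
  exists G => _; split=> // s s1; have := Gd s.
  by rewrite /= clamp_id.
exists (fun x => G x 1).
  have pp : cube p r p by rewrite /cube/= subrr normr0.
  rewrite -(HG p pp).1.
  apply: (@eq_is_derive _ (G p) (fun=> G p 0) (fun=> 0) 0 1) => // s /andP[s0 s1].
  split; last exact: is_derive_cst.
  rewrite add0r subr0 mulr1.
  have -> : (0 : R) = rho p s.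
    by rewrite /rho big1// => j _; rewrite subrr mxE mulr0.
  by apply: (HG p pp).2; rewrite ger0_norm.
move=> x i xp.
rewrite -[x]addr0 -(scale0r (e_ i)); apply: (is_derive_line _ _ _ _ _).2.
rewrite scale0r addr0.
apply: is_derive_small => c c0.
(* The final estimate adds n errors weighted by |x - p| and one error of
   weight 1. *)
pose L := n%:R * `|x - p| + 1.
have L0 : 0 < L by rewrite ltr_wpDl// mulr_ge0.
pose c' := c / L.
have c'0 : 0 < c' by rewrite divr_gt0.
have [||d1 d10 [_ _ H]] := @uniform_near_curve R n n (ray p) x 1
  (fun _ y z => `|w y - w z - dirD w z (y - z)| <= c' * `|y - z| /\
    `|w y - w z| <= c').
- by move=> t _; exact: ray_jcont.
- move=> t t1; have tp := ray_cube t1 xp.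
  have [r1 r10 h1] := strict_diff_row Co ws tp c'0.
  have [r2 r20 [M M0 h2]] := local_lipschitz Co ws tp.
  have M1 : 0 < M + 1 by rewrite ltr_wpDl.
  exists (Num.min (Num.min r1 r2) (c' / (M + 1) / 2)).
    by rewrite !lt_min r10 r20 !divr_gt0.
  exists 0 => _ y z _; rewrite !lt_min => /andP[/andP[y1 y2] y3] /andP[/andP[z1 z2] z3].
  split; first exact: h1.
  apply: le_trans (h2 _ _ y2 z2) _.
  apply: (@le_trans _ _ ((M + 1) * (c' / (M + 1)))); last first.
    by rewrite mulrC divfK// gt_eqF.
  apply: ler_pM => //; first by rewrite lerDl.
  have -> : y - z = (y - ray p t x) - (z - ray p t x) by rewrite opprB addrA subrK.
  apply: le_trans (ler_normB _ _) _; rewrite [leRHS]splitr.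
  by apply: lerD; exact: ltW.
have /nbhs_normP[d2 /= d20 hd2] := open_nbhs_nbhs (conj Co xp).
exists (Num.min d1 d2); first by rewrite lt_min d10.
move=> h; rewrite lt_min => /andP[h1 h2].
rewrite add0r scale0r addr0.
set x' := x + h *: e_ i.
have eN : `|e_ i : 'rV[R]_n| <= 1.
  apply: norm_le_coord => // k j; rewrite !mxE (ord1 k) eqxx/=.
  by case: (_ == _); rewrite ?normr1 ?normr0.
have hN : `|h *: e_ i : 'rV[R]_n| <= `|h| by rewrite normrZ ler_piMr.
have x'x : x' - x = h *: e_ i by rewrite /x' addrC addKr.
have x'd1 : `|x' - x| < d1 by rewrite x'x; exact: le_lt_trans hN h1.
have x'p : cube p r x'.
  by apply: hd2; rewrite /ball_/= distrC x'x; exact: le_lt_trans hN h2.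
have xd1 : `|x - x| < d1 by rewrite subrr normr0.
pose dpi s := w (ray p s x) 0 i +
  s * \sum_j (x - p) 0 j * 'D_(e_ j) (fun y => w y 0 i) (ray p s x).
have dray (s : R) : is_derive s 1 (ray p ^~ x) (x - p).
  apply/is_derive_rowP => j.
  have D1 := @is_deriveM R R id (fun=> (x - p) 0 j) s 1 _ _ (is_derive_id _ _) (is_derive_cst _ _ _).
  have := @is_deriveD R R R (fun=> p 0 j) _ s 1 _ _ (is_derive_cst _ _ _) D1.
  rewrite scaler0 !add0r scale_mul mulr1; congr (is_derive _ _ _ _).
  apply/funext => u.
  by have -> : ray p u x 0 j = p 0 j + u * (x - p) 0 j by rewrite !mxE.
have dpiE (s : R) : `|s| <= 1 -> is_derive s 1 (fun s => s * w (ray p s x) 0 i) (dpi s).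
  move=> s1.
  have d1' : is_derive s 1 (fun s => w (ray p s x) 0 i)
      (\sum_j (x - p) 0 j * 'D_(e_ j) (fun y => w y 0 i) (ray p s x)).
    apply: (@is_derive_chain R n R (fun y => w y 0 i) (ray p ^~ x) s 1 (fun j => (x - p) 0 j)).
      exact: smooth_C1 Co (wjs i) (ray_cube s1 xp).
    exact: (is_derive_rowP _ _ _ _).1.
  have := @is_deriveM R R id _ s 1 _ _ (is_derive_id _ _) d1'.
  by rewrite !scale_mul mulr1 addrC.
(* W 1 is the linearization error of T, W 0 is 0, and the derivative of W is
   small by strict differentiability of w along the ray. *)
pose W s := G x' s - G x s - h * (s * w (ray p s x) 0 i).
have : `|W 1 - W 0| <= c * `|h| * `|1 - 0|.
  apply: (@MVT_bound R W (fun s => rho x' s - rho x s - h * dpi s)) => s /andP[s0 s1].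
  rewrite subr0 mulr1 add0r.
  have sn : `|s| <= 1 by rewrite ger0_norm.
  split.
    apply: is_deriveB; first by apply: is_deriveB; [exact: (HG x' x'p).2|exact: (HG x xp).2].
    exact: (is_deriveZ h (dpiE s sn)).
  have [Ha Hb] := H x' x x'd1 xd1 s sn.
  set z := ray p s x in Ha Hb *; set y := ray p s x' in Ha Hb *.
  have yz : y - z = (s * h) *: e_ i.
    by rewrite -scalerA -x'x /y /z /ray; apply/rowP => j; rewrite !mxE; ring.
  have D j : dirD w z (y - z) 0 j = s * h * 'D_(e_ j) (fun y => w y 0 i) z.
    rewrite mxE (bigD1 i)//= big1 ?addr0.
      by rewrite yz !mxE !eqxx mulr1 wcl//; exact: ray_cube.
    by move=> k ki; rewrite yz !mxE eqxx/= (negbTE ki) mulr0 mul0r.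
  have -> : rho x' s - rho x s - h * dpi s =
    \sum_j (w y - w z - dirD w z (y - z)) 0 j * (x - p) 0 j +
    h * (w y - w z) 0 i.
    have E : rho x' s = \sum_j w y 0 j * (x - p) 0 j + h * w y 0 i.
      rewrite /rho -/y.
      have -> : h * w y 0 i = \sum_j w y 0 j * (h *: e_ i) 0 j.
        rewrite (bigD1 i)//= big1 ?addr0; first by rewrite !mxE !eqxx mulr1 mulrC.
        by move=> k ki; rewrite !mxE eqxx/= (negbTE ki) !mulr0.
      rewrite -big_split/=; apply: eq_bigr => j _.
      by rewrite -mulrDr -x'x !mxE; ring.
    have S : \sum_j (w y - w z - dirD w z (y - z)) 0 j * (x - p) 0 j =
      \sum_j w y 0 j * (x - p) 0 j - \sum_j w z 0 j * (x - p) 0 j -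
      h * (s * \sum_j (x - p) 0 j * 'D_(e_ j) (fun y => w y 0 i) z).
      rewrite !mulr_sumr -!sumrB; apply: eq_bigr => j _.
      have -> : (w y - w z - dirD w z (y - z)) 0 j =
        w y 0 j - w z 0 j - dirD w z (y - z) 0 j by rewrite !mxE.
      rewrite D; ring.
    rewrite E S /dpi -/z /rho -/z.
    have -> : (w y - w z) 0 i = w y 0 i - w z 0 i by rewrite !mxE.
    ring.
  apply: le_trans (ler_normD _ _) _.
  have -> : c * `|h| = c' * `|h| * (n%:R * `|x - p|) + `|h| * c'.
    by rewrite /c' /L; field; rewrite gt_eqF.
  have yzN : `|y - z| <= `|h|.
    rewrite yz normrZ normrM -mulrA; apply: (@le_trans _ _ (1 * (`|h| * 1))).
      by apply: ler_pM => //; rewrite ler_wpM2l.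
    by rewrite mul1r mulr1.
  apply: lerD; last first.
    rewrite normrM ler_wpM2l//; apply: le_trans Hb.
    exact: coord_le_norm.
  apply: le_trans (ler_norm_sum _ _ _) _.
  apply: (@le_trans _ _ (\sum_(j < n) c' * `|h| * `|x - p|)); last first.
    by rewrite sumr_const card_ord -[X in X <= _]mulr_natl mulrCA.
  apply: ler_sum => j _; rewrite normrM; apply: ler_pM => //; last exact: coord_le_norm.
  apply: le_trans (coord_le_norm _ _ _) _; apply: le_trans Ha _.
  by rewrite ler_wpM2l// ltW.
rewrite /W (HG x xp).1 (HG x' x'p).1 subrr mul0r mulr0 subrr subr0 subr0 normr1 mulr1 mul1r.
by rewrite /ray scale1r (addrC p) subrK.
Qed.

End Poincare.

(** * Simultaneous straightening of a vector field and a closed form *)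

Section Straightening.
Context {R : realType} {m : nat}.
Opaque smooth_on.
Local Notation n := m.+1.

Local Notation e_ i := (delta_mx (0 : 'I_1) i).

Lemma open_setI_preimage (S T : topologicalType) (A : set S) (B : set T)
    (f : S -> T) : open A -> open B ->
  (forall x, A x -> {for x, continuous f}) -> open [set x | A x /\ B (f x)].
Proof.
move=> Ao Bo fc; rewrite openE => x [Ax Bfx]; rewrite /interior.
apply: filterI; first exact: open_nbhs_nbhs.
by apply: (fc x Ax); exact: open_nbhs_nbhs.
Qed.

Lemma open_setI_norm k (A : set 'rV[R]_k) (f : 'rV[R]_k -> R) (c : R) : open A ->
  (forall x, A x -> {for x, continuous f}) -> open [set x | A x /\ `|f x| < c].
Proof.
move=> Ao fc; rewrite openE => x [Ax fx]; rewrite /interior.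
apply: filterI; first exact: open_nbhs_nbhs.
have Io : open [set y : R | `|y| < c].
  by apply: (@open_comp _ _ (fun y : R => `|y|) [set x | x < c]) => [y _|];
    [exact: norm_continuous|exact: open_lt].
exact: (fc x Ax [set y | `|y| < c] (open_nbhs_nbhs (conj Io fx))).
Qed.

(** The section of slice_coord in the hyperplane through p on which the k-th
    coordinate is constant. *)
Definition chart_slice (p : 'rV[R]_n) (k : 'I_n) (y : 'rV[R]_m) : 'rV[R]_n :=
  \row_i (p 0 i + if unlift k i is Some j then y 0 j else 0).

Definition slice_coord (p : 'rV[R]_n) (k : 'I_n) (x : 'rV[R]_n) : 'rV[R]_m :=
  \row_j (x - p) 0 (lift k j).

Lemma chart_sliceK p k y : slice_coord p k (chart_slice p k y) = y.
Proof. by apply/rowP => j; rewrite !mxE liftK addrC addKr. Qed.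

Lemma chart_slice_smooth (V : set 'rV[R]_m) p k : open V ->
  smooth_on V (chart_slice p k).
Proof.
move=> Vo; apply: (smooth_rowP _ Vo).2 => i.
have -> : (fun y => chart_slice p k y 0 i) =
  (fun y => p 0 i + if unlift k i is Some j then y 0 j else 0).
  by apply/funext => y; rewrite mxE.
apply: smooth_add; [exact: Vo|exact: smooth_cst|].
by case: (unlift k i) => [j|]; [exact: smooth_coordinate|exact: smooth_cst].
Qed.

Lemma slice_coord_smooth (V : set 'rV[R]_n) p k : open V ->
  smooth_on V (slice_coord p k).
Proof.
move=> Vo; apply: (smooth_rowP _ Vo).2 => j.
have -> : (fun x => slice_coord p k x 0 j) = (fun x => x 0 (lift k j) + - p 0 (lift k j)).
  by apply/funext => x; rewrite !mxE.
by apply: smooth_add; [exact: Vo|exact: smooth_coordinate|exact: smooth_cst].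
Qed.

Lemma slice_coord_inj p k x x' : slice_coord p k x = slice_coord p k x' ->
  x = x' + (x 0 k - x' 0 k) *: e_ k.
Proof.
move=> /rowP E; apply/rowP => i; rewrite !mxE eqxx/=.
case: (unliftP k i) => [j|] ->.
  have := E j; rewrite !mxE => /addIr ->.
  by rewrite eq_sym (negbTE (neq_lift _ _)) mulr0 addr0.
by rewrite eqxx mulr1 addrC subrK.
Qed.

(** T is strictly monotonic along the k-th direction, hence a point is
    determined by T and its other coordinates. This replaces the implicit
    function theorem for the level sets of T. *)
Lemma injective_along p r k (T : 'rV[R]_n -> R) (dT : 'rV[R]_n -> R) x x' :
  (forall y, cube p r y -> is_derive y (e_ k) T (dT y)) ->
  (forall y, cube p r y -> dT y != 0) ->
  cube p r x -> cube p r x' ->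
  slice_coord p k x = slice_coord p k x' -> T x = T x' -> x = x'.
Proof.
move=> Td dT0 xp x'p /slice_coord_inj E TE.
set a := x 0 k - x' 0 k in E.
have seg s : 0 <= s <= 1 -> cube p r (x' + (s * a) *: e_ k).
  move=> /andP[s0 s1].
  have -> : x' + (s * a) *: e_ k = s *: x + (1 - s) *: x'.
    by rewrite E; apply/rowP => i; rewrite !mxE; ring.
  rewrite /cube/=.
  have -> : s *: x + (1 - s) *: x' - p = s *: (x - p) + (1 - s) *: (x' - p).
    by apply/rowP => i; rewrite !mxE; ring.
  apply: le_lt_trans (ler_normD _ _) _.
  rewrite !normrZ ger0_norm// (@ger0_norm _ (1 - s)) ?subr_ge0//.
  have -> : r = s * r + (1 - s) * r by ring.
  have [s0'|s0'] := eqVneq s 0.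
    by rewrite s0' !mul0r !add0r subr0 !mul1r.
  by apply: ltr_leD; [rewrite ltr_pM2l// lt_neqAle eq_sym s0'|
     rewrite ler_wpM2l ?subr_ge0// ltW].
have [s s01|s s01] := @MVT_from R (fun s => T (x' + s *: e_ k))
   (fun s => dT (x' + s *: e_ k)) 0 a.
  rewrite subr0 add0r; apply: (is_derive_line _ _ _ _ _).1.
  by apply: Td; exact: seg.
rewrite subr0 add0r scale0r addr0 -E TE subrr => /esym/eqP.
rewrite mulf_eq0 (negbTE (dT0 _ (seg _ s01))) orbF => /eqP a0.
by rewrite E a0 scale0r addr0.
Qed.

Lemma derivative_along_flow p r (T : 'rV[R]_n -> R) (w F : 'rV[R]_n -> 'rV[R]_n)
    (e c : R) (y : R -> 'rV[R]_n) :
  smooth_on (cube p r) T ->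
  (forall x i, cube p r x -> is_derive x (e_ i) T (w x 0 i)) ->
  (forall x, cube p r x -> \sum_i F x 0 i * w x 0 i = c) ->
  (forall t : R, `|t| < e -> cube p r (y t) /\ is_derive t 1 y (F (y t))) ->
  forall t : R, `|t| < e -> T (y t) = T (y 0) + c * t.
Proof.
move=> Ts Td Fw yd t te; have Co := @cube_open R n p r.
apply: (@eq_is_derive R (fun s => T (y s)) (fun s => T (y 0) + c * s) (fun=> c) 0 t);
  last by rewrite mulr0 addr0.
move=> s /andP[s0 s1].
have se : `|0 + s * (t - 0)| < e.
  rewrite add0r subr0 normrM ger0_norm//; apply: le_lt_trans te.
  by rewrite ler_piMl.
have [yp dy] := yd _ se; split.
  rewrite -(Fw _ yp).
  apply: is_derive_eq.
    apply: (@is_derive_chain R n R T y _ 1 (fun i => F (y (0 + s * (t - 0))) 0 i)).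
      exact: smooth_C1 Co Ts yp.
    exact: (is_derive_rowP _ _ _ _).1.
  apply: eq_bigr => i _; congr (_ * _).
  by have [] := Td _ i yp.
set u := 0 + _.
have D1 := @is_deriveM R R (fun=> c) id u 1 _ _ (is_derive_cst _ _ _) (is_derive_id _ _).
have := @is_deriveD R R R (fun=> T (y 0)) _ u 1 _ _ (is_derive_cst _ _ _) D1.
by rewrite scaler0 addr0 add0r scale_mul mulr1.
Qed.

(** Let w = dT near p. Since w(P) = 1, the flow of P increases T at unit
    speed and transports the level set T = 0 to the other ones. Some
    component w_k does not vanish at p, and the field E = e_k / w_k also
    increases T at unit speed while it fixes all coordinates but the k-th;
    sliding the hyperplane through p along E for the time - T thus
    parametrizes the level set T = 0 by m coordinates. Phi (t, y) is the
    point reached at time t along P from the point of the level set with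
    coordinates y. Its inverse Psi is explicit: t is the value of T, and y
    is read off after flowing back by that time. Both maps are smooth, being
    composed of smooth flows. *)
Lemma straightening (O : set 'rV[R]_n) (p : 'rV[R]_n) (P w : 'rV[R]_n -> 'rV[R]_n) :
  open O -> O p -> smooth_on O P -> smooth_on O w ->
  (forall x, O x -> forall i j, 'D_(e_ i) (fun y => w y 0 j) x =
     'D_(e_ j) (fun y => w y 0 i) x) ->
  (forall x, O x -> \sum_i P x 0 i * w x 0 i = 1) ->
  exists2 a : R, 0 < a & exists (Q : set 'rV[R]_n)
    (Psi : 'rV[R]_n -> 'rV[R]_(1 + m)) (Phi : 'rV[R]_(1 + m) -> 'rV[R]_n),
  let B := cylinder a (cube (0 : 'rV[R]_m) a) in
  [/\ [/\ open Q, Q `<=` O & Q p],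
      smooth_on Q Psi /\ smooth_on B Phi,
      forall q, Q q -> B (Psi q) /\ Phi (Psi q) = q,
      forall z, B z -> Q (Phi z) /\ Psi (Phi z) = z &
      (forall z, B z -> is_derive z (e_ (lshift m 0)) Phi (P (Phi z))) /\
      (forall q i, Q q -> is_derive q (e_ i) (fun q => lsubmx (Psi q) 0 0) (w q 0 i))].
Proof.
move=> Oo Op Ps ws wcl Pw.
have [k wk0] : exists k, w p 0 k != 0.
  apply/not_existsP => h; have := Pw p Op; rewrite big1; last first.
    move=> i _; have := h i; case: eqVneq => [->|]; first by rewrite mulr0.
    by move=> _ /(_ isT).
  by move/eqP; rewrite eq_sym oner_eq0.
have wkC : {for p, continuous (fun y => w y 0 k)}.
  exact: smooth_continuous ((smooth_rowP w Oo).1 ws k) Op.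
have [r0 r00 [rO rk]] : exists2 r0 : R, 0 < r0 &
    (cube p r0 `<=` O) /\ forall x, cube p r0 x -> w x 0 k != 0.
  have A0 : 0 < `|w p 0 k| by rewrite normr_gt0.
  have /nbhs_normP[r1 /= r10 h1] := open_nbhs_nbhs (conj Oo Op).
  move/cvgrPdist_lt: wkC => /(_ _ A0) /nbhs_normP[r2 /= r20 h2].
  exists (Num.min r1 r2); first by rewrite lt_min r10.
  split=> x; rewrite /cube/= lt_min => /andP[x1 x2].
    by apply: h1; rewrite /ball_/= distrC.
  apply/negP => /eqP E; have := h2 x; rewrite /ball_/= distrC => /(_ x2).
  by rewrite E subr0 ltxx.
pose C := cube p r0; have Co : open C := @cube_open R n p r0.
have wC := smooth_on_sub rO ws; have PC := smooth_on_sub rO Ps.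
have Cp : C p by rewrite /C /cube/= subrr normr0.
have [T T0 Td] := poincare r00 wC (fun x Cx => wcl x (rO x Cx)).
have wjC j : smooth_on C (fun x => w x 0 j) := (smooth_rowP w Co).1 wC j.
have Ts : smooth_on C T by apply: (smooth_of_partials Co Td); exact: wjC.
have Tinj x x' : C x -> C x' -> slice_coord p k x = slice_coord p k x' ->
    T x = T x' -> x = x'.
  apply: (@injective_along p r0 k T (fun x => w x 0 k)); exact: rk.
pose E x : 'rV[R]_n := (w x 0 k)^-1 *: e_ k.
have Es : smooth_on C E.
  apply: (smooth_rowP _ Co).2 => j.
  have -> : (fun x => E x 0 j) = (fun x => (w x 0 k)^-1 * e_ k 0 j).
    by apply/funext => x; rewrite mxE.
  apply: smooth_mul; [exact: Co| |exact: smooth_cst].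
  apply: smooth_inv; [exact: Co|exact: rk|exact: wjC].
have Ew x : C x -> \sum_i E x 0 i * w x 0 i = 1.
  move=> Cx; rewrite (bigD1 k)//= big1 ?addr0.
    by rewrite !mxE !eqxx mulr1 mulVf// rk.
  by move=> i ik; rewrite !mxE eqxx/= (negbTE ik) mulr0 mul0r.
have [r1 r10 [e1 e10 [th [thd th0 thV ths]]]] := local_flow Co PC Cp.
have [r2 r20 [e2 e20 [vt [vtd vt0 vtV vts]]]] := local_flow Co Es Cp.
have C1 x : cube p r1 x -> C x.
  move=> xp; have := (thd 0 x _ xp).1; rewrite th0//; apply.
  by rewrite normr0.
have C2 x : cube p r2 x -> C x.
  move=> xp; have := (vtd 0 x _ xp).1; rewrite vt0//; apply.
  by rewrite normr0.
have Tth t x : `|t| < e1 -> cube p r1 x -> T (th t x) = T x + t.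
  move=> te xp; rewrite -{2}(th0 x xp) -[t in RHS]mul1r.
  apply: (@derivative_along_flow p r0 T w P e1 1 (th^~ x)) => //.
    by move=> y Cy; apply: Pw; exact: rO.
  by move=> s se; exact: thd.
have Tvt t x : `|t| < e2 -> cube p r2 x -> T (vt t x) = T x + t.
  move=> te xp; rewrite -{2}(vt0 x xp) -[t in RHS]mul1r.
  apply: (@derivative_along_flow p r0 T w E e2 1 (vt^~ x)) => //.
  by move=> s se; exact: vtd.
have Svt t x : `|t| < e2 -> cube p r2 x ->
    slice_coord p k (vt t x) = slice_coord p k x.
  move=> te xp; apply/rowP => j; rewrite mxE [RHS]mxE mxE [RHS]mxE.
  congr (_ + _); rewrite -[in RHS](vt0 x xp).
  apply: (@eq_is_derive R (fun s => vt s x 0 (lift k j)) (fun=> vt 0 x 0 (lift k j))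
    (fun=> 0) 0 t) => // s /andP[s0 s1].
  have se : `|0 + s * (t - 0)| < e2.
    rewrite add0r subr0 normrM ger0_norm//; apply: le_lt_trans te.
    by rewrite ler_piMl.
  split; last exact: is_derive_cst.
  have [_ /is_derive_rowP/(_ (lift k j))] := vtd _ x se xp.
  by rewrite !mxE eqxx/= eq_sym (negbTE (neq_lift _ _)) mulr0.
(* io parametrizes the hyperplane, and si the level set T = 0. *)
pose io := chart_slice p k.
have io0 : io 0 = p.
  apply/rowP => i; rewrite mxE; case: (unlift k i) => [j|]; last by rewrite addr0.
  by rewrite mxE addr0.
have ios (V : set 'rV[R]_m) : open V -> smooth_on V io by exact: chart_slice_smooth.
pose A0 := [set y : 'rV[R]_m | setT y /\ cube p r2 (io y)].
have A0o : open A0.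
  apply: open_setI_preimage; [exact: openT|exact: cube_open|].
  by move=> y _; exact: smooth_continuous (ios setT openT) I.
have TioS : smooth_on A0 (fun y => - T (io y)).
  apply: smooth_opp; first exact: A0o.
  exact: (smooth_comp A0o Co (fun y A => C2 _ A.2) Ts (ios A0 A0o)).
pose V0 := [set y | A0 y /\ `|- T (io y)| < e2].
have V0o : open V0.
  by apply: open_setI_norm A0o _ => y A0y; exact: smooth_continuous TioS A0y.
pose si y := vt (- T (io y)) (io y).
have siC y : V0 y -> C (si y).
  by move=> [[_ y1] y2]; exact: (vtd _ _ y2 y1).1.
have siT y : V0 y -> T (si y) = 0.
  by move=> [[_ y1] y2]; rewrite /si Tvt// addrC addNr.
have siP y : V0 y -> slice_coord p k (si y) = y.
  by move=> [[_ y1] y2]; rewrite /si Svt// chart_sliceK.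
have sis : smooth_on V0 si.
  have V0A : V0 `<=` A0 by move=> y [].
  have gs : smooth_on V0 (fun y => row_mx (\row_(_ < 1) (- T (io y))) (io y)).
    apply: smooth_row_mx; [exact: V0o| |exact: ios].
    apply: (smooth_rowP _ V0o).2 => j.
    have -> : (fun y => (\row__ - T (io y) : 'rV[R]_1) 0 j) = (fun y => - T (io y)).
      by apply/funext => y; rewrite mxE.
    exact: smooth_on_sub TioS.
  have cyl y : V0 y -> cylinder e2 (cube p r2) (row_mx (\row_(_ < 1) (- T (io y))) (io y)).
    by move=> [[_ y1] y2]; split; rewrite /= ?row_mxKr// row_mxKl mxE.
  have Ko := @cylinder_open R n e2 _ (@cube_open R n p r2).
  have := smooth_comp_mx V0o Ko cyl vts gs.
  apply: smooth_on_ext; first exact: V0o.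
  by move=> y _; rewrite /= /on_cylinder row_mxKl row_mxKr mxE.
pose V1 := [set y | V0 y /\ cube p r1 (si y)].
have V1o : open V1.
  apply: open_setI_preimage; [exact: V0o|exact: cube_open|].
  by move=> y V0y; exact: smooth_continuous sis V0y.
have cubeP r : 0 < r -> cube p r p by move=> rr; rewrite /cube/= subrr normr0.
have V0_0 : V0 0.
  split; first by split=> //; rewrite io0; exact: cubeP.
  by rewrite io0 T0 oppr0 normr0.
have si0 : si 0 = p by rewrite /si io0 T0 oppr0 vt0//; exact: cubeP.
have V1_0 : V1 0 by split=> //; rewrite si0; exact: cubeP.
pose Phi (z : 'rV[R]_(1 + m)) := th (lsubmx z 0 0) (si (rsubmx z)).
pose K1 := cylinder e1 V1; have K1o : open K1 := @cylinder_open R m e1 _ V1o.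
have PhiS : smooth_on K1 Phi.
  have Ko := @cylinder_open R n e1 _ (@cube_open R n p r1).
  have K1V0 z : K1 z -> V0 (rsubmx z) by move=> [_ []].
  have gs : smooth_on K1 (fun z => row_mx (lsubmx z) (si (rsubmx z)) : 'rV[R]_(1 + n)).
    apply: smooth_row_mx; [exact: K1o|exact: smooth_lsubmx|].
    exact: (smooth_comp_mx K1o V0o K1V0 sis (smooth_rsubmx K1o)).
  have cyl z : K1 z -> cylinder e1 (cube p r1) (row_mx (lsubmx z) (si (rsubmx z))).
    by move=> [z1 [_ z2]]; split; rewrite /= ?row_mxKr ?row_mxKl.
  have := smooth_comp_mx K1o Ko cyl ths gs.
  apply: smooth_on_ext; first exact: K1o.
  by move=> y _; rewrite /= /on_cylinder row_mxKl row_mxKr.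
pose K2 := [set z | K1 z /\ cube p r1 (Phi z)].
have K2o : open K2.
  apply: open_setI_preimage; [exact: K1o|exact: cube_open|].
  by move=> z K1z; exact: smooth_continuous PhiS K1z.
have l0 : lsubmx (0 : 'rV[R]_(1 + m)) 0 0 = 0 by rewrite !mxE.
have rs0 : rsubmx (0 : 'rV[R]_(1 + m)) = 0 by apply/rowP => j; rewrite !mxE.
have K2_0 : K2 0.
  split; first by split; rewrite ?l0 ?rs0// normr0.
  by rewrite /Phi l0 rs0 si0 th0; exact: cubeP.
have /nbhs_normP[a /= a0 aK2] := open_nbhs_nbhs (conj K2o K2_0).
pose B : set 'rV[R]_(1 + m) := cylinder a (cube (0 : 'rV[R]_m) a).
have BK2 : B `<=` K2.
  move=> z [z1 z2]; apply: aK2; rewrite /ball_/= sub0r normrN.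
  rewrite -[z]hsubmxK; apply: norm_row_mx_lt.
    by apply: norm_lt_coord => // i j; rewrite (ord1 i) (ord1 j).
  by move: z2; rewrite /cube/= subr0.
have Bo : open B := @cylinder_open R m a _ (@cube_open R m 0 a).
pose Psi (q : 'rV[R]_n) : 'rV[R]_(1 + m) :=
  row_mx (\row_(_ < 1) T q) (slice_coord p k (th (- T q) q)).
pose D0 := [set q | cube p r1 q /\ `|- T q| < e1].
have NT : smooth_on (cube p r1) (fun q => - T q).
  apply: smooth_opp; first exact: cube_open.
  exact: smooth_on_sub C1 Ts.
have D0o : open D0.
  apply: open_setI_norm; first exact: cube_open.
  by move=> q qp; exact: smooth_continuous NT qp.
have D0C : D0 `<=` C by move=> q [/C1].
have PsiS : smooth_on D0 Psi.
  have Ko := @cylinder_open R n e1 _ (@cube_open R n p r1).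
  have gs : smooth_on D0 (fun q => row_mx (\row_(_ < 1) (- T q)) q).
    apply: smooth_row_mx; [exact: D0o| |].
      apply: (smooth_rowP _ D0o).2 => j.
      have -> : (fun y => (\row__ - T y : 'rV[R]_1) 0 j) = (fun y => - T y).
        by apply/funext => y; rewrite mxE.
      apply: smooth_on_sub NT; by move=> q [].
    by apply: (smooth_rowP _ D0o).2 => j; exact: smooth_coordinate.
  have cyl q : D0 q -> cylinder e1 (cube p r1) (row_mx (\row_(_ < 1) (- T q)) q).
    by move=> [q1 q2]; split; rewrite /= ?row_mxKr// row_mxKl mxE.
  have s1 := smooth_comp_mx D0o Ko cyl ths gs.
  apply: smooth_row_mx; [exact: D0o| |].
    apply: (smooth_rowP _ D0o).2 => j.
    have -> : (fun y => (\row__ T y : 'rV[R]_1) 0 j) = T.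
      by apply/funext => y; rewrite mxE.
    exact: smooth_on_sub D0C Ts.
  have := smooth_comp_mx D0o openT (fun q _ => I) (slice_coord_smooth p k openT) s1.
  apply: smooth_on_ext; first exact: D0o.
  by move=> y _; rewrite /= /on_cylinder row_mxKl row_mxKr mxE.
(* Shrinking to the preimage of the cylinder B makes Phi and Psi inverse to
   each other between exactly these sets. *)
pose Q := [set q | D0 q /\ B (Psi q)].
have Qo : open Q.
  apply: open_setI_preimage; [exact: D0o|exact: Bo|].
  by move=> q D0q; exact: smooth_continuous PsiS D0q.
have BPhi z : B z -> Psi (Phi z) = z /\ D0 (Phi z).
  move=> Bz; have [[z1 [z2 z3]] z4] := BK2 _ Bz.
  have TP : T (Phi z) = lsubmx z 0 0 by rewrite /Phi Tth// siT// add0r.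
  split; last by split=> //; rewrite TP normrN.
  rewrite /Psi TP thV// siP// -[RHS]hsubmxK; congr row_mx.
  by apply/rowP => j; rewrite mxE (ord1 j).
exists a => //; exists Q, Psi, Phi; rewrite /=; split.
- split; [exact: Qo|by move=> q [/D0C/rO]|].
  have D0p : D0 p by split; [exact: cubeP|rewrite T0 oppr0 normr0].
  split=> //; have -> : Psi p = 0.
    rewrite /Psi T0 oppr0 th0; last exact: cubeP.
    have -> : slice_coord p k p = 0 by apply/rowP => j; rewrite !mxE subrr.
    by rewrite -[RHS]hsubmxK; congr row_mx; apply/rowP => j; rewrite !mxE.
  by split; rewrite /= ?l0 ?rs0 ?normr0// /cube/= subrr normr0.
- split; first by apply: smooth_on_sub PsiS => q [].
  by apply: smooth_on_sub PhiS => z /BK2[].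
- move=> q [[q1 q2] BP]; split=> //.
  have [[z1 [z2 z3]] z4] := BK2 _ BP.
  have q3 : `|T q| < e1 by rewrite -normrN.
  pose rr := th (- T q) q.
  have Crr : C rr := (thd _ _ q2 q1).1.
  have Er : rr = si (slice_coord p k rr).
    move: z2; rewrite /Psi row_mxKr -/rr => z2.
    by apply: Tinj => //; [exact: siC|rewrite siP|rewrite siT// /rr Tth// subrr].
  have rr1 : cube p r1 rr by move: z3; rewrite /Psi row_mxKr -/rr -Er.
  rewrite /Phi /Psi row_mxKl row_mxKr -/rr -Er mxE.
  by rewrite -[T q]opprK thV.
- move=> z Bz; have [E1 D0z] := BPhi z Bz; split=> //.
  by split=> //; rewrite E1.
- split.
    move=> z Bz; have [[z1 [z2 z3]] _] := BK2 _ Bz.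
    apply/is_derive_rowP => i.
    apply: (@is_derive_time R m (fun t y => th t (si y) 0 i)).
    have [_ /is_derive_rowP D] := thd _ _ z1 z3.
    exact: D.
  move=> q i [/D0C Cq _].
  have -> : (fun q => lsubmx (Psi q) 0 0) = T.
    by apply/funext => y; rewrite /Psi row_mxKl mxE.
  exact: Td.
Qed.

End Straightening.

(** * Changes of charts *)

(** Connects the estimates above to the total derivative, in terms of which
    jacobian matrices are defined. *)
Lemma differentiable_estimate (R : realType) (V W : normedModType R) (f : V -> W)
    (df : {linear V -> W}) x : continuous df ->
  (forall c : R, 0 < c -> exists2 r : R, 0 < r & forall v, `|v| < r ->
     `|f (v + x) - f x - df v| <= c * `|v|) ->
  differentiable f x.
Proof.
move=> dfc h.
have dfo : f \o shift x = cst (f x) + df +o_ 0 id.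
  apply/eqaddoP => c c0; have [r r0 hr] := h c c0.
  near=> v.
  have vr : `|v| < r.
    near: v; have := near_norm_lt (0 : V) r0.
    by apply: filterS => v; rewrite sub0r normrN.
  have := hr v vr; congr (`|_| <= _).
  by rewrite -addrA -opprD.
by apply/diff_locallyP; rewrite (diff_unique dfc dfo).
Unshelve. all: by end_near. Qed.

Section Differentiable.
Context {R : realType} {n k : nat}.
Opaque smooth_on.
Local Notation e_ i := (delta_mx (0 : 'I_1) i).

Lemma smooth_differentiable (W : set 'rV[R]_n) (F : 'rV[R]_n -> 'rV[R]_k) q :
  open W -> smooth_on W F -> W q -> differentiable F q.
Proof.
move=> Wo Fs Wq.
pose J : 'M[R]_(n, k) := \matrix_(j, i) 'D_(e_ j) (fun y => F y 0 i) q.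
have JE v : mulmxr J v = dirD F q v.
  by apply/rowP => i; rewrite !mxE; apply: eq_bigr => j _; rewrite !mxE.
have Jc : continuous (mulmxr J : 'rV[R]_n -> 'rV[R]_k).
  have [r r0 [M M0 hM]] := dirD_bound Wo Fs Wq.
  apply: (@lipschitz_continuous_rV R n k _ M) => y z.
  by rewrite !JE -dirDB; apply: hM; rewrite subrr normr0.
apply: (@differentiable_estimate R _ _ F (mulmxr J) q Jc) => c c0.
have [r r0 hr] := strict_diff_row Wo Fs Wq c0; exists r => // v vr.
have := hr (v + q) q; rewrite addrK subrr normr0 => /(_ vr r0).
by rewrite -JE.
Qed.

End Differentiable.

Section Charts.
Context {R : realType} {n : nat}.
Opaque smooth_on.

Lemma cmap_cont (T : topologicalType) (c : chart R n T) p :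
  cdom c p -> {for p, continuous (cmap c)}.
Proof.
move=> cp; have := @cmap_continuous _ _ _ c.
rewrite continuous_open_subspace; last exact: cdom_open.
by apply; rewrite inE.
Qed.

Lemma cinv_cont (T : topologicalType) (c : chart R n T) x :
  cimg c x -> {for x, continuous (cinv c)}.
Proof.
move=> cx; have := @cinv_continuous _ _ _ c.
rewrite continuous_open_subspace; last exact: cimg_open.
by apply; rewrite inE.
Qed.

Lemma cinvK (T : topologicalType) (c : chart R n T) x : cimg c x ->
  cdom c (cinv c x) /\ cmap c (cinv c x) = x.
Proof. by move=> [p cp <-]; rewrite cmapK. Qed.

Lemma overlapE (T : topologicalType) (c c' : chart R n T) :
  overlap c c' = [set x | cimg c x /\ cdom c' (cinv c x)].
Proof.
apply/seteqP; split=> x.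
  by move=> [p [cp c'p] <-]; rewrite /= cmapK//; split=> //; exists p.
move=> [cx c'x]; have [h1 h2] := cinvK cx.
by exists (cinv c x).
Qed.

Lemma overlap_open (T : topologicalType) (c c' : chart R n T) :
  open (overlap c c').
Proof.
rewrite overlapE; apply: open_setI_preimage; [exact: cimg_open|exact: cdom_open|].
by move=> x; exact: cinv_cont.
Qed.

Lemma overlap_refine (T : topologicalType) (c c' : chart R n T) x :
  cdom c' `<=` cdom c -> cimg c' x -> overlap c' c x.
Proof.
by move=> sub c'x; rewrite overlapE; split=> //; apply: sub; exact: (cinvK c'x).1.
Qed.

(** By maximality of the atlas, a chart may be composed with a smooth
    diffeomorphism between open sets. *)
Lemma refined_chart (M : manifold R n) (c : chart R n M) (Q B : set 'rV[R]_n)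
    (Psi Phi : 'rV[R]_n -> 'rV[R]_n) : atlas c -> open Q -> open B ->
  Q `<=` cimg c -> smooth_on Q Psi -> smooth_on B Phi ->
  (forall q, Q q -> B (Psi q) /\ Phi (Psi q) = q) ->
  (forall z, B z -> Q (Phi z) /\ Psi (Phi z) = z) ->
  exists c' : chart R n M, [/\ atlas c',
    cdom c' = [set p | cdom c p /\ Q (cmap c p)],
    cmap c' = Psi \o cmap c, cinv c' = cinv c \o Phi & cimg c' = B].
Proof.
move=> ac Qo Bo Qc PsiS PhiS PsiK PhiK.
pose D := [set p : M | cdom c p /\ Q (cmap c p)].
have Do : open D.
  by apply: open_setI_preimage; [exact: cdom_open|exact: Qo|exact: cmap_cont].
have img : (Psi \o cmap c) @` D = B.
  apply/seteqP; split=> z; first by move=> [p [cp Qp] <-]; exact: (PsiK _ Qp).1.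
  move=> Bz; have [Qz zE] := PhiK z Bz; have [h1 h2] := cinvK (Qc _ Qz).
  by exists (cinv c (Phi z)); [split=> //; rewrite h2|rewrite /= h2].
have imgo : open ((Psi \o cmap c) @` D) by rewrite img.
have K p : D p -> (cinv c \o Phi) ((Psi \o cmap c) p) = p.
  by move=> [cp Qp]; rewrite /= (PsiK _ Qp).2 cmapK.
have C1 : {within D, continuous (Psi \o cmap c)}.
  rewrite continuous_open_subspace//= => p; rewrite inE => -[cp Qp].
  apply: continuous_comp; first exact: cmap_cont.
  exact: smooth_continuous PsiS Qp.
have C2 : {within (Psi \o cmap c) @` D, continuous (cinv c \o Phi)}.
  rewrite continuous_open_subspace//= img => z; rewrite inE => Bz.
  apply: continuous_comp; first exact: smooth_continuous PhiS Bz.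
  by apply: cinv_cont; apply: Qc; exact: (PhiK z Bz).1.
pose c' := Chart Do imgo K C1 C2.
have c'E : cimg c' = B by exact: img.
exists c'; split=> //.
apply: atlas_maximal => c'' ac''.
have [S1 S2] := atlas_compatible ac ac''.
have ovE x : overlap c' c'' x -> B x /\ overlap c c'' (Phi x).
  rewrite overlapE => -[c'x h]; have Bx : B x by rewrite -c'E.
  split=> //; rewrite overlapE; split=> //; apply: Qc; exact: (PhiK _ Bx).1.
have ovE' x : overlap c'' c' x -> overlap c'' c x /\ Q (transition c'' c x).
  by rewrite overlapE => -[c''x [h1 h2]]; split=> //; rewrite overlapE; split.
split.
- apply: (@smooth_comp_mx _ _ _ (overlap c' c'') (overlap c c'') _ _
    (transition c c'') Phi) => //.
  + exact: overlap_open.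
  + exact: overlap_open.
  + by move=> x /ovE[].
  + by apply: smooth_on_sub PhiS => x /ovE[].
- apply: (@smooth_comp_mx _ _ _ (overlap c'' c') Q _ _ Psi (transition c'' c)) => //.
  + exact: overlap_open.
  + by move=> x /ovE'[].
  + by apply: smooth_on_sub S2 => x /ovE'[].
Qed.

(** The transformation laws involve the jacobian matrix of a transition map,
    while smoothness provides directional derivatives. *)
Lemma transition_jacobian (M : manifold R n) (c c' : chart R n M) x v :
  atlas c -> atlas c' -> overlap c c' x ->
  'D_v (transition c c') x = v *m jacobian (transition c c') x.
Proof.
move=> ac ac' ox; apply: deriveEjacobian.
have [S _] := atlas_compatible ac ac'.
by apply: smooth_differentiable S ox; exact: overlap_open.
Qed.

End Charts.

(** * Lorentzian forms *)

Section Lorentzian.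
Context {R : realType}.

Lemma eta_unit n : @eta_mx R n \in unitmx.
Proof.
have : @eta_mx R n *m @eta_mx R n = 1%:M.
  rewrite /eta_mx mulmx_diag -[RHS]diag_const_mx; congr diag_mx.
  by apply/rowP => i; rewrite !mxE; case: ifP; rewrite ?mulrNN mulr1.
by case/mulmx1_unit.
Qed.

Lemma lorentzian_unit n (A : 'M[R]_n) : lorentzian A -> A \in unitmx.
Proof.
move=> [S Su E]; have := eta_unit n; rewrite -E !unitmx_mul.
by case/andP => /andP[].
Qed.

(** N passes to the coordinates in which the form is diagonal, where its
    signature can be read off. *)
Lemma lorentzian_form n (A : 'M[R]_n.+1) : lorentzian A ->
  exists2 N : 'M[R]_n.+1, N \in unitmx & forall u : 'rV[R]_n.+1,
    (u *m A *m u^T) 0 0 = - (u *m N) 0 0 ^+ 2 + \sum_(i < n) (u *m N) 0 (lift 0 i) ^+ 2.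
Proof.
move=> [S Su E]; exists (invmx S); first by rewrite unitmx_inv.
move=> u.
have [w <- uE] : exists2 w, w = u *m invmx S & u = w *m S.
  by exists (u *m invmx S); rewrite ?mulmxKV.
rewrite uE trmx_mul -!mulmxA (mulmxA A) (mulmxA S) (mulmxA S) E.
rewrite mulmxA /eta_mx mul_mx_diag mxE big_ord_recl; congr (_ + _).
  by rewrite !mxE /= mulrN1 mulNr expr2.
by apply: eq_bigr => i _; rewrite !mxE /= mulr1 expr2.
Qed.

(** If G were not positive at v, the Lorentzian form would be nonpositive on
    the plane spanned by v and the first basis vector. That plane contains a
    nonzero u at which the negative square of a diagonalization vanishes;
    then all positive squares vanish as well, and u = 0. *)
Lemma spacelike_complement m (G : 'M[R]_m) :
  lorentzian (block_mx (- 1%:M) 0 0 G : 'M[R]_(1 + m)) ->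
  forall v : 'rV[R]_m, v != 0 -> 0 < (v *m G *m v^T) 0 0.
Proof.
move=> L v v0; rewrite ltNge; apply/negP => vG.
set A := block_mx _ _ _ _ in L.
have [N Nu NE] : exists2 N : 'M[R]_(1 + m), N \in unitmx & forall u : 'rV[R]_(1 + m),
    (u *m A *m u^T) 0 0 = - (u *m N) 0 0 ^+ 2 + \sum_(i < m) (u *m N) 0 (lift 0 i) ^+ 2.
  exact: lorentzian_form L.
have form (t : R) (y : 'rV[R]_m) : let u : 'rV[R]_(1 + m) := row_mx t%:M y in
    (u *m A *m u^T) 0 0 = - t ^+ 2 + (y *m G *m y^T) 0 0.
  rewrite /= mul_row_block !mulmx0 addr0 add0r tr_row_mx mul_row_col mxE.
  congr (_ + _); rewrite mulmxN mulmx1 tr_scalar_mx mulNmx mxE -scalar_mxM mxE.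
  by rewrite eqxx mulr1n expr2.
pose a : 'rV[R]_(1 + m) := row_mx 1%:M 0 *m N.
pose b : 'rV[R]_(1 + m) := row_mx (0%:M : 'M[R]_1) v *m N.
have a0 : a 0 0 != 0.
  apply/eqP => a0; have := NE (row_mx 1%:M 0).
  rewrite (form 1 0) -/a a0 mul0mx mul0mx mxE addr0 expr1n expr0n/= oppr0 add0r => H.
  have : 0 <= -1 :> R by rewrite H sumr_ge0// => i _; exact: sqr_ge0.
  by rewrite oppr_ge0 ler10.
have comb (s t : R) : row_mx s%:M (- t *: v) =
    s *: row_mx 1%:M 0 - t *: row_mx 0%:M v :> 'rV[R]_(1 + m).
  rewrite !scale_row_mx opp_row_mx add_row_mx scaler0 add0r scaleNr; congr row_mx.
  apply/matrixP => i j; rewrite (ord1 i) (ord1 j) !mxE eqxx !mulr1n; ring.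
have quad (t : R) (y : 'rV[R]_m) :
    ((t *: y) *m G *m (t *: y)^T) 0 0 = t ^+ 2 * (y *m G *m y^T) 0 0.
  have -> : (t *: y)^T = t *: y^T by apply/matrixP => i j; rewrite !mxE.
  by rewrite -!scalemxAl -scalemxAr scalerA mxE expr2.
pose u : 'rV[R]_(1 + m) := row_mx (b 0 0)%:M (- a 0 0 *: v).
have uN : u *m N = b 0 0 *: a - a 0 0 *: b.
  by rewrite /u comb mulmxBl -!scalemxAl.
have u0 : (u *m N) 0 0 = 0 by rewrite uN !mxE mulrC subrr.
have := NE u; rewrite u0 expr0n/= oppr0 add0r (form (b 0 0) _).
rewrite quad => H.
have S0 : \sum_(i < m) (u *m N) 0 (lift 0 i) ^+ 2 <= 0.
  rewrite -H -oppr_ge0 opprD opprK addr_ge0 ?sqr_ge0// oppr_ge0.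
  by rewrite mulr_ge0_le0// sqr_ge0.
have Z i : (u *m N) 0 i = 0.
  case: (unliftP 0 i) => [j|] -> //.
  apply/eqP; rewrite -sqrf_eq0 eq_le sqr_ge0 andbT.
  apply: le_trans S0; rewrite (bigD1 j)//= lerDl sumr_ge0// => k _.
  exact: sqr_ge0.
have : u = 0.
  rewrite -[u](mulmxK Nu).
  have -> : u *m N = 0 by apply/rowP => i; rewrite Z mxE.
  by rewrite mul0mx.
move=> /(congr1 rsubmx); rewrite /u row_mxKr linear0 => /eqP.
by rewrite scaler_eq0 oppr_eq0 (negbTE a0) (negbTE v0).
Qed.

End Lorentzian.

(** * Concircular geometry in a chart *)

Section Geometry.
Context {R : realType}.
Opaque smooth_on.
Local Notation e_ i := (delta_mx (0 : 'I_1) i).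

Lemma constant_field n (M : manifold R n) (c : chart R n M) (v : 'rV[R]_n) :
  local_field c (fun=> v).
Proof.
have Co := @cimg_open _ _ _ c.
by apply: (smooth_rowP _ Co).2 => j; exact: smooth_cst.
Qed.
Arguments constant_field {n M} c v.

Lemma nabla_coordinate n (M : manifold R n) (D : connection M) c i j x :
  nabla D c (fun=> e_ i) (fun=> e_ j) x = D c x i j.
Proof.
rewrite /nabla derive_cst add0r (bigD1 i)//= (bigD1 j)//= !mxE !eqxx mul1r scale1r.
rewrite !big1 ?addr0// => k ki.
  by rewrite big1// => l _; rewrite !mxE eqxx/= (negbTE ki) mul0r scale0r.
by rewrite !mxE eqxx/= (negbTE ki) mulr0 scale0r.
Qed.

Lemma pairing_coordinate n (M : manifold R n) (pi : covector_field M) c j x :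
  pairing pi c (fun=> e_ j) x = pi c x 0 j.
Proof.
rewrite /pairing mxE (bigD1 j)//= big1 ?addr0; first by rewrite !mxE !eqxx mulr1.
by move=> k kj; rewrite !mxE eqxx/= (negbTE kj) mulr0.
Qed.

Lemma inner_coordinate n (M : manifold R n) (g : lorentz_metric M) c i j x :
  inner g c (fun=> e_ i) (fun=> e_ j) x = g c x i j.
Proof.
rewrite /inner -rowE mxE (bigD1 j)//= big1 ?addr0; first by rewrite !mxE !eqxx mulr1.
by move=> k kj; rewrite !mxE eqxx/= (negbTE kj) mulr0.
Qed.

Lemma form_sym n (G : 'M[R]_n) (u v : 'rV[R]_n) : G^T = G ->
  (u *m G *m v^T) 0 0 = (v *m G *m u^T) 0 0.
Proof.
move=> GT; transitivity ((u *m G *m v^T)^T 0 0); first by rewrite [RHS]mxE.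
by rewrite !trmx_mul trmxK GT mulmxA.
Qed.

Lemma derive_locally_constant n (U : set 'rV[R]_n) (f : 'rV[R]_n -> R) (k : R) x v :
  open U -> (forall y, U y -> f y = k) -> U x -> 'D_v f x = 0.
Proof.
move=> Uo fk Ux; rewrite -[RHS](@derive_cst R 'rV[R]_n R k x v).
exact: near_eq_derive (eq_on_near Uo Ux fk).
Qed.

Section Concircular.
Context {n : nat} (M : manifold R n) (g : lorentz_metric M) (Dg : connection M)
  (pi : covector_field M) (P : vector_field M).
Hypothesis LC : levi_civita g Dg.
Hypothesis assoc : associated_vector g pi P.
Hypothesis conc : concircular g Dg pi.
Hypothesis unitP : unit_timelike g P.
Context (c : chart R n M).
Hypothesis ac : atlas c.

Lemma associated_pointwise (v x : 'rV[R]_n) : cimg c x ->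
  (pi c x *m v^T) 0 0 = (v *m g c x *m (P c x)^T) 0 0.
Proof. by move=> cx; have := assoc ac (constant_field c v) cx. Qed.

Lemma pairing_unit x : cimg c x -> \sum_i P c x 0 i * pi c x 0 i = -1.
Proof.
move=> cx; rewrite -(unitP ac cx) -(assoc ac (vf_smooth P ac) cx) /pairing mxE.
by apply: eq_bigr => i _; rewrite mxE mulrC.
Qed.

Lemma coordinate_torsion x i j : cimg c x -> Dg c x i j = Dg c x j i.
Proof.
move=> cx; have := LC.1 c ac _ _ (constant_field c (e_ i)) (constant_field c (e_ j)) x cx.
rewrite /bracket !derive_cst subrr !nabla_coordinate => /eqP.
by rewrite subr_eq0 => /eqP.
Qed.

Lemma concircular_coordinate x : cimg c x -> exists w : R, forall i j,
  'D_(e_ i) (fun y => pi c y 0 j) x - (pi c x *m (Dg c x i j)^T) 0 0 -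
    pi c x 0 i * pi c x 0 j = w * g c x i j.
Proof.
move=> cx; have [w Hw] := conc; exists (w (cinv c x)) => i j.
have := Hw c ac _ _ (constant_field c (e_ i)) (constant_field c (e_ j)) x cx.
rewrite inner_coordinate !pairing_coordinate => <-.
rewrite /nabla_covector /deriv_along /pairing nabla_coordinate.
have -> // : (fun y => (pi c y *m (e_ j)^T) 0 0) = (fun y => pi c y 0 j).
by apply/funext => y; rewrite -pairing_coordinate.
Qed.

(** By concircularity nabla pi is the symmetric tensor pi pi + w g, and
    without torsion the alternating part of nabla pi is dpi. *)
Lemma closed_form x i j : cimg c x ->
  'D_(e_ i) (fun y => pi c y 0 j) x = 'D_(e_ j) (fun y => pi c y 0 i) x.
Proof.
move=> cx; have [w Hw] := concircular_coordinate cx.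
have gs : g c x i j = g c x j i by rewrite -[in LHS](g_sym g ac cx) mxE.
have := Hw i j; rewrite gs -(Hw j i) (coordinate_torsion i j cx).
by rewrite (mulrC (pi c x 0 i)) => /addIr/addIr.
Qed.

Context (i0 : 'I_n).
Hypothesis PE : forall x, cimg c x -> P c x = e_ i0.
Hypothesis piE : forall x, cimg c x -> pi c x = - e_ i0.

Lemma metric_row x j : cimg c x -> g c x j i0 = - (j == i0)%:R.
Proof.
move=> cx; have := associated_pointwise (e_ j) cx.
rewrite PE// piE// -[X in _ = X]/(inner g c (fun=> e_ j) (fun=> e_ i0) x).
rewrite inner_coordinate => <-.
rewrite mxE (bigD1 j)//= big1 ?addr0; last first.
  by move=> k kj; rewrite !mxE eqxx/= (negbTE kj) mulr0.
by rewrite !mxE !eqxx/= mulr1.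
Qed.

(** This is the Lie derivative of g along P, namely 2 (g + pi pi).
    Concircularity says that nabla_X P = w X + pi(X) P; as g(P, P) is
    constant, X = P gives w = 1, and the derivative of g_ij along P is
    g(nabla_i P, e_j) + g(e_i, nabla_j P), since P is a coordinate field and
    there is no torsion. *)
Lemma metric_derivative x i j : cimg c x ->
  'D_(e_ i0) (fun y => g c y i j) x = 2 * (pi c x 0 i * pi c x 0 j + g c x i j).
Proof.
move=> cx; have Co := @cimg_open _ _ _ c.
have [w Hw] := concircular_coordinate cx.
have gs y a b : cimg c y -> g c y a b = g c y b a.
  by move=> cy; rewrite -[in LHS](g_sym g ac cy) mxE.
(* The left side is g(nabla_a P, e_b), because the lower indices of the
   connection coefficients are symmetric and P is the i0-th coordinate field. *)
have half a b : (Dg c x i0 a *m g c x *m (e_ b)^T) 0 0 =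
    pi c x 0 a * pi c x 0 b + w * g c x a b.
  rewrite coordinate_torsion//.
  have MC := LC.2 c ac _ _ _ (constant_field c (e_ a)) (constant_field c (e_ i0))
    (constant_field c (e_ b)) x cx.
  have L0 : deriv_along (fun=> e_ a) (inner g c (fun=> e_ i0) (fun=> e_ b)) x = 0.
    apply: (derive_locally_constant _ Co _ cx) => y cy.
    by rewrite inner_coordinate gs// metric_row.
  have := Hw a b.
  have -> : 'D_(e_ a) (fun y => pi c y 0 b) x = 0.
    apply: (derive_locally_constant _ Co _ cx) => y cy.
    by rewrite piE// !mxE eqxx.
  rewrite sub0r (associated_pointwise _ cx) PE// => <-.
  rewrite addrCA subrr addr0.
  move: MC; rewrite L0 /inner !nabla_coordinate => /esym/eqP.
  rewrite addr_eq0 => /eqP ->; congr (- _).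
  exact: form_sym (g_sym g ac cx).
(* The derivative of g(P, P) = -1 along P is 2 (1 - w). *)
have w1 : w = 1.
  have MC := LC.2 c ac _ _ _ (constant_field c (e_ i0)) (constant_field c (e_ i0))
    (constant_field c (e_ i0)) x cx.
  have L0 : deriv_along (fun=> e_ i0) (inner g c (fun=> e_ i0) (fun=> e_ i0)) x = 0.
    apply: (derive_locally_constant _ Co _ cx) => y cy.
    by rewrite inner_coordinate metric_row// eqxx.
  move: MC; rewrite L0 /inner !nabla_coordinate half.
  rewrite (form_sym _ (Dg c x i0 i0) (g_sym g ac cx)).
  rewrite half metric_row// piE// !mxE !eqxx/= => E.
  by lra.
have MC := LC.2 c ac _ _ _ (constant_field c (e_ i0)) (constant_field c (e_ i))
    (constant_field c (e_ j)) x cx.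
move: MC; rewrite /inner !nabla_coordinate half.
rewrite (form_sym _ (Dg c x i0 j) (g_sym g ac cx)).
rewrite half w1 /deriv_along.
have -> : (fun y => (e_ i *m g c y *m (e_ j)^T) 0 0) = (fun y => g c y i j).
  by apply/funext => y; rewrite -[RHS](inner_coordinate g c i j y).
by move=> ->; rewrite (gs x j i cx); ring.
Qed.

End Concircular.

End Geometry.

(** * Adapted charts *)

Section AdaptedChart.
Context {R : realType} {m : nat}.
Opaque smooth_on.
Local Notation e_ i := (delta_mx (0 : 'I_1) i).

(** Apply straightening to P and w = - pi, which is closed and takes the
    value 1 on P as pi(P) = g(P, P) = -1. *)
Lemma adapted_chart (M : manifold R m.+1) (g : lorentz_metric M) (Dg : connection M)
    (pi : covector_field M) (P : vector_field M) (p : M) :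
  levi_civita g Dg -> associated_vector g pi P -> concircular g Dg pi ->
  unit_timelike g P ->
  exists2 a : R, 0 < a & exists c : chart R m.+1 M,
    [/\ atlas c, cdom c p, cimg c = cylinder a (cube (0 : 'rV[R]_m) a),
      forall z, cimg c z -> P c z = e_ (@lshift 1 m 0) &
      forall z, cimg c z -> pi c z = - e_ (@lshift 1 m 0)].
Proof.
move=> LC assoc conc unitP.
have [c ac cp] := atlas_cover p.
have Co : open (cimg c) := @cimg_open _ _ _ c.
have piS := cf_smooth pi ac; have PS := vf_smooth P ac.
have cx0 : cimg c (cmap c p) by exists p.
pose w x := - pi c x.
have wjE j : (fun y => w y 0 j) = (fun y => - pi c y 0 j).
  by apply/funext => y; rewrite mxE.
have wS : smooth_on (cimg c) w.
  apply: (smooth_rowP _ Co).2 => j; rewrite wjE.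
  by apply: smooth_opp; [exact: Co|exact: (smooth_rowP _ Co).1].
have wcl x : cimg c x -> forall i j, 'D_(e_ i) (fun y => w y 0 j) x =
     'D_(e_ j) (fun y => w y 0 i) x.
  move=> cx i j; rewrite !wjE.
  have dj k l : derivable (fun y => pi c y 0 l) x (e_ k).
    exact: smooth_derivable ((smooth_rowP _ Co).1 piS l) cx.
  rewrite (deriveN (dj i j)) (deriveN (dj j i)); congr (- _).
  exact: (closed_form LC conc ac).
have Pw x : cimg c x -> \sum_i P c x 0 i * w x 0 i = 1.
  move=> cx; rewrite -[RHS]opprK -(pairing_unit assoc unitP ac cx) -sumrN.
  by apply: eq_bigr => i _; rewrite mxE mulrN.
have [a a0 [Q [Psi [Phi]]]] := straightening Co cx0 PS wS wcl Pw.
set B := cylinder a _ => -[[Qo Qc Qp] [PsiS PhiS] PsiK PhiK [PhiP dT]].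
have Bo : open B := @cylinder_open R m a _ (@cube_open R m 0 a).
have [c' [ac' dom' map' inv' img']] := refined_chart ac Qo Bo Qc PsiS PhiS PsiK PhiK.
exists a => //; exists c'.
have sub : cdom c' `<=` cdom c by rewrite dom' => q [].
have trE z : B z -> transition c' c z = Phi z.
  move=> Bz; rewrite /transition inv' /=.
  exact: (cinvK (Qc _ (PhiK z Bz).1)).2.
have ov z : B z -> overlap c' c z.
  by move=> Bz; apply: overlap_refine; [exact: sub|rewrite img'].
have JE z v : B z -> 'D_v Phi z = v *m jacobian (transition c' c) z.
  move=> Bz; rewrite -(transition_jacobian v ac' ac (ov z Bz)).
  apply: near_eq_derive; apply: (eq_on_near Bo Bz) => y By.
  by rewrite trE.
have Ju z : B z -> jacobian (transition c' c) z \in unitmx.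
  move=> Bz; have cz : cimg c' z by rewrite img'.
  have := lorentzian_unit (g_lorentzian g ac' cz).
  by rewrite (g_law g ac' ac (ov z Bz)) /= !unitmx_mul => /andP[/andP[]].
split=> //.
- by rewrite dom'; split.
- rewrite img' => z Bz.
  have := vf_law P ac' ac (ov z Bz); rewrite trE//.
  have [_ <-] := PhiP z Bz.
  rewrite JE// => E.
  by rewrite -[LHS](mulmxK (Ju z Bz)) -E mulmxK// Ju.
- rewrite img' => z Bz; rewrite (cf_law pi ac' ac (ov z Bz)) trE//.
  apply/rowP => i; rewrite mxE.
  have Qz := (PhiK z Bz).1.
  have TS : smooth_on Q (fun q => lsubmx (Psi q : 'rV[R]_(1 + m)) 0 0).
    have -> : (fun q => lsubmx (Psi q : 'rV[R]_(1 + m)) 0 0) =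
        (fun q => Psi q 0 (@lshift 1 m 0)).
      by apply/funext => q; rewrite mxE.
    exact: (smooth_rowP _ Qo).1.
  have PhiD k : is_derive z (e_ i) (fun y => Phi y 0 k) ('D_(e_ i) Phi z 0 k).
    have D : derivable Phi z (e_ i) by exact: smooth_derivable PhiS Bz.
    by have /is_derive_rowP := derivableP D; exact.
  have := @is_derive_chain R m.+1 'rV[R]_m.+1 
    (fun q => lsubmx (Psi q : 'rV[R]_(1 + m)) 0 0) Phi z (e_ i)
    (fun k => 'D_(e_ i) Phi z 0 k) (smooth_C1 Qo TS Qz) PhiD.
  move=> [_ E].
  have E2 : 'D_(e_ i) ((fun q => lsubmx (Psi q : 'rV[R]_(1 + m)) 0 0) \o Phi) z =
      (i == @lshift 1 m 0)%:R.
    have -> : 'D_(e_ i) ((fun q => lsubmx (Psi q : 'rV[R]_(1 + m)) 0 0) \o Phi) z =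
        'D_(e_ i) (fun y : 'rV[R]_m.+1 => y 0 (@lshift 1 m 0)) z.
      apply: near_eq_derive; apply: (eq_on_near Bo Bz) => y By.
      by rewrite /= (PhiK y By).2 mxE.
    by have [_ ->] := is_derive_coord z (e_ i) (@lshift 1 m 0); rewrite !mxE eqxx/= eq_sym.
  rewrite !mxE eqxx/= -E2 E -sumrN; apply: eq_bigr => k _.
  have [_ ->] := dT (Phi z) k Qz.
  rewrite JE// -rowE !mxE mulrN opprK; exact: mulrC.
Qed.

End AdaptedChart.

(** * The warped product form *)

Section Warped.
Context {R : realType} {m : nat}.
Opaque smooth_on.
Local Notation e_ i := (delta_mx (0 : 'I_1) i).

Lemma derive1n_expR k : derive1n k (@expR R) = @expR R.
Proof.
elim: k => [|k IH]; first by [].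
rewrite derive1nS IH; apply/funext => x; rewrite derive1E.
by have [_ ->] := is_derive_expR x.
Qed.

(** The scale factor is the exponential function, whence its square here. *)
Lemma exponential_growth (a : R) (f : R -> R) :
  (forall t : R, `|t| < a -> is_derive t 1 f (2 * f t)) ->
  forall t, `|t| < a -> f t = expR t ^+ 2 * f 0.
Proof.
move=> fd t ta.
have : f t * expR (- 2 * t) = f 0 * expR (- 2 * 0).
  apply/esym; apply: (@eq_is_derive R (fun=> f 0 * expR (- 2 * 0))
    (fun s => f s * expR (- 2 * s)) (fun=> 0) 0 t) => // s /andP[s0 s1].
  split; first exact: is_derive_cst.
  rewrite add0r subr0; set u := s * t.
  have ua : `|u| < a.
    by rewrite /u normrM ger0_norm// (le_lt_trans _ ta)// ler_piMl.
  have d3 : is_derive u 1 (fun s : R => - 2 * s) (- 2 : R).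
    have := @is_deriveZ R R R id (- 2) u 1 1 (is_derive_id _ _).
    by rewrite [_%:A]mulr1.
  have d4 := @is_derive1_comp R (@expR R) (fun t => - 2 * t) u _ _ (is_derive_expR _) d3.
  have := @is_deriveM R R f _ u 1 _ _ (fd u ua) d4.
  congr (is_derive _ _ _ _); rewrite !scale_mul /=; ring.
rewrite mulr0 expR0 mulr1 => <-.
rewrite mulrCA mulNr expRN -expRM_natl.
by rewrite mulfV ?mulr1// gt_eqF// expR_gt0.
Qed.

(** In the adapted chart pi = - dt, so the first row of g is (-1, 0). The
    other entries satisfy dg_ij/dt = 2 g_ij by metric_derivative, hence are
    exp(2t) times their values h on the slice t = 0. *)
Lemma adapted_warped (M : manifold R m.+1) (g : lorentz_metric M) (Dg : connection M)
    (pi : covector_field M) (P : vector_field M) (c : chart R m.+1 M) (a : R) :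
  levi_civita g Dg -> associated_vector g pi P -> concircular g Dg pi ->
  unit_timelike g P ->
  0 < a -> atlas c -> cimg c = cylinder a (cube (0 : 'rV[R]_m) a) ->
  (forall z, cimg c z -> P c z = e_ (@lshift 1 m 0)) ->
  (forall z, cimg c z -> pi c z = - e_ (@lshift 1 m 0)) ->
  warped_chart g c.
Proof.
move=> LC assoc conc unitP a0 ac img PE piE.
pose V := cube (0 : 'rV[R]_m) a.
have Vo : open V := @cube_open R m 0 a.
have Co : open (cimg c) := @cimg_open _ _ _ c.
have gS := g_smooth g ac.
have gE i j z : cimg c z -> g c z j i = g c z i j.
  by move=> cz; rewrite -[in LHS](g_sym g ac cz) mxE.
have row0 j z : cimg c z -> g c z j (@lshift 1 m 0) = - (j == @lshift 1 m 0)%:R.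
  exact: (metric_row assoc ac PE piE).
have deriv i j z : cimg c z ->
    'D_(e_ (@lshift 1 m 0)) (fun y => g c y i j) z =
    2 * (pi c z 0 i * pi c z 0 j + g c z i j).
  exact: (metric_derivative LC assoc conc ac PE piE).
have neq0 (j : 'I_m) : ((rshift 1 j : 'I_m.+1) == @lshift 1 m 0) = false.
  by apply/eqP => /(congr1 val).
pose sl (y : 'rV[R]_m) : 'rV[R]_(1 + m) := row_mx 0 y.
have slV y : V y -> cimg c (sl y).
  move=> Vy; rewrite img; split; last by rewrite /sl row_mxKr.
  by rewrite /sl row_mxKl mxE normr0.
pose h (y : 'rV[R]_m) : 'M[R]_m := drsubmx (g c (sl y) : 'M[R]_(1 + m)).
have block z : cimg c z -> g c z = block_mx (- 1%:M) 0 0 (drsubmx (g c z : 'M[R]_(1 + m)))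
    :> 'M[R]_(1 + m).
  move=> cz; rewrite -[LHS](@submxK _ 1 m 1 m); congr block_mx.
  - apply/matrixP => i j; rewrite (ord1 i) (ord1 j) 2!mxE row0// !mxE.
    by rewrite eqxx.
  - apply/matrixP => i j; rewrite (ord1 i) 2!mxE gE// row0// mxE.
    by rewrite neq0 oppr0.
  - apply/matrixP => i j; rewrite (ord1 j) 2!mxE row0// mxE.
    by rewrite neq0 oppr0.
exists [set t | `|t| < a], V, expR, h; split.
- split.
    apply: (@open_comp _ _ (fun y : R => `|y|) [set x | x < a]) => [y _|];
      [exact: norm_continuous|exact: open_lt].
  move=> x y /= xa ya z /andP[xz zy].
  rewrite ltr_norml; apply/andP; split.
    by apply: lt_le_trans xz; move: xa; rewrite ltr_norml => /andP[].
  by apply: le_lt_trans zy _; move: ya; rewrite ltr_norml => /andP[].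
- move=> t _; split; first exact: expR_gt0.
  by move=> k; rewrite derive1n_expR; have [] := is_derive_expR t.
- split; first exact: Vo.
  split.
  + apply: (smooth_coordP _ Vo).2 => i j.
    have -> : (fun y => h y i j) = (fun y => g c y (rshift 1 i) (rshift 1 j)) \o sl.
      by apply/funext => y; rewrite /h /= !mxE.
    apply: (smooth_comp Vo Co slV).
      exact: (smooth_coordP _ Co).1.
    have -> : sl = (fun y => y *m row_mx 0 1%:M + 0).
      by apply/funext => y; rewrite mul_mx_row mulmx0 mulmx1 addr0.
    exact: smooth_affine.
  + move=> y Vy; apply/matrixP => i j; rewrite !mxE.
    exact: gE (slV y Vy).
  + move=> y Vy; apply: spacelike_complement.
    have := g_lorentzian g ac (slV y Vy); rewrite (block _ (slV y Vy)) /h.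
    exact.
- by rewrite img.
- move=> z cz; rewrite {1}(block z cz); congr (block_mx _ _ _ _).
  apply/matrixP => i j.
  have drE (A : 'M[R]_(1 + m)) : drsubmx A i j = A (rshift 1 i) (rshift 1 j).
    by rewrite 2!mxE.
  rewrite drE [RHS]mxE /h drE.
  move: (cz); rewrite img => -[z1 z2].
  pose f (t : R) :=
    g c (sl (rsubmx (z : 'rV[R]_(1 + m))) + t *: e_ (@lshift 1 m 0)) (rshift 1 i) (rshift 1 j).
  have pt (t : R) : sl (rsubmx (z : 'rV[R]_(1 + m))) + t *: e_ (@lshift 1 m 0) =
      row_mx (\row_(_ < 1) t) (rsubmx (z : 'rV[R]_(1 + m))).
    apply/rowP => k; rewrite mxE [X in _ + X]mxE [X in _ * X]mxE.
    case: (split_ordP k) => l ->.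
      by rewrite !row_mxEl (ord1 l) !eqxx/= mulr1 !mxE add0r.
    by rewrite !row_mxEr neq0 andbF mulr0 addr0.
  have fE : g c z (rshift 1 i) (rshift 1 j) = f (lsubmx (z : 'rV[R]_(1 + m)) 0 0).
    suff zE : z = row_mx (\row_(_ < 1) (lsubmx (z : 'rV[R]_(1 + m)) 0 0))
        (rsubmx (z : 'rV[R]_(1 + m))) by rewrite /f (pt (lsubmx _ 0 0)) -zE.
    rewrite -[LHS](@hsubmxK _ 1 1 m); congr row_mx.
    by apply/rowP => l; rewrite [RHS]mxE (ord1 l).
  have f0 : g c (sl (rsubmx (z : 'rV[R]_(1 + m)))) (rshift 1 i) (rshift 1 j) = f 0.
    by rewrite /f scale0r addr0.
  rewrite fE f0; apply: (@exponential_growth a f) => // t ta.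
  have ct : cimg c (row_mx (\row_(_ < 1) t) (rsubmx (z : 'rV[R]_(1 + m)))).
    by rewrite img; split; rewrite ?row_mxKr ?row_mxKl ?mxE.
  apply: (is_derive_line (fun y => g c y (rshift 1 i) (rshift 1 j))
    (sl (rsubmx (z : 'rV[R]_(1 + m)))) (e_ (@lshift 1 m 0)) t _).1.
  rewrite /f pt.
  have D : derivable (fun y => g c y (rshift 1 i) (rshift 1 j))
      (row_mx (\row_(_ < 1) t) (rsubmx (z : 'rV[R]_(1 + m)))) (e_ (@lshift 1 m 0)).
    exact: smooth_derivable ((smooth_coordP _ Co).1 gS _ _) ct.
  apply: is_derive_eq (derivableP D) _.
  have pi0 : pi c (row_mx (\row_(_ < 1) t) (rsubmx (z : 'rV[R]_(1 + m)))) 0 (rshift 1 i) = 0.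
    by rewrite (piE _ ct) 2!mxE neq0 andbF oppr0.
  by apply: etrans (deriv _ _ _ ct) _; rewrite pi0 mul0r add0r.
Qed.

End Warped.

(* The dimension n of the statement is m.+1. *)
Theorem corollary3p1 (R : realType) (m : nat) (dim_ge3 : (3 <= m.+1)%N)
    (M : manifold R m.+1) (g : lorentz_metric M) (Dg D1 : connection M)
    (pi : covector_field M) (P : vector_field M) :
  levi_civita g Dg ->
  associated_vector g pi P ->
  concircularly_semi_symmetric_metric g Dg pi P D1 ->
  unit_timelike g P ->
  is_GRW g.
Proof.
move=> LC assoc [_ conc] unitP p.
have [a a0 [c [ac cp img PE piE]]] := adapted_chart p LC assoc conc unitP.
exists c; split=> //.
exact: (adapted_warped LC assoc conc unitP a0 ac img PE piE).
Qed.
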